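(* For primes $p\equiv 1\pmod 4$ and any integer $n$ with $\gcd(n,p)=1$, $$\sum_{\chi\neq\chi_0}|G(n,\chi;p)|^6\cdot|L(1,\chi)|=10\cdot C\cdot p^4+O(p^{7/2}\ln p),$$ where the sum runs over all non-principal Dirichlet characters $\chi$ modulo $p$, and the implied constant is absolute (independent of $p$ and $n$).
   Context: For a prime $p$, an integer $n$ and a Dirichlet character $\chi$ modulo $p$, the generalized quadratic Gauss sum is $G(n,\chi;p)=\sum_{a=1}^{p}\chi(a)e\!\left(\frac{na^2}{p}\right)$ with $e(y)=e^{2\pi i y}$. $\chi_0$ is the principal character modulo $p$, and $L(s,\chi)$ is the Dirichlet $L$-function of $\chi$. The constant $C$ is $$C=\prod_{q}\left[\sum_{m=0}^{\infty}\frac{\binom{2m}{m}^2}{4^{2m}q^{2m}}\right]=\prod_q\left[1+\frac{\binom{2}{1}^2}{4^2q^2}+\frac{\binom{4}{2}^2}{4^4q^4}+\cdots\right],$$ the product over all primes $q$. *)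

(* Defs.v *)
From Stdlib Require Import Reals ZArith Znumtheory Arith List.
From Coquelicot Require Import Coquelicot.
Open Scope R_scope.

Definition e_ (y : R) : C := (cos (2 * PI * y), sin (2 * PI * y)).

(* Dirichlet characters modulo p, viewed on nonnegative integers
   (a Dirichlet character on Z is determined by its values on N by periodicity). *)
Definition is_dchar (p : nat) (chi : nat -> C) : Prop :=
  (forall a : nat, chi (a + p)%nat = chi a) /\
  (forall a b : nat, chi (a * b)%nat = Cmult (chi a) (chi b)) /\
  chi 1%nat = RtoC 1 /\
  (forall a : nat, chi a = RtoC 0 <-> Nat.gcd a p <> 1%nat).

Definition principal_char (p : nat) : nat -> C :=
  fun a => if Nat.eqb (Nat.gcd a p) 1 then RtoC 1 else RtoC 0.

Definition gauss_sum (n : Z) (chi : nat -> C) (p : nat) : C :=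
  sum_n (fun k : nat =>
           Cmult (chi (S k)) (e_ (IZR n * INR (S k * S k) / INR p))) (p - 1).

Definition L1_partial (chi : nat -> C) (N : nat) : C :=
  sum_n (fun k : nat => Cdiv (chi (S k)) (RtoC (INR (S k)))) N.

(* L(1, chi) as the limit of the (convergent, for chi non-principal) series. *)
Definition L1 (chi : nat -> C) : C :=
  (real (Lim_seq (fun N => Re (L1_partial chi N))),
   real (Lim_seq (fun N => Im (L1_partial chi N)))).

Definition C_factor (q : nat) : R :=
  Series (fun m : nat =>
            (Binomial.C (2 * m) m) ^ 2 / (4 ^ (2 * m) * (INR q) ^ (2 * m))).

Fixpoint C_partial (N : nat) : R :=
  match N with
  | O => 1
  | S M => C_partial M *
           (if prime_dec (Z.of_nat (S M)) then C_factor (S M) else 1)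
  end.

Definition C_const : R := real (Lim_seq C_partial).

Definition char_sum (n : Z) (p : nat) (l : list (nat -> C)) : R :=
  fold_right (fun chi acc =>
                (Cmod (gauss_sum n chi p)) ^ 6 * Cmod (L1 chi) + acc) 0 l.

(* Main.v *)
(* For a non-principal character chi one has
   |G(n,chi)|^2 = p (1 + chi(-1)) + (n|p) g S(chi), where g^2 = p and S(chi) is the
   sum of chi(a) ((a^2-1)|p) over a; in particular |G|^2 <= 4p.

   On average |L(1,chi)| is |P(chi)|^2, where P(chi) is the sum of r(n) chi(n) / n
   over n < p and the r(n) are the coefficients of the square root of zeta: the
   series L(1,chi) and P(chi)^2 have the same coefficients below p, so that the
   mean square of L(1,chi) - P(chi)^2 over chi is O(log^2 p / p) by orthogonality.

   Expanding |G|^6 |P|^2 and using orthogonality again leaves the values at n/m of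
   4p^3 D + 12p^2 c v + 6p^2 (v*v) + pc (v*v*v), where v(a) = ((a^2-1)|p),
   D(a) = 1 if a^2 = 1 and 0 otherwise, c = +-sqrt p, and * is the multiplicative
   convolution. At +-1 this is 10p^3 + O(p^(5/2)), which yields the main term
   because C is the sum of r(n)^2 / n^2. Everywhere else it is O(p^(5/2)): v*v is a
   character sum of a cubic, bounded by Stepanov's method, and v*v*v is reduced to
   the square of such a sum by a finite-field form of Clausen's formula. *)

Require Import Defs.
From Stdlib Require Import Reals ZArith Znumtheory Arith List.
From Coquelicot Require Import Coquelicot.
From Stdlib Require Lra Lia Permutation FunctionalExtensionality.
From HB Require structures.
From mathcomp Require all_boot all_order all_algebra all_fingroup all_solvable all_field.
From mathcomp Require Rstruct zify ring lra.
Open Scope R_scope.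

(** The obstacle is that $|L(1,\chi)|$ is not linear in characters, so orthogonality does not apply
    to it; with the square root of zeta it becomes [half_poly j] times its conjugate, a finite
    expression in characters. The cut at $p$ serves two purposes: nonzero indices $k, m < p$ satisfy
    $k \equiv \pm m$ only for $k = m$ or $k = p - m$, and the square of the truncated series agrees
    with $L(1,\chi)$ below $p$. Two errors of order $p^{7/2} \ln p$ arise. The defect costs $\sqrt p
    \ln p$ after summation over the characters, against $|G|^6 \le 64 p^3$. The kernel outside $\pm
    1$ costs $p \cdot p^{5/2}$ times the square of the sum of $r(n)/n$, which is a single logarithm.
    So $v*v$ must be $O(\sqrt p)$ and $v*v*v$ must be $O(p)$; the latter is a double sum, and
    estimating one variable at a time would lose a factor $\sqrt p$, which is why Clausen's formula
    enters. The coefficient 10 is $4 + 6$: the cube of $1 + \chi(-1)$ is $4(1 + \chi(-1))$, and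
    $v*v$ equals $p - 3$ at $\pm 1$. The congruence $p \equiv 1 \pmod 4$ makes $-1$ a square, so
    that [legendre] is even and the quadratic Gauss sum is real. *)

Module SixthMoment.

Import structures Permutation FunctionalExtensionality.
Import all_boot all_order all_algebra all_fingroup all_solvable all_field.
Import Rstruct zify ring lra.
Import Order.TTheory GRing.Theory Num.Theory.
Set Implicit Arguments. Unset Strict Implicit. Unset Printing Implicit Defensive.
Local Open Scope ring_scope.
Bind Scope ring_scope with C.
Bind Scope ring_scope with R.

(** * Stepanov's method *)

Section Stepanov.
Variables (F : finFieldType) (p : nat) (charF : p \in [pchar F]) (cardF : #|F| = p).

Lemma pchar_natr_neq0 (n : nat) : (0 < n < p)%N -> n%:R != 0 :> F.
Proof.
move=> /andP[n0 np]; rewrite -(dvdn_pcharf charF).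
by apply/negP => /(dvdn_leq n0); rewrite leqNgt np.
Qed.

Lemma dvdp_exp_deriv (r : {poly F}) (a : F) (l : nat) :
  (l < p)%N -> r.[a] = 0 -> ('X - a%:P) ^+ l %| r^`() -> ('X - a%:P) ^+ l.+1 %| r.
Proof.
move=> lp ra dr.
suff H k : (k <= l)%N -> ('X - a%:P) ^+ k.+1 %| r by exact: H.
elim: k => [_|k IH kl]; first by rewrite expr1 dvdp_XsubCl; apply/rootP.
have /dvdpP[u ru] := IH (ltnW kl).
have D : r^`() = ('X - a%:P) ^+ k * (u *+ k.+1 + ('X - a%:P) * u^`()).
  rewrite ru derivM deriv_exp derivXsubC mul1r /= exprS -[_ *+ k.+1 in LHS]mulr_natl -[u *+ k.+1]mulr_natl.
  by ring.
have : ('X - a%:P) ^+ k.+1 %| r^`() by apply: dvdp_trans dr; apply: dvdp_exp2l.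
rewrite D exprSr dvdp_mul2l; last by rewrite expf_neq0 // polyXsubC_eq0.
rewrite dvdp_addl; last by rewrite dvdp_mulIl.
rewrite -scaler_nat dvdpZr; last by apply: pchar_natr_neq0; apply: leq_ltn_trans lp.
by move=> du; rewrite ru exprS mulrC [X in _ %| X]mulrC dvdp_mul2l // expf_neq0 // polyXsubC_eq0.
Qed.

Lemma dvdp_exp_derivn (r : {poly F}) (a : F) (l : nat) :
  (l <= p)%N -> (forall i, (i < l)%N -> (r^`(i)).[a] = 0) ->
  ('X - a%:P) ^+ l %| r.
Proof.
elim: l r => [|l IH] r lp H; first by rewrite expr0 dvd1p.
apply: dvdp_exp_deriv => //; first exact: (H 0%N).
by apply: IH => [|i il]; [apply: ltnW | rewrite -derivSn; apply: H].
Qed.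

(** These powers are constants for the derivation. The auxiliary polynomial can therefore contain
    them, and have a large degree, without making its derivatives more complicated. *)
Lemma deriv_Xpn (j : nat) : ('X^(p * j) : {poly F})^`() = 0.
Proof.
by rewrite derivXn -mulr_natr natrM -polyC_natr (pcharf0 charF) mul0r mulr0.
Qed.

(* The cofactor left when [f ^+ e * k] is differentiated [i] times and
   [f ^+ (e - i)] is factored out. The exponent [e] is an element of [F] because
   the extra factor [f ^+ ((p - 1) / 2)] contributes [- 1 / 2] to it. *)
Fixpoint twisted_deriv (f : {poly F}) (e : F) (k : {poly F}) (i : nat) : {poly F} :=
  if i is i'.+1 then
    f * (twisted_deriv f e k i')^`() + (e - i'%:R) *: (f^`() * twisted_deriv f e k i')
  else k.

Lemma twisted_derivB f e k1 k2 i : twisted_deriv f e (k1 - k2) i = twisted_deriv f e k1 i - twisted_deriv f e k2 i.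
Proof.
elim: i => //= i ->; rewrite derivB !mulrBr scalerBr; ring.
Qed.

Lemma size_twisted_deriv (f : {poly F}) (e : F) (k : {poly F}) i n : (size f <= 4)%N -> (size k <= n)%N ->
  (size (twisted_deriv f e k i) <= n + 2 * i)%N.
Proof.
move=> sf; elim: i => [|i IH] sk /=; first by rewrite addn0.
have {}IH := IH sk.
have sd (q : {poly F}) : (size q^`() <= (size q).-1)%N.
  by have [->|/lt_size_deriv] := eqVneq q 0; [rewrite deriv0 size_poly0 | case: (size q)].
have sM (a b : {poly F}) : (size (a * b)%R <= (size a + size b).-1)%N by exact: size_polyMleq.
apply: leq_trans (size_polyD _ _) _; rewrite geq_max; apply/andP; split.
  have [->|d0] := eqVneq (twisted_deriv f e k i) 0; first by rewrite deriv0 mulr0 size_poly0.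
  have := lt_size_deriv d0; have := sM f (twisted_deriv f e k i)^`(); lia.
apply: leq_trans (size_scale_leq _ _) _.
have := sM f^`() (twisted_deriv f e k i); have := sd f; lia.
Qed.

Lemma derivn_twisted_deriv (f k : {poly F}) (l h j i : nat) : (i <= l)%N ->
  (f ^+ l * f ^+ h * k * 'X^(p * j))^`(i) =
  f ^+ (l - i) * f ^+ h * twisted_deriv f (l + h)%:R k i * 'X^(p * j).
Proof.
elim: i => [|i IH] il; first by rewrite subn0.
rewrite derivnS IH ?(ltnW il) //; set d := twisted_deriv _ _ _ i.
have [n ln] : exists n, (l - i = n.+1)%N by exists (l - i).-1; lia.
have ln' : (l - i.+1 = n)%N by lia.
rewrite ln ln' /= -/d.
(* Multiplying by [f] avoids the exponent [h - 1], so that [h = 0] is covered; both exponents, [0]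
   and [h], occur in the auxiliary polynomial. *)
have fg : f * (f ^+ h)^`() = h%:R * f^`() * f ^+ h.
  rewrite deriv_exp; case: (h) => [|h1]; first by rewrite mulr0n mul0r mulr0 mul0r.
  by rewrite /= exprS -mulr_natl; ring.
rewrite !derivM deriv_Xpn mulr0 addr0.
have -> : (f ^+ n.+1)^`() = n.+1%:R * f^`() * f ^+ n by rewrite deriv_exp /= -mulr_natl; ring.
have -> : (l + h)%:R - i%:R = (n.+1 + h)%:R :> F.
  by apply/eqP; rewrite subr_eq -natrD; apply/eqP; congr _%:R; lia.
rewrite -mul_polyC polyC_natr natrD.
transitivity ((n.+1%:R * f^`() * f ^+ n * f ^+ h * d + f ^+ n * (f * (f ^+ h)^`()) * d
   + f ^+ n * f * f ^+ h * d^`()) * 'X^(p * j)); first by rewrite exprS; ring.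
by rewrite fg; ring.
Qed.

(** Frobenius is additive on polynomials and fixes the constant term because [F] is the prime
    field. *)
Lemma poly_exp_p_mod (f : {poly F}) : exists h, f ^+ p = (f.[0])%:P + 'X^p * h.
Proof.
have charP : p \in [pchar {poly F}] by rewrite pchar_poly.
have [h fE] : exists h, f = (f.[0])%:P + 'X * h.
  have : 'X %| f - (f.[0])%:P by rewrite -[X in X %| _]subr0 dvdp_XsubCl /root !hornerE subrr.
  by case/dvdpP => h hE; exists h; rewrite mulrC -hE addrC subrK.
exists (h ^+ p); rewrite {1}fE -!(pFrobenius_autE charP) pFrobenius_autD_comm; last exact: mulrC.
rewrite !pFrobenius_autE -exprMn; congr (_ + _).
by rewrite -polyC_exp -[X in _ ^+ X]cardF expf_card.
Qed.

(** Parity of degrees: [f] has odd degree, so for nonzero [a] and [b] the left side has odd degree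
    and the right side even degree. *)
Lemma size_sqr_eq (f a b : {poly F}) (c : F) : ~~ odd (size f) -> f != 0 -> c != 0 ->
  f * a ^+ 2 = c%:P * b ^+ 2 -> a = 0 /\ b = 0.
Proof.
move=> of0 f0 c0 E.
have szs (q : {poly F}) : q != 0 -> odd (size (q ^+ 2)).
  by move=> q0; rewrite expr2 size_mul // addnn; move: q0; rewrite -size_poly_gt0; case: (size q) => // n _; rewrite doubleS /= odd_double.
have [a0|a0] := eqVneq a 0.
  split=> //; move: E; rewrite a0 expr0n mulr0 => /esym/eqP; rewrite mulf_eq0 polyC_eq0 (negPf c0) /=.
  by rewrite sqrf_eq0 => /eqP.
exfalso; have := congr1 (fun q : {poly F} => odd (size q)) E.
have a20 : a ^+ 2 != 0 by rewrite sqrf_eq0.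
rewrite size_mul // mul_polyC size_scale //.
have b0 : b != 0.
  apply: contra_eq_neq E => ->; rewrite expr0n mulr0; exact: mulf_neq0.
rewrite (szs b b0).
have := szs a a0; move: of0; rewrite -size_poly_gt0 in a20.
case: (size (a ^+ 2)) a20 => // n _; rewrite addnS /= oddD; by case: (odd n); case: (odd (size f)).
Qed.

(* Modulo ['X^p] the relation reads [f * a_0 ^+ 2 = f(0) * b_0 ^+ 2], with both
   sides of degree less than [p]; since [f] has odd degree, [a_0 = b_0 = 0], and
   a factor ['X^(2 p)] cancels. *)
Lemma sum_Xp_eq0 (f : {poly F}) (m : nat) : ~~ odd (size f) -> f.[0] != 0 ->
  (0 < m)%N -> ((size f + 2 * m).-2 <= p)%N -> forall (J : nat) (a b : nat -> {poly F}),
  (forall j, (j < J)%N -> (size (a j) <= m)%N /\ (size (b j) <= m)%N) ->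
  f * (\sum_(j < J) a j * 'X^(p * j)) ^+ 2 = f ^+ p * (\sum_(j < J) b j * 'X^(p * j)) ^+ 2 ->
  forall j, (j < J)%N -> a j = 0 /\ b j = 0.
Proof.
move=> of0 f00 m0 szm; have f0 : f != 0 by apply: contraNneq f00 => ->; rewrite horner0.
have [h fp] := poly_exp_p_mod f.
elim=> [//|J IH] a b szab.
have shift (c : nat -> {poly F}) : \sum_(j < J.+1) c j * 'X^(p * j) =
   c 0%N + 'X^p * \sum_(j < J) c j.+1 * 'X^(p * j).
  rewrite big_ord_recl muln0 expr0 mulr1; congr (_ + _).
  rewrite big_distrr /=; apply: eq_bigr => j _.
  by rewrite /bump /= mulnS exprD; ring.
rewrite !shift => E.
have E0 : f * a 0%N ^+ 2 = (f.[0])%:P * b 0%N ^+ 2.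
  apply/eqP; rewrite -subr_eq0.
  set A := \sum_(j < J) _ in E; set B := \sum_(j < J) _ in E.
  have D : 'X^p %| f * a 0%N ^+ 2 - (f.[0])%:P * b 0%N ^+ 2.
    apply/dvdpP; exists (h * (b 0%N + 'X^p * B) ^+ 2
       + (f.[0])%:P * (2 * b 0%N * B + 'X^p * B ^+ 2) - f * (2 * a 0%N * A + 'X^p * A ^+ 2)).
    move: E; rewrite fp; set c := (f.[0])%:P => E.
    apply/eqP; rewrite -subr_eq0; apply/eqP.
    transitivity (f * (a 0%N + 'X^p * A) ^+ 2 - (c + 'X^p * h) * (b 0%N + 'X^p * B) ^+ 2); first by ring.
    by rewrite E subrr.
  apply: contraT => n0; have := dvdp_leq n0 D; rewrite size_polyXn.
  have [sa sb] := szab 0%N isT.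
  have sM (u v : {poly F}) : (size (u * v)%R <= (size u + size v).-1)%N by exact: size_polyMleq.
  have s1 := sM f (a 0%N ^+ 2); have s2 := sM (f.[0])%:P (b 0%N ^+ 2).
  have s3 := sM (a 0%N) (a 0%N); have s4 := sM (b 0%N) (b 0%N).
  have s5 := size_polyD (f * a 0%N ^+ 2) (- ((f.[0])%:P * b 0%N ^+ 2)).
  rewrite size_polyN in s5; rewrite !expr2 in s1 s2 s5 *.
  have s6 : (size f > 1)%N by move: of0; have := f0; rewrite -size_poly_gt0; case: (size f) => [|[]].
  have s7 := size_polyC_leq1 f.[0].
  rewrite leqNgt => /negP[]; apply: leq_trans s5 _; rewrite geq_max.
  apply/andP; split.
    apply: leq_trans s1 _; move: (size (a 0%N * a 0%N)%R) s3 => s *; lia.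
  apply: leq_trans s2 _; move: (size (b 0%N * b 0%N)%R) (size (f.[0])%:P) s4 s7 => s s' *; lia.
have [a0 b0] := size_sqr_eq of0 f0 f00 E0.
have Xp0 : 'X^p ^+ 2 != 0 :> {poly F} by rewrite expf_neq0 // -size_poly_gt0 size_polyXn.
case=> [//|j] jJ; apply: (IH (fun j => a j.+1) (fun j => b j.+1)) => //.
  by move=> i iJ; apply: szab.
move: E; rewrite a0 b0 !add0r !exprMn => E; apply: (mulfI Xp0).
by rewrite mulrCA E; ring.
Qed.

Lemma prod_XsubC_exp_dvdp (r : {poly F}) (l : nat) (s : seq F) : uniq s ->
  (forall x, x \in s -> ('X - x%:P) ^+ l %| r) ->
  \prod_(x <- s) ('X - x%:P) ^+ l %| r.
Proof.
elim: s => [|x s IH] /=; first by rewrite big_nil dvd1p.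
move=> /andP[xs us] H; rewrite big_cons Gauss_dvdp ?H ?mem_head //=.
  by apply: IH => // y ys; apply: H; rewrite inE ys orbT.
rewrite coprimep_expl //; rewrite big_seq; apply: (big_ind (coprimep _)).
- exact: coprimep1.
- by move=> u v cu cv; rewrite coprimepMr cu.
move=> y ys; rewrite coprimep_expr // coprimep_XsubC root_XsubC.
by apply: contraNneq xs => <-.
Qed.

(** The relations use ['X^j] and the constant [a] where the auxiliary polynomial has ['X^(p * j)]
    and [f ^+ h]. They are imposed identically in ['X], after this reduction of the degree, so they
    amount to [l * B] equations whatever the number of points, against [2 * (e.+1 * m)] free
    coefficients. *)
Lemma stepanov_system (f : {poly F}) (a : F) (h l m e B : nat) :
  size f = 4%N -> (m + 2 * l + e < B)%N -> (l * B < 2 * (e.+1 * m))%N ->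
  exists k k' : nat -> {poly F},
  [/\ forall j, (size (k j) <= m)%N /\ (size (k' j) <= m)%N,
      exists2 j, (j < e.+1)%N & ~ (k j = 0 /\ k' j = 0)
    & forall i, (i < l)%N ->
      \sum_(j < e.+1) (twisted_deriv f (l + 0)%:R (k j) i + a *: twisted_deriv f (l + h)%:R (k' j) i) * 'X^j = 0].
Proof.
move=> sf hB lB.
pose S (k k' : nat -> {poly F}) i := \sum_(j < e.+1)
  (twisted_deriv f (l + 0)%:R (k j) i + a *: twisted_deriv f (l + h)%:R (k' j) i) * 'X^j.
pose K (M : 'M[F]_(e.+1, m)) (j : nat) := rVpoly (row (inord j) M).
have sK M j : (size (K M j) <= m)%N by apply: size_poly.
pose Phi (M : 'M[F]_(e.+1, m) * 'M[F]_(e.+1, m)) : 'M[F]_(l, B) :=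
  \matrix_(i < l) poly_rV (S (K M.1) (K M.2) i).
have sS (k k' : nat -> {poly F}) i : (forall j, (size (k j) <= m)%N /\ (size (k' j) <= m)%N) -> (i < l)%N ->
    (size (S k k' i) <= B)%N.
  move=> sk il; apply: leq_trans (size_sum _ _ _) _; apply/bigmax_leqP => j _.
  apply: leq_trans (size_polyMleq _ _) _; rewrite size_polyXn.
  have sf4 : (size f <= 4)%N by rewrite sf.
  have [sk1 sk2] := sk j.
  have := size_twisted_deriv (l + 0)%:R i sf4 sk1; have := size_twisted_deriv (l + h)%:R i sf4 sk2.
  set d1 := twisted_deriv _ _ _ _; set d2 := twisted_deriv _ _ _ _ => s1 s2.
  have s3 : (size (d2 + a *: d1)%R <= m + 2 * i)%N.
    apply: leq_trans (size_polyD _ _) _; rewrite geq_max s2 /=.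
    exact: leq_trans (size_scale_leq a d1) s1.
  move: (size (d2 + a *: d1)%R) s3 (ltn_ord j) => s *; lia.
(* Pigeonhole: there are more coefficient vectors than values of the system. *)
have /injectivePn [M1 [M2 M12 PhiE]] : ~~ injectiveb Phi.
  apply/injectiveP => inj; have := leq_card _ inj; rewrite card_prod !card_mx cardF -expnD.
  rewrite leq_exp2l; last by apply: prime_gt1; apply: pcharf_prime charF.
  lia.
have KB j : K (M1.1 - M2.1) j = K M1.1 j - K M2.1 j by rewrite /K !linearB.
have KB' j : K (M1.2 - M2.2) j = K M1.2 j - K M2.2 j by rewrite /K !linearB.
exists (K (M1.1 - M2.1)), (K (M1.2 - M2.2)); split.
- by move=> j; split; apply: sK.
- have : (M1.1 - M2.1 != 0) || (M1.2 - M2.2 != 0).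
    by rewrite !subr_eq0 -negb_and -xpair_eqE -!surjective_pairing.
  have nzK (M : 'M[F]_(e.+1, m)) : M != 0 -> exists2 j, (j < e.+1)%N & K M j <> 0.
    move=> M0; have /existsP[j jP] : [exists j : 'I_e.+1, K M j != 0].
      apply: contra_neqT M0 => /existsPn H; apply/row_matrixP => i; rewrite row0.
      have /negPn/eqP := H i; rewrite /K inord_val => /(congr1 (@poly_rV _ m)).
      by rewrite rVpolyK linear0.
    by exists j => //; apply/eqP.
  by move=> /orP[] /nzK [j jl jP]; exists j => // -[].
- move=> i il; have /(congr1 (row (Ordinal il))) := PhiE; rewrite !rowK => /(congr1 rVpoly) /=.
  rewrite !poly_rV_K ?sS // => E; transitivity (S (K M1.1) (K M1.2) i - S (K M2.1) (K M2.2) i).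
    rewrite -sumrB; apply: eq_bigr => j _; rewrite KB KB' !twisted_derivB scalerBr; ring.
  by rewrite E subrr.
Qed.

Lemma expf_card_mul (x : F) j : x ^+ (p * j) = x ^+ j.
Proof. by rewrite exprM -cardF expf_card. Qed.

(** Every point of the set is a root of multiplicity [2 * e] of [r], whose degree is at most about
    [p * e + 6 * e + 3 * h + m], and [3 * h + m <= 2 * p]. After division by [2 * e] the main term
    is [p / 2], the expected size. The condition [2 * m + 2 <= p] is the one of [sum_Xp_eq0] for a
    cubic. *)
Lemma stepanov_count (f : {poly F}) (a : F) (h m e : nat) :
  size f = 4%N -> f.[0] != 0 -> p = (2 * h).+1 -> (0 < m)%N -> (2 * m + 2 <= p)%N ->
  (10 * e ^ 2 + 2 * e < 2 * m)%N ->
  (#|[set x : F | f.[x] ^+ h == a]| * (2 * e) <= p * e + 2 * p + 6 * e)%N.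
Proof.
move=> sf f00 ph m0 mp em; set Z := [set x | _].
have f0 : f != 0 by rewrite -size_poly_eq0 sf.
have [k [k' [sk [j0 j0e nz0] sys]]] : exists k k' : nat -> {poly F},
  [/\ forall j, (size (k j) <= m)%N /\ (size (k' j) <= m)%N,
      exists2 j, (j < e.+1)%N & ~ (k j = 0 /\ k' j = 0)
    & forall i, (i < 2 * e)%N ->
      \sum_(j < e.+1) (twisted_deriv f (2 * e + 0)%:R (k j) i + a *: twisted_deriv f (2 * e + h)%:R (k' j) i) * 'X^j = 0].
  (* With [l = 2 * e] the degree bound [m + 2 * l + e] is [m + 5 * e], and the counting condition
     [l * B < 2 * (e.+1 * m)] becomes [10 * e ^ 2 + 2 * e < 2 * m]. *)
  apply: (stepanov_system a h (B := m + 5 * e + 1)) => //; first lia.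
  rewrite -mulnn in em; nia.
pose A := \sum_(j < e.+1) k j * 'X^(p * j).
pose A' := \sum_(j < e.+1) k' j * 'X^(p * j).
(* At a point of [Z] the [i]-th derivative of [r] is [f] to some power times the
   [i]-th relation of [sys], because [x ^+ p = x] and [f.[x] ^+ h = a]. *)
pose r := f ^+ (2 * e) * (A + f ^+ h * A').
have r0 : r != 0.
  apply/negP; rewrite mulf_eq0 expf_eq0 (negPf f0) andbF /= addr_eq0 => /eqP AE.
  apply: nz0; apply: (@sum_Xp_eq0 f m _ f00 m0 _ e.+1 k k') => //; rewrite ?sf //; first lia.
  (* If [r] were zero, then [A = - f ^+ h * A']; squaring and multiplying by [f] gives the relation
     that [sum_Xp_eq0] excludes, as [p = 2 h + 1]. *)
  have fp : f ^+ p = f * (f ^+ h) ^+ 2 by rewrite ph exprS mulnC exprM.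
  by rewrite -/A -/A' AE fp; ring.
have rZ x : x \in Z -> ('X - x%:P) ^+ (2 * e) %| r.
  rewrite inE => /eqP fx; apply: dvdp_exp_derivn => [|i il].
    rewrite -mulnn in em; nia.
  have -> : r = \sum_(j < e.+1) (f ^+ (2 * e) * f ^+ 0 * k j * 'X^(p * j)
                 + f ^+ (2 * e) * f ^+ h * k' j * 'X^(p * j)).
    rewrite big_split /r /A /A' mulrDr mulrA !big_distrr /=; congr (_ + _);
    apply: eq_bigr => j _; rewrite ?expr0; ring.
  rewrite raddf_sum horner_sum.
  transitivity (f.[x] ^+ (2 * e - i) * (\sum_(j < e.+1) (twisted_deriv f (2 * e + 0)%:R (k j) i
      + a *: twisted_deriv f (2 * e + h)%:R (k' j) i) * 'X^j).[x]); last by rewrite sys // horner0 mulr0.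
  rewrite horner_sum big_distrr /=; apply: eq_bigr => j _.
  rewrite derivnD !derivn_twisted_deriv ?(ltnW il) // expr0 !hornerE expf_card_mul fx.
  by rewrite /=; ring.
have /dvdp_leq : \prod_(x <- enum Z) ('X - x%:P) ^+ (2 * e) %| r.
  by apply: prod_XsubC_exp_dvdp => [|x]; rewrite ?enum_uniq // mem_enum; apply: rZ.
move/(_ r0); rewrite prodrXl.
have sZ : size (\prod_(x <- enum Z) ('X - x%:P)) = #|Z|.+1 by rewrite size_prod_XsubC cardE.
set q := (X in X ^+ _) in sZ *.
have q0 : q != 0 by rewrite -size_poly_gt0 sZ.
rewrite -[size (q ^+ _)]prednK ?size_exp ?sZ ?size_poly_gt0 ?expf_neq0 //=.
have sM (u v : {poly F}) : (size (u * v)%R <= (size u + size v).-1)%N by exact: size_polyMleq.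
have sE n : (size (f ^+ n) <= (3 * n).+1)%N by have := size_exp_leq f n; rewrite sf.
have sA (c : nat -> {poly F}) : (forall j, (size (c j) <= m)%N) ->
   (size (\sum_(j < e.+1) c j * 'X^(p * j))%R <= m + p * e)%N.
  move=> sc; apply: leq_trans (size_sum _ _ _) _; apply/bigmax_leqP => j _.
  apply: leq_trans (sM _ _) _; rewrite size_polyXn addnS /=; apply: leq_add => //.
  by rewrite leq_mul2l -ltnS ltn_ord orbT.
have s1 := sA k (fun j => (sk j).1); have s2 := sA k' (fun j => (sk j).2).
have s3 : (size (A + f ^+ h * A')%R <= 3 * h + (m + p * e))%N.
  apply: leq_trans (size_polyD _ _) _; rewrite geq_max; apply/andP; split.
    by apply: leq_trans s1 _; lia.
  apply: leq_trans (sM _ _) _; have := sE h; rewrite -/A' in s2; lia.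
have := sM (f ^+ (2 * e)) (A + f ^+ h * A'); have := sE (2 * e)%N; rewrite -/r => s4 s5 s6.
move: (size r) s5 s6 => sr s5 s6; move: (size (f ^+ (2 * e))) s4 s5 => sx s4 s5.
move: (size (A + f ^+ h * A')%R) s5 s3 => sy s5 s3.
lia.
Qed.

End Stepanov.

(** * The quadratic character of a finite field *)

Section QuadraticCharacter.
Variables (F : finFieldType) (h : nat) (charF : (2 * h).+1 \in [pchar F]) (cardF : #|F| = (2 * h).+1).
Local Notation p := (2 * h).+1.

(** Euler's criterion serves as the definition, which makes the level sets of [f ^+ h] counted by
    Stepanov's method directly relevant. The values are integers, so that sums are estimated in
    [int]. *)
Definition legendre (x : F) : int :=
  if x == 0 then 0 else if x ^+ (#|F|./2) == 1 then 1 else -1.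

Lemma half_cardF : #|F|./2 = h. Proof. by rewrite cardF; lia. Qed.

Lemma h_gt0 : (0 < h)%N.
Proof. have := prime_gt1 (pcharf_prime charF); lia. Qed.

Lemma two_neq0 : 2%:R != 0 :> F.
Proof. by apply: (pchar_natr_neq0 charF); have := h_gt0; lia. Qed.

Lemma expf_half_sqr (x : F) : x != 0 -> (x ^+ h == 1) || (x ^+ h == -1).
Proof.
move=> x0; rewrite -sqrf_eq1 -exprM mulnC.
apply/eqP; apply: (mulfI x0); rewrite -exprS mulr1 -[X in _ ^+ X]cardF; exact: expf_card.
Qed.

Lemma neg1_neq1 : (-1 : F) != 1.
Proof. by rewrite -subr_eq0 -opprD oppr_eq0; exact: two_neq0. Qed.

Lemma leg0 : legendre 0 = 0. Proof. by rewrite /legendre eqxx. Qed.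
Lemma leg1 : legendre 1 = 1. Proof. by rewrite /legendre oner_eq0 expr1n eqxx. Qed.

Lemma legM (x y : F) : legendre (x * y) = legendre x * legendre y.
Proof.
rewrite /legendre mulf_eq0; case: eqP => [|/eqP x0]; first by rewrite mul0r.
case: eqP => [|/eqP y0] /=; first by rewrite mulr0.
rewrite half_cardF exprMn.
have /orP[/eqP->|/eqP->] := expf_half_sqr x0; have /orP[/eqP->|/eqP->] := expf_half_sqr y0;
by rewrite ?mulr1 ?mul1r ?mulrN ?mulNr ?mulr1 ?opprK ?eqxx ?(negPf neg1_neq1) ?mulrN ?mulr1 ?opprK.
Qed.

Lemma leg_sqr (x : F) : x != 0 -> legendre (x ^+ 2) = 1.
Proof.
move=> x0; rewrite expr2 legM /legendre (negPf x0).
by case: ifP; rewrite ?mulr1 // mulrN mulr1 opprK.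
Qed.

Lemma leg_eq0 (x : F) : (legendre x == 0) = (x == 0).
Proof. by rewrite /legendre; case: ifP => //; case: ifP. Qed.

Lemma sqr_leg (x : F) : x != 0 -> legendre x ^+ 2 = 1.
Proof. by move=> x0; rewrite expr2 -legM -expr2 leg_sqr. Qed.

Lemma legV (x : F) : legendre x^-1 = legendre x.
Proof.
have [->|x0] := eqVneq x 0; first by rewrite invr0.
apply: (mulfI (_ : legendre x != 0)); first by rewrite leg_eq0.
by rewrite -legM divff // leg1 -expr2 sqr_leg.
Qed.

Lemma norm_leg_le1 (x : F) : `|legendre x| <= 1.
Proof. by rewrite /legendre; case: ifP => //; case: ifP. Qed.

Lemma ex_generator : exists g : F, (2 * h).-primitive_root g.
Proof.
suff /hasP[g _ gP] : has (2 * h).-primitive_root (enum [pred x : F | x != 0]) by exists g.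
apply: has_prim_root; first by have := h_gt0; lia.
- apply/allP => x; rewrite mem_enum inE => x0; apply/unity_rootP.
  by apply: (mulfI x0); rewrite -exprS mulr1 -[X in _ ^+ X]cardF; exact: expf_card.
- exact: enum_uniq.
- have := cardC1 (0 : F); rewrite cardF /= => E.
  by rewrite -cardE -[X in (X <= _)%N]E; apply: eq_leq; apply: eq_card => x; rewrite !inE.
Qed.

Lemma prim_root_neq0 (g : F) : (2 * h).-primitive_root g -> g != 0.
Proof.
move=> gP; apply: contraTneq isT => g0; have := prim_expr_order gP; rewrite g0 expr0n.
by have := h_gt0; case: h => //= n _ /esym/eqP; rewrite oner_eq0.
Qed.

Lemma leg_generator (g : F) : (2 * h).-primitive_root g -> legendre g = -1.
Proof.
move=> gP; rewrite /legendre (negPf (prim_root_neq0 gP)) half_cardF -(prim_order_dvd gP).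
by rewrite gtnNdvd //; have := h_gt0; lia.
Qed.

Lemma ex_sqrt (x : F) : legendre x = 1 -> exists2 y, y != 0 & x = y ^+ 2.
Proof.
have [g gP] := ex_generator; have g0 := prim_root_neq0 gP.
rewrite /legendre half_cardF; case: eqP => // /eqP x0; case: eqP => // xh _.
have [|i xE] := prim_rootP gP (x := x); first by rewrite mulnC exprM xh expr1n.
have : (2 * h %| i * h)%N by rewrite (prim_order_dvd gP) exprM -xE xh.
rewrite dvdn_pmul2r ?h_gt0 // => /dvdnP[k ik].
by exists (g ^+ k); rewrite ?expf_neq0 // xE ik exprM.
Qed.

Lemma card_sqrt (x : F) : #|[set y : F | y ^+ 2 == x]|%:Z = 1 + legendre x.
Proof.
have [->|x0] := eqVneq x 0.
  rewrite leg0 addr0 (_ : [set y | _] = [set 0]) ?cards1 //.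
  by apply/setP => y; rewrite !inE sqrf_eq0.
have : (legendre x == 1) || (legendre x == -1) by rewrite -sqrf_eq1 sqr_leg.
case/orP => /eqP lx; rewrite lx.
  have [y y0 xE] := ex_sqrt lx.
  have -> : [set y | y ^+ 2 == x] = [set y; - y].
    by apply/setP => z; rewrite !inE xE eqf_sqr.
  rewrite cards2 (_ : y != - y) // -subr_eq0 opprK -mulr2n -mulr_natr mulf_neq0 //.
  exact: two_neq0.
rewrite (_ : [set y | _] = set0) ?cards0 //; apply/setP => y; rewrite !inE.
apply/negP => /eqP yx; move: lx x0; rewrite -yx; have [->|y0] := eqVneq y 0.
  by rewrite expr0n eqxx.
by rewrite leg_sqr.
Qed.

Lemma sum_over_fibers (T : finType) (u : T -> F) (f : F -> int) :
  \sum_y f (u y) = \sum_x #|[set y | u y == x]|%:Z * f x.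
Proof.
rewrite (partition_big u xpredT) //=; apply: eq_bigr => x _.
rewrite (eq_bigr (fun=> f x)) => [|y /eqP->//].
by rewrite sumr_const -mulr_natl natz; congr (Posz _ * _); apply: eq_card => y; rewrite !inE.
Qed.

Lemma sum_sqr (f : F -> int) : \sum_y f (y ^+ 2) = \sum_x (1 + legendre x) * f x.
Proof. by rewrite sum_over_fibers; apply: eq_bigr => x _; rewrite card_sqrt. Qed.

Lemma sum_affine (f : F -> int) (a b : F) : a != 0 -> \sum_x f (a * x + b) = \sum_x f x.
Proof.
move=> a0; rewrite [RHS](reindex (fun x => a * x + b)) //.
exists (fun y => a^-1 * (y - b)) => x _; first by rewrite addrK mulKf.
by rewrite mulVKf // subrK.
Qed.

Lemma sum_leg : \sum_x legendre x = 0.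
Proof.
have [g gP] := ex_generator; have := sum_affine legendre 0 (prim_root_neq0 gP).
rewrite (eq_bigr (fun x => - legendre x)); last by move=> x _; rewrite addr0 legM (leg_generator gP) mulN1r.
by rewrite sumrN => /eqP; rewrite eq_sym -subr_eq0 opprK -mulr2n mulrn_eq0 => /eqP.
Qed.

Lemma sum_leg_affine (a b : F) : a != 0 -> \sum_x legendre (a * x + b) = 0.
Proof. by move=> a0; rewrite (sum_affine legendre b a0) sum_leg. Qed.

Lemma sum_norm_le_card (f : F -> int) : (forall x, `|f x| <= 1) -> `|\sum_x f x| <= p%:Z.
Proof.
move=> f1; apply: le_trans (ler_norm_sum _ _ _) _.
apply: (@le_trans _ _ (\sum_(x : F) 1)); first by apply: ler_sum.
by rewrite sumr_const cardF; lia.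
Qed.

Lemma card_quad (a b c : F) : a != 0 ->
  #|[set x : F | a * x ^+ 2 + b * x + c == 0]|%:Z = 1 + legendre (b ^+ 2 - 4%:R * a * c).
Proof.
move=> a0; rewrite -card_sqrt; congr (_%:Z).
have d0 : 2%:R * a != 0 by rewrite mulf_neq0 ?two_neq0.
have inj : injective (fun x => 2%:R * a * x + b) by move=> x y /addIr /(mulfI d0).
rewrite -(card_imset _ inj); apply: eq_card => y; rewrite !inE.
apply/imsetP/idP => [[x]|/eqP yE].
  rewrite inE => /eqP xE ->; rewrite -subr_eq0; apply/eqP.
  by transitivity (4%:R * a * (a * x ^+ 2 + b * x + c)); [ring | rewrite xE mulr0].
exists ((2%:R * a)^-1 * (y - b)); last by rewrite mulVKf // subrK.
rewrite inE; apply/eqP; apply: (mulfI (mulf_neq0 two_neq0 d0)).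
have xE : y = 2%:R * a * ((2%:R * a)^-1 * (y - b)) + b by rewrite mulVKf // subrK.
move: yE; rewrite {1}xE; move: (_^-1 * _) => x yE.
rewrite mulr0; transitivity ((2%:R * a * x + b) ^+ 2 - (b ^+ 2 - 4%:R * a * c)); first by ring.
by rewrite yE subrr.
Qed.

(** Summing over [x = y ^+ 2] with weight [1 + legendre x] leaves the sum of
    [legendre (x * (x - D))], the weight 1 giving a complete linear sum. For [x != 0] this term is
    [legendre (1 - D / x)], whose argument takes every value except 1, hence the total
    [- legendre 1]. *)
Lemma sum_leg_sqr_sub (D : F) : D != 0 -> \sum_y legendre (y ^+ 2 - D) = -1.
Proof.
move=> D0; rewrite (sum_sqr (fun x => legendre (x - D))).
rewrite (eq_bigr (fun x => legendre (1 * x + - D) + legendre (x * (x - D)))); last first.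
  by move=> x _; rewrite mulrDl !mul1r legM.
rewrite big_split /= sum_leg_affine ?oner_eq0 // add0r (bigD1 0) //= mul0r leg0 add0r.
have := sum_leg; rewrite (bigD1 1) //= leg1 => /eqP; rewrite addrC addr_eq0 => /eqP <-.
rewrite [RHS](reindex (fun x => 1 - D / x)) /=; last first.
  exists (fun w => D / (1 - w)) => x; rewrite !inE => xP.
    rewrite opprB addrCA subrr addr0 invf_div mulrCA divff // mulr1 //.
  by rewrite invf_div mulrCA divff // mulr1 opprB addrCA subrr addr0.
apply: eq_big => [x|x x0].
  by rewrite -[1 - D / x == 1]subr_eq0 addrAC subrr add0r oppr_eq0 mulf_eq0 negb_or D0 invr_eq0.
rewrite (_ : x * (x - D) = x ^+ 2 * (1 - D / x)); last by field.
by rewrite legM leg_sqr // mul1r.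
Qed.

(** Completing the square, [4 a (a x^2 + b x + c) = (2 a x + b)^2 - (b^2 - 4 a c)], reduces the sum
    to [sum_leg_sqr_sub]; its exact value is [- legendre a]. *)
Lemma sum_leg_quad_le1 (a b c : F) : a != 0 -> b ^+ 2 - 4%:R * a * c != 0 ->
  `|\sum_x legendre (a * x ^+ 2 + b * x + c)| <= 1.
Proof.
move=> a0 D0; have d0 : 2%:R * a != 0 by rewrite mulf_neq0 ?two_neq0.
have := sum_affine (fun y => legendre (y ^+ 2 - (b ^+ 2 - 4%:R * a * c))) b d0.
rewrite sum_leg_sqr_sub // (eq_bigr (fun x => legendre a * legendre (a * x ^+ 2 + b * x + c))); last first.
  move=> x _; rewrite -legM -[RHS]mul1r -(leg_sqr two_neq0) -legM; congr legendre; ring.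
rewrite -big_distrr /= => /(congr1 Num.norm); rewrite normrM normrN1.
have : `|legendre a| = 1 by rewrite /legendre (negPf a0); case: ifP.
by move=> ->; rewrite mul1r => ->.
Qed.

Lemma card_roots_lt (f : {poly F}) : f != 0 -> (#|[set x : F | root f x]| < size f)%N.
Proof.
move=> f0; rewrite cardE; apply: max_poly_roots => //; last exact: enum_uniq.
by apply/allP => x; rewrite mem_enum inE.
Qed.

Lemma card_set_sum (P : pred F) : #|[set x | P x]|%:Z = \sum_x (P x)%:Z.
Proof.
rewrite -sum1_card (big_morph Posz PoszD (erefl _)) (bigID P) /= [X in _ + X]big1 => [|x]; last first.
  by rewrite inE => /andP[->].
rewrite addr0 [RHS](bigID P) /= [X in _ = _ + X]big1 => [|x /negPf->//]; rewrite addr0.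
by apply: eq_big => [x|x /andP[_ ->]//]; rewrite inE andbb.
Qed.

(** The points split into values 1, values -1 and roots. Eliminating the class opposite to [s]
    leaves twice the count for [s], minus [p], plus the number of roots, which is below [size f]. *)
Lemma sum_leg_poly_le_count (f : {poly F}) (s : bool) : f != 0 ->
  (-1) ^+ s * \sum_x legendre f.[x] <=
    2 * #|[set x : F | f.[x] ^+ h == (-1) ^+ s]|%:Z - p%:Z + (size f)%:Z.
Proof.
move=> f0; apply: (@le_trans _ _
  (2 * #|[set x : F | f.[x] ^+ h == (-1) ^+ s]|%:Z - p%:Z + #|[set x : F | root f x]|%:Z)); last first.
  by rewrite lerD2l lez_nat ltnW // card_roots_lt.
have -> : p%:Z = \sum_(x : F) 1 by rewrite sumr_const cardF natz.
rewrite !card_set_sum !big_distrr /= -sumrB -big_split /=; apply: ler_sum => x _.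
rewrite /legendre half_cardF rootE; case: eqVneq => [->|fx].
  rewrite mulr0 expr0n gtn_eqF ?h_gt0 //=.
  move: (_ == _); clear. by case.
have := expf_half_sqr fx; have := neg1_neq1.
by case: s; rewrite ?expr0 ?expr1 => n1 /orP[/eqP->|/eqP->];
  rewrite ?eqxx ?(negPf n1) // eq_sym (negPf n1).
Qed.

(** The choice [m = h - 1] is the largest that [stepanov_count] permits, and then
    [12 * e ^ 2 + 4 <= p] implies its condition on [e]. The 10 is the 4 from [size f] plus the 6
    from the count. *)
Lemma leg_cubic_bound_aux (f : {poly F}) (e : nat) (s : bool) :
  size f = 4%N -> f.[0] != 0 -> (12 * e ^ 2 + 4 <= p)%N -> (0 < e)%N ->
  ((-1) ^+ s * \sum_x legendre f.[x] - 10) * e%:Z <= 2 * p%:Z.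
Proof.
move=> sf f00 ep e0; have f0 : f != 0 by rewrite -size_poly_eq0 sf.
have := sum_leg_poly_le_count s f0; rewrite sf; move: (_ * _) => S.
have h1 : (0 < h - 1)%N by move: ep; rewrite -mulnn; nia.
have NE : (#|[set x : F | f.[x] ^+ h == (-1) ^+ s]| * (2 * e) <= p * e + 2 * p + 6 * e)%N.
  apply: (@stepanov_count _ _ charF cardF _ _ h (h - 1)%N e) => //; first by lia.
  by move: ep; rewrite -mulnn; nia.
move: #|_| NE => N NE SN.
have : 2 * (N%:Z * e%:Z) <= p%:Z * e%:Z + 2 * p%:Z + 6 * e%:Z by lia.
move: (p%:Z) SN => q SN NE'.
have : (S - 10) * e%:Z <= (2 * N%:Z - q - 6) * e%:Z by apply: ler_wpM2r => //; lia.
by move=> H; apply: le_trans H _; lia.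
Qed.

(** With [e] maximal one has [p <= 52 e^2], so [(|S| - 10) e <= 2 p] yields [(|S| - 10)^2 <= 208 p],
    hence [S^2 <= 416 p + 200 <= 600 p]. The squared form keeps everything in integers. Below 16 the
    trivial bound suffices; above, [e >= 1] is available. *)
Lemma leg_cubic_bound (f : {poly F}) : size f = 4%N ->
  (\sum_x legendre f.[x]) ^+ 2 <= 600 * p%:Z.
Proof.
move=> sf; have f0 : f != 0 by rewrite -size_poly_eq0 sf.
have trivial_bound : `|\sum_x legendre f.[x]| <= p%:Z by apply: sum_norm_le_card => x; apply: norm_leg_le1.
have [p16|p16] := ltnP p 16.
  rewrite -real_normK ?num_real // expr2.
  have := normr_ge0 (\sum_x legendre f.[x]); move: `|_| trivial_bound p16 => S; move: p => q; nia.
have [x0 fx0] : exists x0, f.[x0] != 0.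
  apply/existsP; apply: contraTT p16 => /existsPn H; rewrite -ltnNge.
  have := card_roots_lt f0; rewrite (_ : [set x | root f x] = setT) ?cardsT ?cardF ?sf; first by lia.
  by apply/setP => x; rewrite !inE rootE; have := H x; rewrite negbK.
(* The comparison modulo ['X^p] needs a nonzero constant term, so a point where [f] does not vanish
   is moved to 0. *)
pose g := f \Po ('X + x0%:P).
have sg : size g = 4%N by rewrite size_comp_poly2 ?size_XaddC.
have -> : \sum_x legendre f.[x] = \sum_x legendre g.[x].
  rewrite -(sum_affine (fun x => legendre f.[x]) x0 (oner_neq0 F)); apply: eq_bigr => x _.
  by rewrite horner_comp !hornerE ?mul1r.
have g0 : g.[0] != 0 by rewrite horner_comp !hornerE.
have exE : exists e, (12 * e ^ 2 + 4 <= p)%N by exists 1%N; lia.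
have ubE e : (12 * e ^ 2 + 4 <= p)%N -> (e <= p)%N by rewrite -mulnn; nia.
have [e eP emax] := ex_maxnP exE ubE.
have e0 : (0 < e)%N by rewrite lt0n; apply: contraTneq isT => e0; have := emax 1%N; rewrite e0; lia.
have p52 : (p <= 52 * e ^ 2)%N.
  have : (p < 12 * e.+1 ^ 2 + 4)%N by rewrite ltnNge; apply/negP => /emax; lia.
  rewrite -!mulnn; nia.
have := leg_cubic_bound_aux false sg g0 eP e0; have := leg_cubic_bound_aux true sg g0 eP e0.
rewrite expr0 expr1 mul1r mulN1r; move: (\sum_x _) => S; rewrite -!mulnn in p52 eP.
clear -p52 e0 p16 eP; move: p p52 p16 eP => q p52 q16 eP S1 S2.
have [S10|S10] := lerP `|S| 10.
  nia.
have A : (`|S| - 10) * e%:Z <= 2 * q%:Z.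
  by have [|] := lerP 0 S => S0; [rewrite ger0_norm | rewrite ltr0_norm].
have B : (`|S| - 10) ^+ 2 * (e * e)%:Z <= 4 * (q%:Z) ^+ 2.
  rewrite PoszM; have : ((`|S| - 10) * e%:Z) ^+ 2 <= (2 * q%:Z) ^+ 2.
    by rewrite lerXn2r // nnegrE; nia.
  by rewrite !exprMn expr2; lia.
have C : (`|S| - 10) ^+ 2 * q%:Z <= 208 * q%:Z * q%:Z.
  have : (`|S| - 10) ^+ 2 * q%:Z <= (`|S| - 10) ^+ 2 * (52 * (e * e)%:Z).
    by apply: ler_wpM2l; [exact: sqr_ge0 | lia].
  by move: B; rewrite expr2; nia.
have D : (`|S| - 10) ^+ 2 <= 208 * q%:Z by rewrite -(ler_pM2r (_ : 0 < q%:Z)) //; lia.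
rewrite -real_normK ?num_real //; nia.
Qed.

End QuadraticCharacter.

(** * Convolutions of the quadratic character *)

Section Clausen.
Variables (F : finFieldType) (h : nat) (charF : (2 * h).+1 \in [pchar F]) (cardF : #|F| = (2 * h).+1).
Hypothesis (evenh : ~~ odd h).
Local Notation p := (2 * h).+1.

Lemma four_neq0 : 4%:R != 0 :> F.
Proof. by rewrite -[4%N]/(2 * 2)%N natrM mulf_neq0 // (two_neq0 charF). Qed.

Lemma legN1 : legendre (-1 : F) = 1.
Proof.
rewrite /legendre oppr_eq0 oner_eq0 (half_cardF charF cardF) -signr_odd (negPf evenh) expr0 eqxx //.
Qed.

Lemma legN (x : F) : legendre (- x) = legendre x.
Proof. by rewrite -mulN1r (legM charF cardF) legN1 mul1r. Qed.

Lemma sum_norm_except (f : F -> int) (c : F) (n : nat) :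
  (forall x, x != c -> `|f x| <= n%:Z) -> `|f c| <= n%:Z * p%:Z ->
  `|\sum_x f x| <= 2 * n%:Z * p%:Z.
Proof.
move=> fn fc; rewrite (bigD1 c) //=; apply: le_trans (ler_normD _ _) _.
apply: (@le_trans _ _ (n%:Z * p%:Z + \sum_(x | x != c) n%:Z)).
  apply: lerD => //; apply: le_trans (ler_norm_sum _ _ _) _; exact: ler_sum.
by rewrite sumr_const cardC1 cardF; lia.
Qed.

(** The pairs with sum [s] and product [q] are the ordered pairs of roots of [T^2 - s T + q], whose
    discriminant gives the weight. *)
Lemma sum_pairs_sum_prod (H : F -> F -> int) :
  \sum_x \sum_y H (x + y) (x * y) = \sum_q \sum_s (1 + legendre (s ^+ 2 - 4%:R * q)) * H s q.
Proof.
rewrite [RHS]exchange_big /=.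
transitivity (\sum_s \sum_x H s (x * (s - x))).
  rewrite [RHS]exchange_big /=; apply: eq_bigr => x _.
  rewrite -(sum_affine (fun s => H s (x * (s - x))) x (oner_neq0 F)); apply: eq_bigr => y _.
  by rewrite mul1r addrK addrC.
apply: eq_bigr => s _; rewrite (sum_over_fibers (fun x => x * (s - x)) (H s)).
apply: eq_bigr => q _; congr (_ * _).
have := card_quad charF cardF (- s) q (oner_neq0 F).
rewrite sqrrN mulr1 => <-; congr (_%:Z); apply: eq_card => x; rewrite !inE.
by rewrite -subr_eq0 -oppr_eq0; congr (_ == 0); ring.
Qed.

(* Fibres over the value [l] of [Q2 / Q1]; at a common zero of [Q1] and [Q2] every
   [l] occurs, and the values of [legendre] add up to [0]. *)
Lemma sum_leg_pencil (Q1 Q2 : F -> F) :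
  \sum_s legendre (Q1 s) * legendre (Q2 s) = \sum_l legendre l * #|[set s | Q2 s == l * Q1 s]|%:Z.
Proof.
under [RHS]eq_bigr => l _ do rewrite card_set_sum big_distrr /=.
rewrite exchange_big /=; apply: eq_bigr => s _.
have [->|Q10] := eqVneq (Q1 s) 0.
  under eq_bigr => l _ do rewrite mulr0.
  by rewrite -big_distrl /= (sum_leg charF cardF) mul0r leg0 mul0r.
rewrite (bigD1 (Q2 s / Q1 s)) //= divfK // eqxx mulr1 big1 ?addr0 => [|l lP].
  by rewrite (legM charF cardF) (legV charF cardF) mulrC.
rewrite (_ : (_ == _) = false) ?mulr0 //; apply: contraNF lP => /eqP ->.
by rewrite mulfK.
Qed.

(** After [x -> 1 / x] this is, up to sign, Euler's double integral for 3F2(1/2, 1/2, 1/2; 1, 1) at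
    [1 / t], with inverse square roots replaced by [legendre]. In the nonsingular case
    [cubic_sum k b] is minus the trace of Frobenius of the curve [y^2 = x (x^2 + k x + b)]. *)
Definition triple_sum (t : F) : int :=
  \sum_x \sum_y legendre (x * (x - 1) * y * (y - 1) * (t * x - y)).

Definition cubic_sum (k b : F) : int := \sum_x legendre (x * (x ^+ 2 + k * x + b)).

(** With [x = q + b^2 / q] the argument equals [q^2 (x - 2 b + 4 c)]. The number of [q] over a given
    [x] is [1 + legendre (x^2 - 4 b^2)], and the weight 1 contributes a complete linear sum, which
    is 0. *)
Lemma sum_leg_inversion (b c : F) : b != 0 ->
  \sum_q legendre (q * ((q - b) ^+ 2 + 4%:R * q * c)) =
  \sum_x legendre ((x ^+ 2 - 4%:R * b ^+ 2) * (x - 2%:R * b + 4%:R * c)).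
Proof.
move=> b0; rewrite (bigD1 0) //= mul0r leg0 add0r.
pose H x := legendre (x - 2%:R * b + 4%:R * c).
transitivity (\sum_(q | q != 0) H (q + b ^+ 2 / q)).
  apply: eq_bigr => q q0; rewrite /H -[RHS]mul1r -(leg_sqr charF cardF q0) -(legM charF cardF).
  by congr legendre; field.
rewrite (partition_big (fun q => q + b ^+ 2 / q) xpredT) //=.
transitivity (\sum_x (1 + legendre (x ^+ 2 - 4%:R * b ^+ 2)) * H x).
  apply: eq_bigr => x _; rewrite (eq_bigr (fun=> H x)) => [|y /andP[_ /eqP->]//].
  rewrite sumr_const -[LHS]mulr_natl natz; congr (_ * _).
  have := card_quad charF cardF (- x) (b ^+ 2) (oner_neq0 F); rewrite sqrrN mulr1 => <-.
  congr Posz; apply: eq_card => q; rewrite !inE unfold_in /=.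
  have [->|q0] /= := eqVneq q 0.
    by rewrite expr0n !mulr0 !add0r sqrf_eq0 (negPf b0).
  rewrite -subr_eq0 -(mulrI_eq0 _ (mulfI q0)); congr (_ == 0); field.
  by [].
rewrite (eq_bigr (fun x => H x + legendre ((x ^+ 2 - 4%:R * b ^+ 2) * (x - 2%:R * b + 4%:R * c)))) => [|x _]; last first.
  by rewrite mulrDl mul1r (legM charF cardF).
rewrite big_split /= [X in X + _](_ : _ = 0) ?add0r //.
rewrite -[RHS](sum_leg_affine charF cardF (4%:R * c - 2%:R * b) (oner_neq0 F)).
by apply: eq_bigr => x _; rewrite /H; congr legendre; ring.
Qed.

(** The substitutions [l = b t m] and [x = 2 b - 4 b n] turn the product of the arguments into
    [((4 b)^2 t)^2 b] times [m (m - 1) n (n - 1) (t m - n)]. *)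
Lemma sum_leg_triple_lines (b t : F) : b != 0 -> t != 0 ->
  \sum_l \sum_x legendre (l * (- (4%:R * b * t) + 4%:R * l)) *
     legendre ((x ^+ 2 - 4%:R * b ^+ 2) * (x - 2%:R * b + 4%:R * l)) = legendre b * triple_sum t.
Proof.
move=> b0 t0; have bt0 : b * t != 0 by rewrite mulf_neq0.
have b40 : - (4%:R * b) != 0.
  by rewrite oppr_eq0 mulf_neq0 // four_neq0.
pose G (l x : F) : int := legendre (l * (- (4%:R * b * t) + 4%:R * l)) *
     legendre ((x ^+ 2 - 4%:R * b ^+ 2) * (x - 2%:R * b + 4%:R * l)).
rewrite -/(\sum_l \sum_x G l x) -(sum_affine (fun l => \sum_x G l x) 0 bt0).
rewrite /triple_sum big_distrr /=; apply: eq_bigr => m _.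
rewrite -(sum_affine (G (b * t * m + 0)) (2%:R * b) b40).
rewrite big_distrr /=; apply: eq_bigr => n _; rewrite /G.
rewrite addr0 -!(legM charF cardF).
have sq0 : (4%:R * b) ^+ 2 * t != 0.
  by rewrite mulf_neq0 // sqrf_eq0 -oppr_eq0.
rewrite -[RHS]mul1r -(leg_sqr charF cardF sq0) -(legM charF cardF).
by congr legendre; ring.
Qed.

(* Finite-field analogue of Clausen's formula expressing the square of a [2F1] as
   a [3F2]. With [s = x + y] and [q = x y], the product of the two cubics is [q]
   times [Q s q], whose discriminant in [s] is [(k ^+ 2 - 4 b) (q - b) ^+ 2]; the
   pencil spanned by [Q s q] and [s ^+ 2 - 4 q] has a discriminant which splits
   into the two factors of [D q l]. *)
Lemma clausen_bound (k b t : F) : b != 0 -> t != 0 -> k ^+ 2 = 4%:R * b * (1 - t) ->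
  `|cubic_sum k b ^+ 2 - legendre b * triple_sum t| <= 4%:Z * p%:Z.
Proof.
move=> b0 t0 kE.
have n40 : 4%:R != 0 :> F.
  exact: four_neq0.
pose Q (s q : F) := b * s ^+ 2 + k * (q + b) * s + ((q - b) ^+ 2 + k ^+ 2 * q).
pose D (q l : F) := (- (4%:R * b * t) + 4%:R * l) * ((q - b) ^+ 2 + 4%:R * q * l).
pose N q := #|[set s | Q s q == b * (s ^+ 2 - 4%:R * q)]|%:Z.
have WE : cubic_sum k b ^+ 2 = \sum_q \sum_s (1 + legendre (s ^+ 2 - 4%:R * q)) * legendre (q * Q s q).
  rewrite -(sum_pairs_sum_prod (fun s q => legendre (q * Q s q))) expr2 big_distrl /=.
  apply: eq_bigr => x _; rewrite big_distrr /=; apply: eq_bigr => y _.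
  by rewrite -(legM charF cardF); congr legendre; rewrite /Q; ring.
(* For [l != b] the member of the pencil is a quadratic in [s] and has [1 + legendre (D q l)] zeros.
   At [l = b] the leading coefficient [b - l] vanishes, so the true count [N q] is substituted
   there, which produces the correction term. *)
have E2 q : \sum_s legendre (s ^+ 2 - 4%:R * q) * legendre (Q s q) =
    \sum_l legendre l * legendre (D q l) + legendre b * (N q - 1 - legendre (D q b)).
  rewrite [LHS]sum_leg_pencil [LHS](bigD1 b) //= [X in _ = X + _](bigD1 b) //= -/(N q).
  have := sum_leg charF cardF; rewrite (bigD1 b) //= => /eqP; rewrite addrC addr_eq0 => /eqP S0.
  rewrite (eq_bigr (fun l => legendre l + legendre l * legendre (D q l))) => [|l lb].
    by rewrite big_split /= S0; move: (\sum_(l | l != b) _) => S; ring.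
  rewrite -[X in X + _]mulr1 -mulrDr; congr (_ * _).
  have bl : b - l != 0 by rewrite subr_eq0 eq_sym.
  rewrite (_ : D q l = (k * (q + b)) ^+ 2 - 4%:R * (b - l) * ((q - b) ^+ 2 + k ^+ 2 * q + 4%:R * q * l)).
    rewrite -(card_quad charF cardF _ _ bl); congr Posz; apply: eq_card => s; rewrite !inE.
    by rewrite -subr_eq0; congr (_ == 0); rewrite /Q; ring.
  by rewrite /D exprMn kE; ring.
have -> : cubic_sum k b ^+ 2 = \sum_q \sum_s legendre (q * Q s q)
    + \sum_q legendre q * (legendre b * (N q - 1 - legendre (D q b))) + legendre b * triple_sum t.
  rewrite WE -(sum_leg_triple_lines b0 t0) (eq_bigr (fun q => \sum_s legendre (q * Q s q)
      + legendre q * (\sum_s legendre (s ^+ 2 - 4%:R * q) * legendre (Q s q)))) => [|q _]; last first.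
    rewrite big_distrr -big_split; apply: eq_bigr => s _ /=.
    by rewrite mulrDl mul1r (legM charF cardF); congr (_ + _); ring.
  rewrite big_split /= -addrA; congr (_ + _).
  under eq_bigr => q _ do rewrite E2 mulrDr addrC.
  rewrite big_split /=; congr (_ + _).
  under eq_bigr => q _ do rewrite big_distrr /=.
  rewrite exchange_big /=; apply: eq_bigr => l _.
  rewrite -big_distrr /= -(sum_leg_inversion l b0) big_distrr /=; apply: eq_bigr => q _.
  by rewrite -!(legM charF cardF); congr legendre; rewrite /D; ring.
rewrite addrK.
(* The discriminant in [s] is nonzero except at [q = b], so all inner sums but that one are bounded
   by 1. *)
have B1 : `|\sum_q \sum_s legendre (q * Q s q)| <= 2%:Z * p%:Z.
  rewrite -[2%:Z]mulr1; apply: (@sum_norm_except _ b 1%N) => [q qb|].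
    under eq_bigr => s _ do rewrite (legM charF cardF).
    rewrite -big_distrr normrM /= -[1%:Z]mulr1; apply: ler_pM => //.
      exact: norm_leg_le1.
    apply: (sum_leg_quad_le1 charF cardF) => //.
    rewrite (_ : _ - _ = - (4%:R * b * t) * (q - b) ^+ 2).
      apply: mulf_neq0; last by rewrite sqrf_eq0 subr_eq0.
      by rewrite oppr_eq0; apply: mulf_neq0 => //; apply: mulf_neq0.
    by rewrite exprMn kE; ring.
  rewrite mul1r; apply: (sum_norm_le_card charF cardF) => s; exact: norm_leg_le1.
(* At [l = b] the discriminant is a square and the equation is linear in [s], so count and character
   value differ by a bounded amount; only [q = - b], where the linear coefficient vanishes, is
   estimated by [p]. *)
have B2 : `|\sum_q legendre q * (legendre b * (N q - 1 - legendre (D q b)))| <= 2%:Z * p%:Z.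
  have DE q : D q b = (k * (q + b)) ^+ 2 by rewrite /D exprMn kE; ring.
  have NE q : N q = #|[set s | k * (q + b) * s + ((q + b) ^+ 2 + k ^+ 2 * q) == 0]|%:Z.
    congr Posz; apply: eq_card => s; rewrite !inE -subr_eq0; congr (_ == 0); rewrite /Q; ring.
  have red q n : `|N q - 1 - legendre (D q b)| <= n -> `|legendre q * (legendre b * (N q - 1 - legendre (D q b)))| <= n.
    move=> H; rewrite mulrA -(legM charF cardF) normrM -[n]mul1r; apply: ler_pM => //.
    exact: norm_leg_le1.
  rewrite -[2%:Z]mulr1; apply: (@sum_norm_except _ (- b) 1%N) => [q qb|]; apply: red.
    have qb0 : q + b != 0 by rewrite -(opprK b) subr_eq0.
    rewrite NE DE; have [k0|k0] := eqVneq k 0.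
      rewrite (_ : [set s | _] = set0) ?cards0 ?k0 ?mul0r ?expr0n ?leg0 //.
      apply/setP => s; rewrite !inE !mul0r add0r addr0 sqrf_eq0; exact/negbTE.
    have kq0 : k * (q + b) != 0 by rewrite mulf_neq0.
    rewrite (leg_sqr charF cardF kq0) (_ : [set s | _] =
       [set - ((q + b) ^+ 2 + k ^+ 2 * q) / (k * (q + b))]) ?cards1 //.
    apply/setP => s; rewrite !inE addr_eq0 (can2_eq (mulKf kq0) (mulVKf kq0)).
    by rewrite mulrC.
  rewrite DE addNr mulr0 expr0n leg0 subr0 mul1r.
  have : (#|[set s | (Q s (- b) == b * (s ^+ 2 - 4%:R * - b))%R]| <= p)%N.
    by rewrite -cardF max_card.
  rewrite /N; move: #|_| => n; lia.
rewrite (_ : 4%:Z = 2%:Z + 2%:Z) // mulrDl.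
by apply: le_trans (ler_normD _ _) _; apply: lerD.
Qed.

(** Every [t] admits [k] and [b] with [k^2 = 4 b (1 - t)] and [b != 0]; the value [t = 1] needs its
    own choice because [b = 1 - t] would vanish. The constant is [600 + 4], from [leg_cubic_bound]
    and [clausen_bound]. *)
Lemma triple_sum_bound (t : F) : t != 0 -> `|triple_sum t| <= 604%:Z * p%:Z.
Proof.
move=> t0.
have n40 : 4%:R != 0 :> F.
  exact: four_neq0.
have [k [b [b0 kE]]] : exists k b : F, b != 0 /\ k ^+ 2 = 4%:R * b * (1 - t).
  have [->|t1] := eqVneq t 1.
    by exists 0, 1; rewrite oner_eq0 subrr mulr0 expr0n.
  by exists (2%:R * (1 - t)), (1 - t); rewrite subr_eq0 eq_sym; split => //; ring.
have WB : cubic_sum k b ^+ 2 <= 600 * p%:Z.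
  pose f : {poly F} := 'X * ('X ^+ 2 + k *: 'X + b%:P).
  have -> : cubic_sum k b = \sum_x legendre f.[x] by apply: eq_bigr => x _; rewrite /f !hornerE.
  apply: (leg_cubic_bound charF cardF).
  have sX : size ('X ^+ 2 + k *: 'X + b%:P : {poly F}) = 3%N.
    rewrite -addrA size_polyDl ?size_polyXn //.
    apply: leq_ltn_trans (size_polyD _ _) _; rewrite gtn_max.
    apply/andP; split; last by apply: leq_ltn_trans (size_polyC_leq1 _) _.
    by apply: leq_ltn_trans (size_scale_leq _ _) _; rewrite size_polyX.
  by rewrite /f size_mul ?size_polyX ?sX // -size_poly_gt0 ?size_polyX ?sX.
have := clausen_bound b0 t0 kE.
have : `|triple_sum t| = `|legendre b * triple_sum t|.
  by rewrite normrM /legendre (negPf b0); case: ifP; rewrite ?normrN1 ?normr1 mul1r.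
move=> ->; have := sqr_ge0 (cubic_sum k b); move: (cubic_sum k b ^+ 2) WB (_ * _) => w WB q; lia.
Qed.

(** This and the next two definitions are $v$, $v*v$ and $v*v*v$ of the overview. *)
Definition leg_sub1 (a : F) : int := legendre (a ^+ 2 - 1).
Definition leg_conv2 (z : F) : int := \sum_(a | a != 0) leg_sub1 a * leg_sub1 (z / a).
Definition leg_conv3 (z : F) : int := \sum_(a | a != 0) leg_sub1 a * leg_conv2 (z / a).

(** For [z^2 = 1] each term is the character of [- (a^2 - 1)^2 / a^2]. As -1 is a square, it is 1
    except at [a = 1] and [a = -1]; with the omitted 0 this removes three points. *)
Lemma leg_conv2_sqr_eq1 (z : F) : z ^+ 2 = 1 -> leg_conv2 z = p%:Z - 3.
Proof.
move=> z1; have E a : a != 0 -> leg_sub1 a * leg_sub1 (z / a) = legendre ((a ^+ 2 - 1) ^+ 2).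
  move=> a0; rewrite /leg_sub1 -(legM charF cardF) expr_div_n z1 -[RHS]mul1r -(leg_sqr charF cardF (_ : a^-1 != 0)) ?invr_eq0 //.
  by rewrite -legN -(legM charF cardF); congr legendre; field.
rewrite /leg_conv2 (eq_bigr _ E).
have l1 (a : F) : a ^+ 2 - 1 != 0 -> legendre ((a ^+ 2 - 1) ^+ 2) = 1 by exact: (leg_sqr charF cardF).
have -> : p%:Z - 3 = \sum_(a : F | (a != 0) && (a ^+ 2 - 1 != 0)) 1.
  have : p%:Z = \sum_(a : F) 1 by rewrite sumr_const cardF natz.
  rewrite (bigD1 0) //= (bigD1 1) ?oner_eq0 //= (bigD1 (-1)) ?oppr_eq0 ?oner_eq0 ?(neg1_neq1 charF cardF) //=.
  move=> ->; rewrite [RHS](eq_bigl (fun a => (a != 0) && (a != 1) && (a != -1))); last first.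
    by move=> a /=; rewrite subr_eq0 sqrf_eq1 negb_or andbA.
  move: (\sum_(_ | _) _) => S; lia.
rewrite (bigID (fun a => a ^+ 2 - 1 == 0)) /= big1 ?add0r => [|a /andP[_ /eqP->]].
  by apply: eq_bigr => a /andP[_]; exact: l1.
by rewrite expr0n leg0.
Qed.

(** In terms of [x = a^2] the weight [1 + legendre x] gives a quadratic sum, nondegenerate because
    [z^2 != 1], and a cubic sum, of square at most [600 p]. The 1300 leaves room for [2 * 600 p]
    plus the bounded terms, including the correction [f 0 = 1]. *)
Lemma leg_conv2_bound (z : F) : z != 0 -> z ^+ 2 != 1 -> (leg_conv2 z) ^+ 2 <= 1300 * p%:Z.
Proof.
move=> z0 z1; pose f (x : F) := legendre ((x - 1) * (z ^+ 2 - x)).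
have f0 : f 0 = 1 by rewrite /f sub0r subr0 mulN1r legN (leg_sqr charF cardF).
have -> : leg_conv2 z = \sum_x (1 + legendre x) * f x - 1.
  rewrite -(sum_sqr charF cardF f) (bigD1 0) //= expr0n f0 addrAC subrr add0r.
  apply: eq_bigr => a a0; rewrite /leg_sub1 /f -(legM charF cardF) -[LHS]mul1r -(leg_sqr charF cardF a0).
  by rewrite -(legM charF cardF); congr legendre; field.
under eq_bigr => x _ do rewrite mulrDl mul1r.
rewrite big_split /=.
have B1 : `|\sum_x f x| <= 1.
  have n10 : (-1 : F) != 0 by rewrite oppr_eq0 oner_eq0.
  rewrite (eq_bigr (fun x => legendre (-1 * x ^+ 2 + (1 + z ^+ 2) * x + (- z ^+ 2)))) => [|x _].
    apply: (sum_leg_quad_le1 charF cardF) => //.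
    rewrite (_ : _ - _ = (z ^+ 2 - 1) ^+ 2); last by ring.
    by rewrite sqrf_eq0 subr_eq0.
  by rewrite /f; congr legendre; ring.
have B2 : (\sum_x legendre x * f x) ^+ 2 <= 600 * p%:Z.
  pose g : {poly F} := 'X * (('X - 1%:P) * ((z ^+ 2)%:P - 'X)).
  have -> : \sum_x legendre x * f x = \sum_x legendre g.[x].
    by apply: eq_bigr => x _; rewrite /f /g -(legM charF cardF) !hornerE.
  apply: (leg_cubic_bound charF cardF).
  have sz : size ((z ^+ 2)%:P - 'X : {poly F}) = 2%N by rewrite -size_polyN opprB size_XsubC.
  have m2 : ('X - 1%:P) * ((z ^+ 2)%:P - 'X) != 0 :> {poly F}.
    by rewrite mulf_neq0 ?polyXsubC_eq0 // -size_poly_gt0 sz.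
  rewrite /g size_mul ?polyX_eq0 //  size_mul ?polyXsubC_eq0 ?size_polyX ?size_XsubC ?sz //.
  by rewrite -size_poly_gt0 sz.
move: (\sum_x f x) (\sum_x legendre x * f x) B1 B2 => A B B1 B2.
have /andP[A1 A2] : -1 <= A <= 1 by rewrite -ler_norml.
have A4 : (A - 1) ^+ 2 <= 4 by rewrite expr2; nia.
have : (A + B - 1) ^+ 2 = 2 * B ^+ 2 + 2 * (A - 1) ^+ 2 - (B - (A - 1)) ^+ 2 by ring.
have := sqr_ge0 (B - (A - 1)).
lia.
Qed.

Definition triple_kernel (t x y : F) : int := legendre (x * y * (x - 1) * (y - 1) * (t - x * y)).

Lemma triple_kernelC t x y : triple_kernel t x y = triple_kernel t y x.
Proof. by rewrite /triple_kernel; congr legendre; ring. Qed.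

Lemma sum_leg_secant_bound (t y : F) : t != 0 -> y != 0 -> y != t ->
  `|\sum_(x | x != 0) legendre ((x - 1) * (t - x * y))| <= 2.
Proof.
move=> t0 y0 yt; have ny0 : - y != 0 by rewrite oppr_eq0.
have : `|\sum_x legendre ((x - 1) * (t - x * y))| <= 1.
  rewrite (eq_bigr (fun x => legendre (- y * x ^+ 2 + (t + y) * x + (- t)))) => [|x _].
    apply: (sum_leg_quad_le1 charF cardF) => //.
    rewrite (_ : _ - _ = (t - y) ^+ 2); last by ring.
    by rewrite sqrf_eq0 subr_eq0 eq_sym.
  by congr legendre; ring.
rewrite (bigD1 0) //=; have := norm_leg_le1 ((0 - 1) * (t - 0 * y)).
move: (legendre _) (\sum_(_ | _) _) => a b; lia.
Qed.

(** The weight [legendre x] completes the factor [x] of the kernel to a square. The inner sum is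
    then over the quadratic [(x - 1) (t - x y)], bounded unless [y = t]. The function [w] covers
    both twists that occur, by [x] and by [x y]. *)
Lemma sum_twisted_triple_kernel_bound (t : F) (w : F -> F) : t != 0 ->
  `|\sum_y \sum_x legendre (x * w y) * triple_kernel t x y| <= 4%:Z * p%:Z.
Proof.
move=> t0.
have E y : \sum_x legendre (x * w y) * triple_kernel t x y =
    legendre (w y * y * (y - 1)) * \sum_(x | x != 0) legendre ((x - 1) * (t - x * y)).
  rewrite (bigD1 0) //= mul0r leg0 mul0r add0r big_distrr /=; apply: eq_bigr => x x0.
  rewrite /triple_kernel -!(legM charF cardF) -[RHS]mul1r -(leg_sqr charF cardF x0) -(legM charF cardF).
  by congr legendre; ring.
rewrite (_ : 4%:Z = 2%:Z * 2%:Z) //; apply: (@sum_norm_except _ t 2%N) => [y yt|]; rewrite E normrM.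
  have [->|y0] := eqVneq y 0; first by rewrite mulr0 mul0r leg0 normr0 mul0r.
  rewrite -[2%:Z]mul1r; apply: ler_pM => //; first exact: norm_leg_le1.
  exact: sum_leg_secant_bound.
rewrite -[X in _ <= X]mul1r; apply: ler_pM => //; first exact: norm_leg_le1.
have : `|\sum_x legendre ((x - 1) * (t - x * t))| <= p%:Z.
  by apply: (sum_norm_le_card charF cardF) => x; exact: norm_leg_le1.
rewrite (bigD1 0) //=; have := norm_leg_le1 ((0 - 1) * (t - 0 * t)).
move: (legendre _) (\sum_(_ | _) _) => a b; lia.
Qed.

Lemma sum_triple_kernel (t : F) : \sum_x \sum_y triple_kernel t x y = triple_sum t.
Proof.
rewrite /triple_sum (reindex_inj (inv_inj (@invrK F))) /=; apply: eq_bigr => x _.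
apply: eq_bigr => y _; have [->|x0] := eqVneq x 0.
  by rewrite /triple_kernel invr0 !mul0r.
rewrite /triple_kernel -[LHS]mul1r -(leg_sqr charF cardF (_ : x ^+ 2 != 0)) ?sqrf_eq0 // -legN.
rewrite -(legM charF cardF); congr legendre; by field.
Qed.

(* Passing to squares introduces the weights [1 + legendre x] and
   [1 + legendre y]; only the term without weights is not elementary. *)
Lemma leg_conv3_bound (z : F) : z != 0 -> `|leg_conv3 z| <= 616%:Z * p%:Z.
Proof.
move=> z0; have z20 : z ^+ 2 != 0 by rewrite sqrf_eq0.
have -> : leg_conv3 z = \sum_a \sum_b triple_kernel (z ^+ 2) (a ^+ 2) (b ^+ 2).
  rewrite (bigD1 0) //= [X in _ = X + _]big1 => [|b _]; last by rewrite /triple_kernel expr0n !mul0r leg0.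
  rewrite add0r; apply: eq_bigr => a a0; rewrite /leg_conv2 big_distrr [RHS](bigD1 0) //=.
  rewrite [X in _ = X + _](_ : _ = 0) ?add0r; last by rewrite /triple_kernel expr0n mulr0 !mul0r leg0.
  apply: eq_bigr => b b0; rewrite /leg_sub1 /triple_kernel -!(legM charF cardF) -[LHS]mul1r.
  rewrite -(leg_sqr charF cardF (_ : (a ^+ 2 * b ^+ 2) != 0)) ?mulf_neq0 ?sqrf_eq0 //.
  rewrite -(legM charF cardF); congr legendre; field.
  by rewrite a0 b0.
set t := z ^+ 2 in z20 *.
have -> : \sum_a \sum_b triple_kernel t (a ^+ 2) (b ^+ 2) =
    triple_sum t + (\sum_y \sum_x legendre (x * 1) * triple_kernel t x y + \sum_y \sum_x legendre (x * 1) * triple_kernel t x y)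
    + \sum_y \sum_x legendre (x * y) * triple_kernel t x y.
  rewrite (sum_sqr charF cardF (fun x => \sum_b triple_kernel t x (b ^+ 2))) -(sum_triple_kernel t).
  transitivity (\sum_x \sum_y (1 + legendre x) * ((1 + legendre y) * triple_kernel t x y)).
    apply: eq_bigr => x _; rewrite (sum_sqr charF cardF (triple_kernel t x)) big_distrr /=.
    by apply: eq_bigr => y _.
  have -> : \sum_y \sum_x legendre (x * y) * triple_kernel t x y = \sum_x \sum_y legendre (x * y) * triple_kernel t x y.
    by rewrite exchange_big.
  have -> : \sum_y \sum_x legendre (x * 1) * triple_kernel t x y + \sum_y \sum_x legendre (x * 1) * triple_kernel t x y =
      \sum_x \sum_y (legendre x + legendre y) * triple_kernel t x y.
    rewrite {1}exchange_big -big_split /=; apply: eq_bigr => x _.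
    rewrite -big_split /=; apply: eq_bigr => y _.
    by rewrite !mulr1 (triple_kernelC t y x) mulrDl.
  rewrite -!big_split /=; apply: eq_bigr => x _.
  rewrite -!big_split /=; apply: eq_bigr => y _.
  by rewrite (legM charF cardF); ring.
(* 616 is 604 for the sum without weights plus 4 for each of the three twisted sums; the two with a
   single weight agree by symmetry of the kernel. *)
have B1 := triple_sum_bound z20.
have := @sum_twisted_triple_kernel_bound t (fun=> 1) z20; have := @sum_twisted_triple_kernel_bound t id z20.
move: (triple_sum t) (\sum_y _) (\sum_y _) B1 => q a b; lia.
Qed.

End Clausen.

(** * The field of complex numbers *)

Arguments Cmod _%_ring_scope.
Arguments RtoC _%_ring_scope.
Arguments Cconj _%_ring_scope.

Lemma Cplus_opp_l (z : C) : Cplus (Copp z) z = RtoC 0.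
Proof. by rewrite Cplus_comm Cplus_opp_r. Qed.

Lemma RtoC1_neq0 : RtoC 1 != RtoC 0.
Proof. by apply/eqP => /RtoC_inj /eqP; rewrite oner_eq0. Qed.

Lemma Cinv_nonzero_l (z : C) : z != RtoC 0 -> Cmult (Cinv z) z = RtoC 1.
Proof. by move/eqP => z0; apply: Cinv_l. Qed.

(** The field structure requires the inverse of 0 to be 0. Both coordinates of this inverse have
    numerator 0, so the value of a real division by zero does not matter. *)
Lemma Cinv_zero : Cinv (RtoC 0) = RtoC 0.
Proof.
change (Cinv (IZR 0, IZR 0) = (IZR 0, IZR 0)).
by apply: injective_projections; rewrite /= /Rdiv ?Ropp_0 Rmult_0_l.
Qed.

HB.instance Definition _ := Choice.copy C (R * R)%type.
HB.instance Definition _ := GRing.isZmodule.Build C Cplus_assoc Cplus_comm Cplus_0_l Cplus_opp_l.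
HB.instance Definition _ := GRing.Zmodule_isComNzRing.Build C
  Cmult_assoc Cmult_comm Cmult_1_l Cmult_plus_distr_r RtoC1_neq0.
HB.instance Definition _ := GRing.ComNzRing_isField.Build C Cinv_nonzero_l Cinv_zero.

Lemma RtoC_is_zmod_morphism : zmod_morphism RtoC.
Proof. by move=> x y; rewrite RtoC_minus. Qed.
Lemma RtoC_is_monoid_morphism : monoid_morphism RtoC.
Proof. by split=> // x y; rewrite RtoC_mult. Qed.
HB.instance Definition _ := GRing.isZmodMorphism.Build R C RtoC RtoC_is_zmod_morphism.
HB.instance Definition _ := GRing.isMonoidMorphism.Build R C RtoC RtoC_is_monoid_morphism.

Lemma Cconj_is_zmod_morphism : zmod_morphism Cconj.
Proof. by move=> x y; rewrite Cminus_conj. Qed.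
Lemma Cconj_is_monoid_morphism : monoid_morphism Cconj.
Proof. by split=> [|x y]; [apply: injective_projections => //=; rewrite Ropp_0 | rewrite Cmult_conj]. Qed.
HB.instance Definition _ := GRing.isZmodMorphism.Build C C Cconj Cconj_is_zmod_morphism.
HB.instance Definition _ := GRing.isMonoidMorphism.Build C C Cconj Cconj_is_monoid_morphism.

Lemma CmodM (x y : C) : Cmod (x * y) = Cmod x * Cmod y.
Proof. exact: Cmod_mult. Qed.

Lemma Cmod0z : Cmod 0 = 0. Proof. exact: Cmod_0. Qed.
Lemma Cmod1z : Cmod 1 = 1. Proof. exact: Cmod_1. Qed.

Lemma CmodX (x : C) n : Cmod (x ^+ n) = Cmod x ^+ n.
Proof. by elim: n => [|n IH]; rewrite ?expr0 ?Cmod1z // !exprS CmodM IH. Qed.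

Lemma CmodN (x : C) : Cmod (- x) = Cmod x.
Proof. exact: Cmod_opp. Qed.

Lemma Cmod_RtoC (x : R) : Cmod (RtoC x) = `|x|.
Proof. exact: Cmod_R. Qed.

Lemma Cmod_nonneg (x : C) : 0 <= Cmod x.
Proof. apply/RleP; exact: Cmod_ge_0. Qed.

Lemma CmodD (x y : C) : Cmod (x + y) <= Cmod x + Cmod y.
Proof. apply/RleP; exact: Cmod_triangle. Qed.

Lemma Cmod_sum I (r : seq I) (P : pred I) (f : I -> C) :
  Cmod (\sum_(i <- r | P i) f i) <= \sum_(i <- r | P i) Cmod (f i).
Proof.
apply: (big_ind2 (fun z x => Cmod z <= x)) => //; first by rewrite Cmod0z.
by move=> z1 x1 z2 x2 h1 h2; apply: le_trans (CmodD _ _) _; apply: lerD.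
Qed.

Lemma Cmod_dist (x y : C) : `|Cmod x - Cmod y| <= Cmod (x - y).
Proof.
have h1 := CmodD (x - y) y; have h2 := CmodD (y - x) x.
rewrite subrK in h1; rewrite subrK -(opprB x y) CmodN in h2.
by rewrite ler_norml; apply/andP; split; lra.
Qed.

Lemma sqr_Cmod (z : C) : RtoC (Cmod z ^+ 2) = z * Cconj z.
Proof. by rewrite -RpowE; exact: Cmod2_conj. Qed.

(** * The square root of the zeta function *)

(* [half_coef n] is the coefficient of [n^-s] in the square root of the Riemann
   zeta function, [half_local k] its value at the [k]-th power of a prime. *)
Definition half_local (k : nat) : R := ('C(2 * k, k))%:R / 4%:R ^+ k.

Definition half_coef (n : nat) : R := \prod_(q <- primes n) half_local (logn q n).

Lemma half_local0 : half_local 0 = 1.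
Proof. by rewrite /half_local muln0 bin0 expr0 divr1. Qed.

(** This is the differential equation [2 (1 - x) y' = y] of [(1 - x)^(-1/2)], read on
    coefficients. *)
Lemma half_local_rec k : (2 * k.+1)%:R * half_local k.+1 = (2 * k + 1)%:R * half_local k.
Proof.
have E : (k.+1 * 'C(2 * k.+1, k.+1) = 2 * ((2 * k + 1) * 'C(2 * k, k)))%N.
  have h1 := mul_bin_diag (2 * k.+1) k.
  have h2 := mul_bin_diag (2 * k).+1 k.
  have h3 : 'C((2 * k).+1, k) = 'C((2 * k).+1, k.+1).
    by rewrite -[LHS]bin_sub; [congr 'C(_, _); lia | lia].
  rewrite (_ : (2 * k.+1).-1 = (2 * k).+1) in h1; last by lia.
  rewrite /= in h2; rewrite h3 in h1; nia.
rewrite /half_local mulrA -natrM (_ : (2 * k.+1 * 'C(2 * k.+1, k.+1) = 4 * ((2 * k + 1) * 'C(2 * k, k)))%N); last by lia.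
by rewrite natrM exprS invfM natrM; field; rewrite expf_neq0 // pnatr_eq0.
Qed.

Lemma half_local_gt0 k : 0 < half_local k.
Proof. by rewrite divr_gt0 ?exprn_gt0 // ltr0n bin_gt0; lia. Qed.

Lemma half_local_le1 k : half_local k <= 1.
Proof.
elim: k => [|k IH]; first by rewrite half_local0.
have : (2 * k.+1)%:R * half_local k.+1 <= (2 * k.+1)%:R * 1.
  rewrite half_local_rec; apply: ler_pM => //; first exact: ltW (half_local_gt0 k).
  by rewrite ler_nat; lia.
by rewrite ler_pM2l // ltr0n.
Qed.

(** Extending the product by factors [half_local 0 = 1] puts [n] and [q * n] over a common range of
    primes, where they can be compared factor by factor. *)
Lemma half_coefE N n : (0 < n < N)%N -> half_coef n = \prod_(0 <= q < N | prime q) half_local (logn q n).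
Proof.
move=> /andP[n0 nN].
transitivity (\prod_(q <- [seq q <- index_iota 0 N | prime q && (q %| n)%N]) half_local (logn q n)).
  apply: perm_big; apply: uniq_perm; first exact: primes_uniq.
    by apply: filter_uniq; apply: iota_uniq.
  move=> q; rewrite mem_filter mem_primes mem_index_iota n0 /=.
  case: (prime q) => //=; case qn: (q %| n)%N => //=.
  by symmetry; apply: leq_ltn_trans nN; exact: dvdn_leq.
rewrite big_filter big_mkcondr /=; apply: eq_bigr => q pq; case: ifP => // /negbT qn.
by rewrite (_ : logn q n = 0%N) ?half_local0 //; apply/eqP; rewrite lognE pq n0 (negPf qn).
Qed.

Lemma half_coef1 : half_coef 1 = 1. Proof. by rewrite /half_coef big_nil. Qed.

Lemma half_coef_ge0 n : 0 <= half_coef n.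
Proof. by apply: prodr_ge0 => q _; exact: ltW (half_local_gt0 _). Qed.

Lemma half_coef_le1 n : half_coef n <= 1.
Proof. by apply: prodr_ile1 => q _; rewrite (ltW (half_local_gt0 _)) half_local_le1. Qed.

Lemma half_coef_rec q n : prime q -> (0 < n)%N ->
  (2 * (logn q n).+1)%:R * half_coef (q * n)%N = (2 * logn q n + 1)%:R * half_coef n.
Proof.
move=> pq n0; have q1 := prime_gt1 pq.
rewrite (@half_coefE (q * n).+1 (q * n)) ?(@half_coefE (q * n).+1 n); last 2 first.
- by rewrite n0 /=; rewrite ltnS leq_pmull //; lia.
- by rewrite muln_gt0 n0 ltnSn; lia.
have qin : q \in index_iota 0 (q * n).+1 by rewrite mem_index_iota /= ltnS leq_pmulr.
rewrite big_mkcond [in RHS]big_mkcond (bigD1_seq q) ?iota_uniq //= [in RHS](bigD1_seq q) ?iota_uniq //= pq.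
have q0 := prime_gt0 pq.
rewrite lognM // (pfactorK 1) // add1n mulrA half_local_rec -mulrA; congr (_ * (_ * _)).
apply: eq_bigr => q' q'q; case: ifP => // pq'; rewrite lognM //.
by rewrite [logn q' q]lognE pq' q0 /= dvdn_prime2 // (negPf q'q).
Qed.

Lemma half_coef_coprime_pow q k m : prime q -> (0 < m)%N -> ~~ (q %| m)%N -> half_coef (q ^ k * m)%N = half_local k * half_coef m.
Proof.
move=> pq m0 qm; elim: k => [|k IH]; first by rewrite expn0 mul1n half_local0 mul1r.
have q0 := prime_gt0 pq.
have lk : logn q (q ^ k * m)%N = k.
  by rewrite lognM ?expn_gt0 ?q0 // pfactorK // lognE pq m0 (negPf qm) addn0.
have := half_coef_rec pq (_ : (0 < q ^ k * m)%N); rewrite muln_gt0 expn_gt0 q0 m0 => /(_ isT).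
rewrite lk IH mulnA -expnS mulrA -half_local_rec -mulrA => E.
by apply: (mulfI _ E); rewrite pnatr_eq0.
Qed.

Definition half_conv (n : nat) : R := \sum_(d <- divisors n) half_coef d * half_coef (n %/ d)%N.

Lemma divisors_flip (A : nat -> nat -> R) n : (0 < n)%N ->
  \sum_(d <- divisors n) A d (n %/ d)%N = \sum_(d <- divisors n) A (n %/ d)%N d.
Proof.
move=> n0.
have P : perm_eq (divisors n) [seq (n %/ d)%N | d <- divisors n].
  have inj : {in divisors n &, injective (fun d => n %/ d)%N}.
    move=> d e; rewrite -!dvdn_divisors // => dn en E.
    have c0 : (0 < n %/ d)%N by rewrite divn_gt0 ?(dvdn_gt0 n0) // dvdn_leq.
    by apply/eqP; rewrite -(eqn_pmul2l c0) divnK // E divnK.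
  apply: uniq_perm; rewrite ?divisors_uniq // ?map_inj_in_uniq ?divisors_uniq //.
  move=> d; apply/idP/mapP => [dn|[e en ->]].
    move: dn; rewrite -dvdn_divisors // => dn; exists (n %/ d)%N.
      by rewrite -dvdn_divisors // dvdn_div.
    by rewrite divnA // mulKn.
  by rewrite -dvdn_divisors // dvdn_div // dvdn_divisors.
rewrite (perm_big _ P) /= big_map; apply: eq_big_seq => d; rewrite -dvdn_divisors // => dn.
by rewrite divnA // mulKn.
Qed.

(* Weighting each divisor by its [q]-adic valuation, as in differentiating
   [(1 - x)^(-1/2)], gives [v * half_conv n = v * half_conv (n %/ q)]. *)
Lemma half_conv_prime_mul q m : prime q -> (0 < m)%N -> half_conv (q * m)%N = half_conv m.
Proof.
move=> pq m0; have q0 := prime_gt0 pq; have n0 : (0 < q * m)%N by rewrite muln_gt0 q0.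
set n := (q * m)%N in n0 *.
have D1 : \sum_(d <- divisors n) (logn q d)%:R * (half_coef d * half_coef (n %/ d)%N) =
    \sum_(d <- divisors m) (logn q d).+1%:R * (half_coef (q * d)%N * half_coef (m %/ d)%N).
  rewrite (bigID (fun d => (q %| d)%N)) /= [X in _ + X]big1_seq ?addr0; last first.
    move=> d /andP[/negbTE qd _]; rewrite (_ : logn q d = 0%N) ?mul0r //.
    by rewrite lognE qd !andbF.
  rewrite -big_filter (perm_big [seq (q * d)%N | d <- divisors m]) /=.
    rewrite big_map; apply: eq_big_seq => d; rewrite -dvdn_divisors // => dm.
    have d0 : (0 < d)%N := dvdn_gt0 m0 dm.
    rewrite lognM // (pfactorK 1) // add1n; congr (_ * (_ * half_coef _)).
    by rewrite /n divnMl.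
  apply: uniq_perm; rewrite ?filter_uniq ?divisors_uniq //.
    by rewrite map_inj_uniq ?divisors_uniq // => d e /eqP; rewrite eqn_pmul2l // => /eqP.
  move=> d; rewrite mem_filter -dvdn_divisors //; apply/andP/mapP.
    move=> [/dvdnP[e ->] dn]; exists e; last by rewrite mulnC.
    by move: dn; rewrite -dvdn_divisors // mulnC dvdn_pmul2l.
  by move=> [e em ->]; rewrite dvdn_mulr // dvdn_pmul2l // dvdn_divisors.
have S : \sum_(d <- divisors n) (logn q n)%:R * (half_coef d * half_coef (n %/ d)%N) =
   2%:R * \sum_(d <- divisors n) (logn q d)%:R * (half_coef d * half_coef (n %/ d)%N).
  rewrite mulr_natl mulr2n.
  rewrite {2}(divisors_flip (fun d e => (logn q d)%:R * (half_coef d * half_coef e)) n0) -big_split /=.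
  apply: eq_big_seq => d; rewrite -dvdn_divisors // => dn.
  have d0 := dvdn_gt0 n0 dn.
  rewrite -{1}(divnK dn) lognM ?divn_gt0 ?(dvdn_leq n0) // natrD; ring.
have S' : \sum_(d <- divisors m) (logn q m)%:R * (half_coef d * half_coef (m %/ d)%N) =
   2%:R * \sum_(d <- divisors m) (logn q d)%:R * (half_coef d * half_coef (m %/ d)%N).
  rewrite mulr_natl mulr2n.
  rewrite {2}(divisors_flip (fun d e => (logn q d)%:R * (half_coef d * half_coef e)) m0) -big_split /=.
  apply: eq_big_seq => d; rewrite -dvdn_divisors // => dn.
  have d0 := dvdn_gt0 m0 dn.
  rewrite -{1}(divnK dn) lognM ?divn_gt0 ?(dvdn_leq m0) // natrD; ring.
have E : (logn q n)%:R * half_conv n = (logn q n)%:R * half_conv m.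
  rewrite {1}/half_conv big_distrr /= S D1 big_distrr /=.
  rewrite /n lognM // (pfactorK 1) // add1n -[(logn q m).+1]addn1 natrD mulrDl mul1r.
  rewrite {1 2}/half_conv big_distrr /= S' big_distrr -big_split /=.
  apply: eq_big_seq => d; rewrite -dvdn_divisors // => dm.
  have := half_coef_rec pq (dvdn_gt0 m0 dm); rewrite natrM => R1.
  by rewrite mulrA [_ * (half_coef (q * d)%N * _)]mulrA R1 natrD natrM; ring.
apply: (mulfI _ E); rewrite pnatr_eq0 /n lognM // (pfactorK 1) //.
Qed.

Lemma half_conv_eq1 n : (0 < n)%N -> half_conv n = 1.
Proof.
elim/ltn_ind: n => n IH n0; have [n1|n1] := leqP n 1.
  have -> : n = 1%N by lia.
  by rewrite /half_conv (_ : divisors 1 = [:: 1%N]) // big_seq1 divn1 half_coef1 mulr1.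
have pq := pdiv_prime n1; have dq := pdiv_dvd n.
have m0 : (0 < n %/ pdiv n)%N by rewrite divn_gt0 ?prime_gt0 // dvdn_leq.
rewrite -(divnK dq) mulnC half_conv_prime_mul //; apply: IH => //.
by rewrite ltn_Pdiv // prime_gt1.
Qed.

(** These are the coefficients of the square of the series cut at [N]: for [k > 0] they lie between
    0 and [half_conv k = 1], with equality to 1 while the cut has no effect. *)
Definition trunc_conv (N k : nat) : R :=
  \sum_(a < N) \sum_(b < N | (a * b == k)%N) half_coef a * half_coef b.

Lemma half_conv_ord M k : (0 < k < M)%N -> half_conv k = \sum_(a < M | (a %| k)%N) half_coef a * half_coef (k %/ a)%N.
Proof.
move=> /andP[k0 kM]; rewrite /half_conv -(big_mkord (fun a => (a %| k)%N) (fun a => half_coef a * half_coef (k %/ a)%N)).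
rewrite -[RHS]big_filter; apply: perm_big; apply: uniq_perm.
- exact: divisors_uniq.
- by rewrite filter_uniq // iota_uniq.
move=> d; rewrite -dvdn_divisors // mem_filter mem_index_iota /=.
case dk : (d %| k)%N => //=; symmetry; apply: leq_ltn_trans kM; exact: dvdn_leq.
Qed.

Lemma trunc_convE N k : (0 < k)%N ->
  trunc_conv N k = \sum_(a < N | (a %| k)%N && (k %/ a < N)%N) half_coef a * half_coef (k %/ a)%N.
Proof.
move=> k0; rewrite /trunc_conv [RHS]big_mkcond; apply: eq_bigr => a _.
case: ifP => [/andP[ak kaN]|H].
  rewrite (big_pred1 (Ordinal kaN)) // => b /=.
  rewrite -val_eqE /=; have a0 := dvdn_gt0 k0 ak.
  by apply/eqP/eqP => [<-|->]; rewrite ?mulKn // mulnC divnK.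
rewrite big_pred0 // => b; apply: contraFF H => /eqP kE.
move: k0; rewrite -kE muln_gt0 => /andP[a0 _]; rewrite dvdn_mulr //=.
by rewrite mulKn.
Qed.

Lemma trunc_conv_ge0 N k : 0 <= trunc_conv N k.
Proof. by apply: sumr_ge0 => a _; apply: sumr_ge0 => b _; rewrite mulr_ge0 ?half_coef_ge0. Qed.

Lemma trunc_conv_le1 N k : (0 < k)%N -> trunc_conv N k <= 1.
Proof.
move=> k0; rewrite -(half_conv_eq1 k0) (@half_conv_ord (maxn N k.+1)) ?k0 ?leq_max ?ltnSn ?orbT //.
rewrite trunc_convE // (big_ord_widen_cond (maxn N k.+1) (fun a => (a %| k)%N && (k %/ a < N)%N)
  (fun a => half_coef a * half_coef (k %/ a)%N)) ?leq_maxl //.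
rewrite [X in _ <= X](bigID (fun a : 'I__ => (k %/ a < N)%N && (a < N)%N)) /= -[X in X <= _]addr0.
apply: lerD; last by apply: sumr_ge0 => b _; rewrite mulr_ge0 ?half_coef_ge0.
by rewrite le_eqVlt; apply/orP; left; apply/eqP; apply: eq_bigl => a; rewrite andbA.
Qed.

Lemma trunc_conv_eq1 N k : (0 < k < N)%N -> trunc_conv N k = 1.
Proof.
move=> /andP[k0 kN]; rewrite -(half_conv_eq1 k0) (@half_conv_ord N) ?k0 // trunc_convE //.
by apply: eq_bigl => a; rewrite (leq_ltn_trans (leq_div k a) kN) andbT.
Qed.

Lemma sqr_sum_mul (A : comNzRingType) (u f : nat -> A) N :
  (forall a b, f (a * b)%N = f a * f b) ->
  (\sum_(a < N) u a * f a) ^+ 2 =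
  \sum_(k < N * N) (\sum_(a < N) \sum_(b < N | (a * b == k)%N) u a * u b) * f k.
Proof.
move=> fM; rewrite expr2 big_distrl /=.
under [RHS]eq_bigr => k _ do rewrite big_distrl /=.
rewrite [RHS]exchange_big /=; apply: eq_bigr => a _; rewrite big_distrr /=.
under [RHS]eq_bigr => k _ do rewrite big_distrl /= big_mkcond /=.
rewrite [RHS]exchange_big /=; apply: eq_bigr => b _.
have abN : (a * b < N * N)%N by apply: ltn_mul.
rewrite -big_mkcond (big_pred1 (Ordinal abN)) => [|k]; last by rewrite /= -val_eqE /= eq_sym.
by rewrite fM; ring.
Qed.

Lemma inv_natM (a b : nat) : ((a * b)%:R)^-1 = (a%:R)^-1 * (b%:R)^-1 :> R.
Proof. by rewrite natrM invfM. Qed.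

(** The coefficients of the square are at most 1, so the square itself is bounded by one harmonic
    sum. Bounding [half_coef] by 1 before squaring would cost a second logarithm. *)
Lemma sqr_sum_half_coef_le N : (\sum_(a < N) half_coef a / a%:R) ^+ 2 <= \sum_(k < N * N) (k%:R : R)^-1.
Proof.
rewrite (sqr_sum_mul half_coef N inv_natM); apply: ler_sum => k _.
have [->|k0] := eqVneq (k : nat) 0%N; first by rewrite invr0 mulr0.
by rewrite ler_piMl ?invr_ge0 ?ler0n // (@trunc_conv_le1 N) // lt0n.
Qed.

Lemma ln_le_sub1 (y : R) : 0 < y -> ln y <= y - 1.
Proof.
move=> /RltP y0; have /RleP H := exp_ineq1_le (ln y).
by rewrite exp_ln // in H; have {}H : 1 + ln y <= y := H; lra.
Qed.

Lemma lnM (x y : R) : 0 < x -> 0 < y -> ln (x * y) = ln x + ln y.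
Proof. by move=> /RltP x0 /RltP y0; exact: ln_mult. Qed.

Lemma ln_ge0 (x : R) : 1 <= x -> 0 <= ln x.
Proof.
rewrite le_eqVlt => /orP[/eqP<-|/RltP x1]; first by rewrite ln_1.
by have := ln_increasing _ _ Rlt_0_1 x1; rewrite ln_1 => /RltP /ltW.
Qed.

Lemma harmonic_le (N : nat) : (0 < N)%N -> \sum_(k < N.+1) (k%:R : R)^-1 <= 1 + ln N%:R.
Proof.
case: N => // N _; elim: N => [|N IH].
  by rewrite !big_ord_recr big_ord0 /= invr0 invr1 !add0r ln_1 addr0.
rewrite big_ord_recr /=; apply: le_trans (lerD IH (lexx _)) _.
rewrite -addrA lerD2l.
have n1 : 0 < N.+1%:R :> R by rewrite ltr0n.
have n2 : 0 < N.+2%:R :> R by rewrite ltr0n.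
have -> : ln N.+1%:R = ln N.+2%:R + ln (N.+1%:R / N.+2%:R).
  by rewrite -lnM ?divr_gt0 // mulrC divfK // gt_eqF.
have := ln_le_sub1 (divr_gt0 n1 n2).
have -> : N.+1%:R / N.+2%:R = 1 - N.+2%:R^-1 :> R.
  rewrite -[N.+2]addn1 natrD; field; rewrite gt_eqF //; have := ler0n R N; lra.
move: (ln N.+2%:R) (N.+2%:R^-1) => x y; move: (ln _) => z; lra.
Qed.

Lemma sum_inv_sqr_tail_le (N M : nat) : (0 < N)%N ->
  \sum_(N.+1 <= k < M) ((k%:R : R)^-1) ^+ 2 <= (N%:R)^-1.
Proof.
move=> N0; have [MN|NM] := leqP M N.+1; first by rewrite big_geq // invr_ge0 ler0n.
suff : \sum_(N.+1 <= k < M) ((k%:R : R)^-1) ^+ 2 <= (N%:R)^-1 - (M.-1%:R)^-1.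
  by move=> H; apply: le_trans H _; rewrite gerBl invr_ge0 ler0n.
elim: M NM => // M IH; rewrite ltnS => NM.
have {}IH : \sum_(N.+1 <= k < M) ((k%:R : R)^-1) ^+ 2 <= (N%:R)^-1 - (M.-1%:R)^-1.
  by move: NM; rewrite leq_eqVlt => /orP[/eqP<-|/IH//]; rewrite big_geq // subrr.
rewrite big_nat_recr //=; apply: le_trans (lerD IH (lexx _)) _.
have [m ->] : exists m, M = m.+2 by exists M.-2; lia.
have n1 : 0 < m.+1%:R :> R by rewrite ltr0n.
have n2 : 0 < m.+2%:R :> R by rewrite ltr0n.
have : (m.+2%:R^-1) ^+ 2 <= m.+1%:R^-1 - m.+2%:R^-1 :> R.
  have -> : m.+1%:R^-1 - m.+2%:R^-1 = (m.+1%:R * m.+2%:R)^-1 :> R.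
    rewrite -[m.+2]addn1 natrD; field.
    by have := ler0n R m => m0; rewrite !gt_eqF //; lra.
  by rewrite expr2 -invfM lef_pV2 ?posrE ?mulr_gt0 // ler_pM2r // ler_nat.
by rewrite -!addrA lerD2l addrC -lerBrDr opprK addrC.
Qed.

(** * The Euler product *)

Lemma incr_lim (u : nat -> R) (M : R) : (forall n, u n <= u n.+1) -> (forall n, u n <= M) ->
  (forall n, u n <= real (Lim_seq u)) /\ (forall T, (forall n, u n <= T) -> real (Lim_seq u) <= T).
Proof.
move=> incr ub.
have [l ul] : ex_finite_lim_seq u.
  by apply: (ex_finite_lim_seq_incr _ M) => n; apply/RleP.
have -> : Lim_seq u = l by apply: is_lim_seq_unique.
split=> [n|T uT]; apply/RleP => /=.
  by apply: (is_lim_seq_incr_compare u l ul) => k; apply/RleP.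
have : Rbar_le l T.
  apply: (is_lim_seq_le u (fun=> T) l T _ ul (is_lim_seq_const T)).
  by move=> n; apply/RleP.
by [].
Qed.

Lemma sum_n_big (a : nat -> R) n : sum_n a n = \sum_(k < n.+1) a k.
Proof.
elim: n => [|n IH]; first by rewrite sum_O big_ord_recr big_ord0 /= add0r.
by rewrite sum_Sn IH [RHS]big_ord_recr.
Qed.

Lemma fact_factorial n : fact n = n`!.
Proof. by elim: n => // n IH; rewrite factS -IH /=; lia. Qed.

Lemma Binomial_C_bin n m : (m <= n)%N -> Binomial.C n m = 'C(n, m)%:R.
Proof.
move=> mn; rewrite /Binomial.C !fact_factorial !INRE.
have E : n`!%:R = 'C(n, m)%:R * (m`!%:R * (n - m)`!%:R) :> R.
  by rewrite -!natrM bin_fact.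
rewrite -/(n - m)%N RdivE RmultE E mulfK //.
by rewrite mulf_neq0 // pnatr_eq0 -lt0n fact_gt0.
Qed.

Definition half_sqr (n : nat) : R := (half_coef n / n%:R) ^+ 2.

Lemma half_sqr_ge0 n : 0 <= half_sqr n. Proof. exact: sqr_ge0. Qed.

Lemma half_sqr1 : half_sqr 1 = 1. Proof. by rewrite /half_sqr half_coef1 divr1 expr1n. Qed.

Lemma half_sqr_le n : half_sqr n <= (n%:R^-1) ^+ 2.
Proof.
rewrite /half_sqr exprMn ler_piMl ?sqr_ge0 // exprn_ile1 ?half_coef_ge0 ?half_coef_le1 //.
Qed.

Lemma half_sqr_pow_mul q k m : prime q -> (0 < m)%N -> ~~ (q %| m)%N ->
  half_sqr (q ^ k * m)%N = half_sqr (q ^ k)%N * half_sqr m.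
Proof.
move=> pq m0 qm.
have q1 : ~~ (q %| 1)%N by rewrite dvdn1; have := prime_gt1 pq; lia.
have := half_coef_coprime_pow k pq (ltn0Sn 0) q1; rewrite muln1 half_coef1 mulr1 => rq.
by rewrite /half_sqr half_coef_coprime_pow // rq natrM invfM; ring.
Qed.

Lemma C_factorE q : prime q -> C_factor q = Series (fun k => half_sqr (q ^ k)%N).
Proof.
move=> pq; apply: Series_ext => k.
have q1 : ~~ (q %| 1)%N by rewrite dvdn1; have := prime_gt1 pq; lia.
have := half_coef_coprime_pow k pq (ltn0Sn 0) q1; rewrite muln1 half_coef1 mulr1 => rq.
rewrite /half_sqr rq /half_local -[(_ * _)%coq_nat]/(2 * k)%N Binomial_C_bin; last by lia.
rewrite !RpowE RdivE RmultE INRE natrX.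
have -> : IZR 4 = 4%:R by rewrite -INRE INR_IZR_INZ.
by rewrite !exprMn !exprVn -!exprM !(mulnC k 2) invfM; ring.
Qed.

Lemma sum_inj_le (I J : finType) (P : pred I) (Q : pred J) (h : I -> J) (F : J -> R) :
  (forall i, P i -> Q (h i)) -> {in P &, injective h} -> (forall j, 0 <= F j) ->
  \sum_(i | P i) F (h i) <= \sum_(j | Q j) F j.
Proof.
move=> PQ inj F0; rewrite (partition_big h Q) //=; apply: ler_sum => j _.
case: (pickP (fun i => P i && (h i == j))) => [i0 /andP[Pi0 /eqP hi0]|none].
  rewrite (big_pred1 i0) ?hi0 // => i /=; apply/andP/eqP => [[Pi /eqP hi]|->]; last by rewrite hi0.
  by apply: inj; rewrite ?hi.
by rewrite big_pred0.
Qed.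

Definition smooth (M n : nat) := (0 < n)%N && all (fun q => (q <= M)%N) (primes n).

Lemma smoothP M n : reflect ((0 < n)%N /\ forall q, prime q -> (q %| n)%N -> (q <= M)%N) (smooth M n).
Proof.
apply: (iffP andP) => [[n0 /allP H]|[n0 H]]; split=> //.
  by move=> q pq qn; apply: H; rewrite mem_primes pq n0.
by apply/allP => q; rewrite mem_primes => /and3P[pq _ qn]; exact: H.
Qed.

(** Finite sums over smooth integers mediate between [C_partial] and the sum of all [half_sqr n].
    One prime [q] is added at a time through [n = q^k m]: [smooth_sum_le_mul] decomposes [n], and
    [smooth_sum_ge_mul] composes it within a larger range. *)
Definition smooth_sum (M N : nat) : R := \sum_(n < N.+1 | smooth M n) half_sqr n.

Lemma smooth_sum_le_mul M N : prime M.+1 ->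
  smooth_sum M.+1 N <= (\sum_(k < N.+1) half_sqr (M.+1 ^ k)%N) * smooth_sum M N.
Proof.
set q := M.+1 => pq; have q0 := prime_gt0 pq; have q1 := prime_gt1 pq.
have kN (n : 'I_N.+1) : (logn q n < N.+1)%N.
  have [n0|n0] := posnP n; first by rewrite n0 logn0.
  by apply: ltn_trans (ltn_ord n); rewrite ltn_logl.
have mN (n : 'I_N.+1) : (n %/ q ^ logn q n < N.+1)%N by apply: leq_ltn_trans (ltn_ord n); apply: leq_div.
pose g (n : 'I_N.+1) := (Ordinal (kN n), Ordinal (mN n)).
have dec n : (0 < n)%N -> n = (q ^ logn q n * (n %/ q ^ logn q n))%N.
  by move=> n0; rewrite mulnC divnK // pfactor_dvdnn.
have ndvd n : (0 < n)%N -> ~~ (q %| n %/ q ^ logn q n)%N.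
  move=> n0; apply/negP => qd.
  have : (q ^ (logn q n).+1 %| n)%N by rewrite [X in (_ %| X)%N]dec // expnSr dvdn_pmul2l // expn_gt0 q0.
  by rewrite pfactor_dvdn // ltnn.
rewrite big_distrl /=; under [X in _ <= X]eq_bigr => k _ do rewrite big_distrr /=.
rewrite pair_big_dep /= /smooth_sum.
have -> : \sum_(n < N.+1 | smooth q n) half_sqr n =
   \sum_(n < N.+1 | smooth q n) (fun km : 'I_N.+1 * 'I_N.+1 => half_sqr (q ^ km.1)%N * half_sqr km.2) (g n).
  apply: eq_bigr => n /smoothP[n0 _] /=; rewrite -half_sqr_pow_mul // -?dec //; last exact: ndvd.
  by rewrite divn_gt0 ?expn_gt0 ?q0 // dvdn_leq // pfactor_dvdnn.
apply: sum_inj_le.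
- move=> n /smoothP[n0 sn]; apply/smoothP; split=> /=.
    by rewrite divn_gt0 ?expn_gt0 ?q0 // dvdn_leq // pfactor_dvdnn.
  move=> r pr rn; have : (r <= q)%N by apply: sn => //; rewrite [X in (_ %| X)%N]dec // dvdn_mull.
  rewrite leq_eqVlt ltnS => /orP[/eqP rq|//].
  by move: rn; rewrite rq (negPf (ndvd _ n0)).
- move=> n m /smoothP[n0 _] /smoothP[m0 _] [E1 E2]; apply: val_inj => /=.
  transitivity (q ^ logn q n * (n %/ q ^ logn q n))%N; first exact: dec.
  by rewrite E2 E1; symmetry; exact: dec.
- by move=> km; rewrite mulr_ge0 ?half_sqr_ge0.
Qed.

Lemma smooth_sum_ge_mul M N E : prime M.+1 ->
  (\sum_(k < E) half_sqr (M.+1 ^ k)%N) * smooth_sum M N <= smooth_sum M.+1 (M.+1 ^ E * N).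
Proof.
set q := M.+1 => pq; have q0 := prime_gt0 pq; have q1 := prime_gt1 pq.
rewrite big_distrl /=; under eq_bigr => k _ do rewrite big_distrr /=.
rewrite pair_big_dep /= /smooth_sum.
have ndvd m : smooth M m -> ~~ (q %| m)%N.
  by move=> /smoothP[_ H]; apply/negP => qm; have := H q pq qm; rewrite ltnn.
have hB (km : 'I_E * 'I_N.+1) : (q ^ km.1 * km.2 < (q ^ E * N).+1)%N.
  rewrite ltnS; apply: leq_mul; last by rewrite -ltnS.
  by rewrite leq_exp2l // ltnW.
rewrite (eq_bigr (fun km => half_sqr (Ordinal (hB km)))) => [|[k m] /= sm]; last first.
  by rewrite half_sqr_pow_mul //; [case/smoothP: sm | exact: ndvd].
apply: (@sum_inj_le _ _ _ _ (fun km => Ordinal (hB km)) (fun n => half_sqr n)).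
- move=> [k m] /= /smoothP[m0 sm]; apply/smoothP; split=> /=; first by rewrite muln_gt0 expn_gt0 q0.
  move=> r pr; rewrite Euclid_dvdM // => /orP[|/(sm _ pr) rM]; last exact: leqW.
  by rewrite Euclid_dvdX // => /andP[/dvdn_leq->].
- move=> [k m] [k' m'] /= sm sm' /(congr1 (@nat_of_ord _)) /= Ekm.
  rewrite !unfold_in /= in sm sm'.
  have lk (j i : nat) : smooth M i -> logn q (q ^ j * i) = j.
    move=> si; have [i0 _] := smoothP _ _ si.
    rewrite lognM ?expn_gt0 ?q0 // pfactorK // lognE pq i0 (negPf (ndvd _ si)) addn0 //.
  have Ek : k = k'.
    by apply: val_inj; rewrite /= -(lk k m) // Ekm lk.
  congr (_, _) => //; apply: val_inj => /=; apply/eqP; move/eqP: Ekm.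
  by rewrite Ek eqn_pmul2l // expn_gt0 q0.
- by move=> n; exact: half_sqr_ge0.
Qed.

Lemma prime_natP n : Znumtheory.prime (Z.of_nat n) <-> prime n.
Proof.
rewrite -Znumtheory.prime_alt; split.
  move=> [n1 H]; apply/primeP; split=> [|d dn]; first by lia.
  have n0 : (0 < n)%N by lia.
  have d0 := dvdn_gt0 n0 dn; have dle := dvdn_leq n0 dn.
  apply/orP; have [->|d1] := eqVneq d 1%N; [by left|right].
  apply: contraT => dn'; case: (H (Z.of_nat d)); first by lia.
  by move/dvdnP: dn => [k ->]; exists (Z.of_nat k); lia.
move=> pn; split=> [|m m1 [k nk]]; first by have := prime_gt1 pn; lia.
have dn : (Z.to_nat m %| n)%N by apply/dvdnP; exists (Z.to_nat k); nia.
by move: pn => /primeP[_ /(_ _ dn)] /orP[] /eqP; lia.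
Qed.

Lemma sum_half_sqr_le (N M : nat) : (0 < N)%N ->
  \sum_(n < M) half_sqr n <= \sum_(n < N.+1) half_sqr n + N%:R^-1.
Proof.
move=> N0; rewrite -!(big_mkord xpredT half_sqr).
have [MN|NM] := leqP M N.+1.
  rewrite (big_cat_nat (leq0n _) MN) /= -addrA lerDl addr_ge0 ?invr_ge0 ?ler0n //.
  by apply: sumr_ge0 => n _; exact: half_sqr_ge0.
rewrite (big_cat_nat (leq0n _) (ltnW NM)) /= lerD2l.
by apply: le_trans (sum_inv_sqr_tail_le M N0); apply: ler_sum => n _; exact: half_sqr_le.
Qed.

Lemma sum_half_sqr_le2 M : \sum_(n < M) half_sqr n <= 2%:R.
Proof.
apply: le_trans (sum_half_sqr_le M (ltn0Sn 0)) _.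
rewrite !big_ord_recr big_ord0 /= half_sqr1 /half_sqr invr0 mulr0 expr0n /= invr1; lra.
Qed.

Lemma sum_half_sqr_pow_le2 q E : (1 < q)%N -> \sum_(k < E) half_sqr (q ^ k)%N <= 2%:R.
Proof.
move=> q1; apply: le_trans (sum_half_sqr_le2 (q ^ E)).
have hB (k : 'I_E) : (q ^ k < q ^ E)%N by rewrite ltn_exp2l.
apply: (@sum_inj_le _ _ xpredT xpredT (fun k => Ordinal (hB k)) (fun n => half_sqr n)) => //.
  move=> k l _ _ /(congr1 (@nat_of_ord _)) /= /eqP; rewrite eqn_exp2l // => /eqP kl.
  exact: val_inj.
by move=> n; exact: half_sqr_ge0.
Qed.

Lemma C_factor_lim q : prime q ->
  (forall E, \sum_(k < E) half_sqr (q ^ k)%N <= C_factor q) /\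
  (forall T, (forall E, \sum_(k < E) half_sqr (q ^ k)%N <= T) -> C_factor q <= T).
Proof.
move=> pq; rewrite C_factorE //.
have [H1 H2] : (forall n, sum_n (fun k => half_sqr (q ^ k)%N) n <= Series (fun k => half_sqr (q ^ k)%N)) /\
   (forall T, (forall n, sum_n (fun k => half_sqr (q ^ k)%N) n <= T) -> Series (fun k => half_sqr (q ^ k)%N) <= T).
  apply: (incr_lim (M := 2%:R)) => n; rewrite !sum_n_big.
    by rewrite [X in _ <= X]big_ord_recr lerDl half_sqr_ge0.
  by apply: sum_half_sqr_pow_le2; exact: prime_gt1.
split=> [[|E]|T HT]; last by apply: H2 => n; rewrite sum_n_big.
  rewrite big_ord0; apply: le_trans (H1 0%N); rewrite sum_n_big sumr_ge0 // => k _; exact: half_sqr_ge0.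
by have := H1 E; rewrite sum_n_big.
Qed.

Lemma C_factor_ge1 q : prime q -> 1 <= C_factor q.
Proof.
move=> pq; have [H _] := C_factor_lim pq; have := H 1%N.
by rewrite big_ord_recr big_ord0 /= add0r expn0 half_sqr1.
Qed.

Lemma C_partialS M :
  C_partial M.+1 = C_partial M * (if prime M.+1 then C_factor M.+1 else 1).
Proof.
rewrite /=; congr (_ * _); case: prime_dec => pM; case: ifP => // pM'.
  by have := (prime_natP M.+1).1 pM; rewrite pM'.
by case: pM; exact: (prime_natP M.+1).2 pM'.
Qed.

Lemma C_partial_ge1 M : 1 <= C_partial M.
Proof.
elim: M => [|M IH]; first by [].
rewrite C_partialS; apply: mulr_ege1 => //; case: ifP => // pM; exact: C_factor_ge1.
Qed.

Lemma smooth0 n : smooth 0 n = (n == 1%N).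
Proof.
apply/smoothP/eqP => [[n0 H]|->].
  have [|n1] := leqP n 1; first by lia.
  by have := H _ (pdiv_prime n1) (pdiv_dvd n); have := prime_gt0 (pdiv_prime n1); lia.
by split=> // q pq; rewrite dvdn1 => /eqP q1; rewrite q1 in pq.
Qed.

Lemma smoothS M n : ~~ prime M.+1 -> smooth M.+1 n = smooth M n.
Proof.
move=> pM; apply/smoothP/smoothP => -[n0 H]; split=> // q pq qn; have := H q pq qn; last by lia.
by rewrite leq_eqVlt => /orP[/eqP qM|]; [rewrite qM in pq; rewrite pq in pM | lia].
Qed.

Lemma smooth_sum_ge0 M N : 0 <= smooth_sum M N.
Proof. by apply: sumr_ge0 => n _; exact: half_sqr_ge0. Qed.

Lemma smooth_sum_le M N : smooth_sum M N <= C_partial M.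
Proof.
elim: M N => [|M IH] N.
  rewrite /smooth_sum (eq_bigl (fun n : 'I_N.+1 => n == 1%N :> nat)) => [|n]; last exact: smooth0.
  case: N => [|N]; first by rewrite big_mkcond big_ord_recr big_ord0 /= addr0; apply/RleP; exact: Rle_0_1.
  by rewrite (big_pred1 (inord 1)) ?inordK ?half_sqr1 // => n; rewrite /= -[X in _ = X](inj_eq val_inj) /= inordK.
rewrite C_partialS; case: ifP => [pM|/negbT pM]; last first.
  by rewrite mulr1 /smooth_sum (eq_bigl _ _ (fun n : 'I_N.+1 => smoothS n pM)); exact: IH.
apply: le_trans (smooth_sum_le_mul N pM) _; rewrite mulrC; apply: ler_pM => //.
- exact: smooth_sum_ge0.
- by apply: sumr_ge0 => k _; exact: half_sqr_ge0.
- by have [H _] := C_factor_lim pM.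
Qed.

(** The bound [T] is divided by one factor at a time, first to bound the local series and then the
    product over smaller primes, so that no limit of a product is taken. *)
Lemma C_partial_le M T : (forall N, smooth_sum M N <= T) -> C_partial M <= T.
Proof.
elim: M T => [|M IH] T HT.
  apply: le_trans (HT 1%N); rewrite /smooth_sum big_mkcond !big_ord_recr big_ord0 /= half_sqr1.
  by rewrite !add0r.
rewrite C_partialS; case: ifP => [pM|/negbT pM]; last first.
  rewrite mulr1; apply: IH => N; apply: le_trans (HT N).
  by rewrite /smooth_sum (eq_bigl _ _ (fun n : 'I_N.+1 => smoothS n pM)).
have [_ H] := C_factor_lim pM.
have C0 : 0 < C_partial M by apply: lt_le_trans (C_partial_ge1 M).
rewrite mulrC -ler_pdivlMr //; apply: H => E.
case: E => [|E].
  rewrite big_ord0 divr_ge0 ?(ltW C0) //; apply: le_trans (HT 0%N); exact: smooth_sum_ge0.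
have S0 : 0 < \sum_(k < E.+1) half_sqr (M.+1 ^ k)%N.
  rewrite big_ord_recl /= expn0 half_sqr1 ltr_wpDr //; apply: sumr_ge0 => k _; exact: half_sqr_ge0.
rewrite ler_pdivlMr // mulrC -ler_pdivlMr //; apply: IH => N.
rewrite ler_pdivlMr // mulrC; apply: le_trans (HT (M.+1 ^ E.+1 * N)%N).
exact: smooth_sum_ge_mul.
Qed.

(** Every positive [n <= N] is [N]-smooth, which gives the lower bound; the upper one is the tail of
    the sum of [1 / n^2]. *)
Lemma C_const_bounds N : (0 < N)%N ->
  \sum_(n < N.+1) half_sqr n <= C_const /\ C_const <= \sum_(n < N.+1) half_sqr n + N%:R^-1.
Proof.
move=> N0.
have ub M (N' : nat) : (0 < N')%N -> C_partial M <= \sum_(n < N'.+1) half_sqr n + N'%:R^-1.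
  move=> N'0; apply: C_partial_le => K; apply: le_trans (sum_half_sqr_le K.+1 N'0).
  rewrite /smooth_sum big_mkcond; apply: ler_sum => n _; case: ifP => // _; exact: half_sqr_ge0.
have [H1 H2] : (forall n, C_partial n <= C_const) /\ (forall T, (forall n, C_partial n <= T) -> C_const <= T).
  apply: (incr_lim (M := \sum_(n < 2) half_sqr n + 1%:R^-1)) => n; last exact: ub.
  rewrite C_partialS ler_peMr //; first by apply: le_trans (C_partial_ge1 n).
  by case: ifP => // pn; exact: C_factor_ge1.
split; last by apply: H2 => M; exact: ub.
apply: le_trans (H1 N); apply: le_trans (smooth_sum_le N N).
rewrite /smooth_sum [X in _ <= X]big_mkcond; apply: ler_sum => n _.
case: ifP => // /smoothP; have [n0|n0] := posnP n; first by rewrite n0 /half_sqr invr0 mulr0 expr0n.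
case; split=> // q pq qn; have := dvdn_leq n0 qn; have := ltn_ord n; lia.
Qed.

(** * Dirichlet characters *)

Arguments e_ _%_ring_scope.

Lemma e_D (x y : R) : e_ (x + y) = e_ x * e_ y.
Proof.
rewrite /e_ Rmult_plus_distr_l cos_plus sin_plus.
by apply: injective_projections => //=; rewrite !(RplusE, RminusE, RmultE, RoppE); ring.
Qed.

Lemma e_0 : e_ 0 = 1.
Proof. by rewrite /e_ RmultE mulr0 cos_0 sin_0. Qed.

Lemma e_nat (n : nat) : e_ n%:R = 1.
Proof.
elim: n => [|n IH]; first exact: e_0.
rewrite -natr1 e_D IH mul1r /e_ RmultE mulr1.
by rewrite cos_2PI sin_2PI.
Qed.

Lemma e_neq1 (x : R) : 0 < x -> x < 1 -> e_ x != 1.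
Proof.
move=> x0 x1; apply/eqP => /(congr1 fst) /=.
rewrite Rmult_assoc.
have /RltP s0 : 0 < sin (PI * x).
  have p0 : 0 < PI by apply/RltP; exact: PI_RGT_0.
  apply/RltP; apply: sin_gt_0; apply/RltP; first by apply: mulr_gt0.
  by rewrite -[X in _ < X]mulr1 ltr_pM2l.
rewrite cos_2a_sin => E.
have : 0 < sin (PI * x) * sin (PI * x) by apply: mulr_gt0; apply/RltP.
have : 1 - 2 * (sin (PI * x) * sin (PI * x)) = 1.
  by rewrite -[RHS]E mulrA.
lra.
Qed.

Lemma e_conj (x : R) : Cconj (e_ x) = e_ (- x).
Proof.
apply: injective_projections; rewrite /e_ /=.
  by rewrite Ropp_mult_distr_r_reverse cos_neg.
by rewrite Ropp_mult_distr_r_reverse sin_neg.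
Qed.

Lemma e_X (x : R) n : e_ x ^+ n = e_ (n%:R * x).
Proof.
elim: n => [|n IH]; first by rewrite expr0 mul0r e_0.
by rewrite exprS IH -e_D -natr1 mulrDl mul1r addrC.
Qed.

Lemma e_prim (n : nat) : (0 < n)%N -> n.-primitive_root (e_ (n%:R)^-1).
Proof.
move=> n0; have nR : n%:R != 0 :> R by rewrite pnatr_eq0 -lt0n.
rewrite /primitive_root_of_unity n0 /=; apply/forallP => i; apply/eqP.
rewrite unity_rootE e_X; have [->|in1] := eqVneq i.+1 n; first by rewrite divff // (e_nat 1) eqxx.
apply/negbTE/e_neq1; first by rewrite divr_gt0 // ltr0n.
by rewrite ltr_pdivrMr ?ltr0n // mul1r ltr_nat ltn_neqAle in1 ltn_ord.
Qed.

Section Characters.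
Variables (F : finFieldType) (h : nat) (charF : (2 * h).+1 \in [pchar F]) (cardF : #|F| = (2 * h).+1).
Local Notation p := (2 * h).+1.
Local Notation root1 := (e_ ((2 * h)%:R)^-1).

Lemma p1_gt0 : (0 < 2 * h)%N.
Proof. by have := h_gt0 charF; lia. Qed.

Variables (g : F) (gP : (2 * h).-primitive_root g).

Lemma root1_prim : (2 * h).-primitive_root root1.
Proof. exact: e_prim p1_gt0. Qed.

Lemma expf_p1 (x : F) : x != 0 -> x ^+ (2 * h) = 1.
Proof. by move=> x0; apply: (mulfI x0); rewrite -exprS mulr1 -[X in _ ^+ X]cardF; exact: expf_card. Qed.

Definition dlog (x : F) : nat := if [pick k : 'I_(2 * h) | g ^+ k == x] is Some k then k else 0%N.

Lemma dlogK (x : F) : x != 0 -> g ^+ dlog x = x.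
Proof.
move=> x0; rewrite /dlog; case: pickP => [k /eqP//|none].
by have [i xi] := prim_rootP gP (expf_p1 x0); have := none i; rewrite xi eqxx.
Qed.

Definition dlog_char (j : nat) (x : F) : C := if x == 0 then 0 else root1 ^+ (j * dlog x).

Lemma chi0 j : dlog_char j 0 = 0. Proof. by rewrite /dlog_char eqxx. Qed.

Lemma root1_dlog j (x : F) (k : nat) : x != 0 -> x = g ^+ k -> root1 ^+ (j * dlog x) = root1 ^+ (j * k).
Proof.
move=> x0 xk; rewrite !(mulnC j) !exprM; congr (_ ^+ _).
by apply/eqP; rewrite (eq_prim_root_expr root1_prim) -(eq_prim_root_expr gP) dlogK // xk.
Qed.

Lemma chi1 j : dlog_char j 1 = 1.
Proof. by rewrite /dlog_char oner_eq0 (@root1_dlog _ _ 0%N) ?oner_neq0 ?expr0 // muln0. Qed.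

Lemma chiM j (x y : F) : dlog_char j (x * y) = dlog_char j x * dlog_char j y.
Proof.
rewrite /dlog_char mulf_eq0; case: eqVneq => [|x0] /=; first by rewrite mul0r.
case: eqVneq => [|y0]; first by rewrite mulr0.
rewrite -exprD -mulnDr; apply: root1_dlog; first by rewrite mulf_neq0.
by rewrite exprD !dlogK.
Qed.

Lemma chi_conj j (x : F) : Cconj (dlog_char j x) = dlog_char j x^-1.
Proof.
have [->|x0] := eqVneq x 0; first by rewrite invr0 chi0 rmorph0.
have H : dlog_char j x^-1 * dlog_char j x = 1 by rewrite -chiM mulVf // chi1.
have H' : Cconj (dlog_char j x) * dlog_char j x = 1.
  rewrite /dlog_char (negPf x0) e_X e_conj -e_D addNr; exact: e_0.
have c0 : dlog_char j x != 0 by apply: contra_eq_neq H => ->; rewrite mulr0 eq_sym oner_neq0.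
by apply: (mulIf c0); rewrite H H'.
Qed.

Lemma Cmod_chi_le1 j (x : F) : Cmod (dlog_char j x) <= 1.
Proof.
have [->|x0] := eqVneq x 0; first by rewrite chi0 Cmod0z.
have : RtoC (Cmod (dlog_char j x) ^+ 2) = 1.
  by rewrite sqr_Cmod chi_conj -chiM divff // chi1.
move/RtoC_inj => E; have {}E : Cmod (dlog_char j x) ^+ 2 = 1 := E.
by rewrite -(@ler_pXn2r _ 2) ?nnegrE ?Cmod_nonneg // E expr1n.
Qed.

Lemma chi_gen j : dlog_char j g = root1 ^+ j.
Proof.
have g0 := prim_root_neq0 charF cardF gP.
by rewrite /dlog_char (negPf g0) (@root1_dlog _ _ 1%N) // muln1.
Qed.

Lemma chi_orth (x : F) : x != 0 -> \sum_(j < 2 * h) dlog_char j x = if x == 1 then (2 * h)%:R else 0.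
Proof.
move=> x0; have [->|x1] := eqVneq x 1.
  under eq_bigr => j _ do rewrite chi1.
  by rewrite sumr_const card_ord.
have om1 : root1 ^+ dlog x != 1.
  rewrite -(prim_order_dvd root1_prim) (prim_order_dvd gP) dlogK //.
rewrite (eq_bigr (fun j : 'I_(2 * h) => (root1 ^+ dlog x) ^+ j)) => [|j _]; last first.
  by rewrite /dlog_char (negPf x0) -exprM; congr (_ ^+ _); exact: mulnC.
have := subrX1 (root1 ^+ dlog x) (2 * h); rewrite exprAC (prim_expr_order root1_prim) expr1n subrr.
by move=> /esym/eqP; rewrite mulf_eq0 subr_eq0 (negPf om1) => /eqP.
Qed.

Lemma chi_sum j : (0 < j < 2 * h)%N -> \sum_x dlog_char j x = 0.
Proof.
move=> /andP[j0 jh]; have g0 := prim_root_neq0 charF cardF gP.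
have c1 : dlog_char j g != 1.
  by rewrite chi_gen -(prim_order_dvd root1_prim) gtnNdvd.
have : \sum_x dlog_char j x = dlog_char j g * \sum_x dlog_char j x.
  rewrite {1}(reindex_inj (mulfI g0)) big_distrr /=; apply: eq_bigr => x _; exact: chiM.
move/eqP; rewrite -[X in X == _]mul1r -subr_eq0 -mulrBl mulf_eq0 subr_eq0 eq_sym (negPf c1).
by move/eqP.
Qed.

Lemma chi_inj i j : (i < 2 * h)%N -> (j < 2 * h)%N -> dlog_char i g = dlog_char j g -> i = j.
Proof.
move=> ih jh; rewrite !chi_gen => /eqP; rewrite (eq_prim_root_expr root1_prim) !modn_small //.
by move/eqP.
Qed.

(** A multiplicative function is determined by its value at the generator, which must be a root of
    unity of order dividing [2 * h]. *)
Lemma chi_classification (X : F -> C) : X 0 = 0 -> X 1 = 1 ->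
  (forall x y, X (x * y) = X x * X y) -> exists2 j, (j < 2 * h)%N & forall x, X x = dlog_char j x.
Proof.
move=> X0 X1 XM; have XX x n : X (x ^+ n) = X x ^+ n.
  by elim: n => [|n IH]; rewrite ?expr0 // !exprS XM IH.
have g0 := prim_root_neq0 charF cardF gP.
have [j Xg] : {j : 'I_(2 * h) | X g = root1 ^+ j}.
  by apply: (prim_rootP root1_prim); rewrite -XX (prim_expr_order gP).
exists j => // x; have [->|x0] := eqVneq x 0; first by rewrite X0 chi0.
by rewrite -(dlogK x0) XX Xg /dlog_char dlogK // (negPf x0) -exprM.
Qed.
End Characters.

(** * Quadratic Gauss sums *)

Section GaussSums.
Variables (F : finFieldType) (h : nat) (charF : (2 * h).+1 \in [pchar F]) (cardF : #|F| = (2 * h).+1).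
Hypothesis (evenh : ~~ odd h).
Variables (g : F) (gP : (2 * h).-primitive_root g).
Variables (psi : F -> C).
Hypotheses (psi0 : psi 0 = 1) (psi1 : psi 1 != 1) (psiD : forall x y, psi (x + y) = psi x * psi y)
  (psi_conj : forall x, Cconj (psi x) = psi (- x)).
Local Notation p := (2 * h).+1.
Local Notation chi := (dlog_char h g).
Local Notation legC x := ((legendre x)%:~R : C).

Lemma sum_sqr_C (f : F -> C) : \sum_y f (y ^+ 2) = \sum_x (1 + legC x) * f x.
Proof.
rewrite (partition_big (fun y => y ^+ 2) xpredT) //=; apply: eq_bigr => x _.
rewrite (eq_bigr (fun=> f x)) => [|y /eqP->//].
rewrite sumr_const -[LHS]mulr_natl; congr (_ * _).
rewrite -(rmorph1 intr) -rmorphD /= -(card_sqrt charF cardF) -pmulrn; congr _%:R.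
by apply: eq_card => y; rewrite !inE.
Qed.

Lemma sum_psi (m : F) : \sum_x psi (m * x) = if m == 0 then p%:R else 0.
Proof.
case: eqVneq => [->|m0].
  under eq_bigr => x _ do rewrite mul0r psi0.
  by rewrite sumr_const cardF.
rewrite -(reindex_inj (mulfI m0) (P := xpredT) (F := psi)).
have : \sum_x psi x = psi 1 * \sum_x psi x.
  rewrite {1}(reindex_inj (addrI 1)) big_distrr /=; apply: eq_bigr => x _; exact: psiD.
move/eqP; rewrite -[X in X == _]mul1r -subr_eq0 -mulrBl mulf_eq0 subr_eq0 eq_sym (negPf psi1).
by move/eqP.
Qed.

Definition leg_gauss : C := \sum_(x : F) legC x * psi x.

Lemma legCM (x y : F) : legC (x * y) = legC x * legC y.
Proof. by rewrite (legM charF cardF) intrM. Qed.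

Lemma sum_legC : \sum_(x : F) legC x = 0.
Proof. by rewrite -rmorph_sum (sum_leg charF cardF). Qed.

Lemma gauss_quad (m : F) : m != 0 -> \sum_b psi (m * b ^+ 2) = legC m * leg_gauss.
Proof.
move=> m0; rewrite (sum_sqr_C (fun x => psi (m * x))).
under eq_bigr => x _ do rewrite mulrDl mul1r.
rewrite big_split /= sum_psi (negPf m0) add0r /leg_gauss [in RHS](reindex_inj (mulfI m0)) big_distrr /=.
apply: eq_bigr => x _; rewrite legCM !mulrA -legCM -expr2 (leg_sqr charF cardF) //.
by rewrite mul1r.
Qed.

Lemma leg_gauss_conj : Cconj leg_gauss = leg_gauss.
Proof.
rewrite rmorph_sum /= [RHS](reindex_inj oppr_inj) /=; apply: eq_bigr => x _.
by rewrite rmorphM /= psi_conj (legN charF cardF evenh) rmorph_int.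
Qed.

Lemma leg_gauss_sqr : leg_gauss ^+ 2 = p%:R.
Proof.
have D x : legC x * psi x * leg_gauss = \sum_z (if x == 0 then 0 else legC z * psi ((1 + z) * x)).
  case: eqVneq => [->|x0]; first by rewrite leg0 !mul0r big1.
  rewrite /leg_gauss (reindex_inj (mulfI x0)) big_distrr /=; apply: eq_bigr => z _.
  rewrite legCM mulrACA -psiD !mulrA -legCM -expr2 (leg_sqr charF cardF) // mul1r.
  by congr (_ * psi _); ring.
rewrite expr2 {1}/leg_gauss big_distrl /=; under eq_bigr => x _ do rewrite D.
rewrite exchange_big /=.
have E z : \sum_x (if x == 0 then 0 else legC z * psi ((1 + z) * x)) =
   legC z * (if 1 + z == 0 then p%:R else 0) - legC z.
  rewrite -sum_psi (bigD1 0) //= eqxx add0r [in RHS](bigD1 0) //= mulr0 psi0 mulrDr mulr1.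
  rewrite addrAC subrr add0r big_distrr /=; apply: eq_bigr => x /negPf->//.
under eq_bigr => z _ do rewrite E.
rewrite sumrB sum_legC subr0 (bigD1 (-1)) //= subrr eqxx (legN1 charF cardF evenh) mul1r.
rewrite big1 ?addr0 // => z zN; rewrite ifF ?mulr0 //.
by rewrite addrC addr_eq0; apply: negbTE.
Qed.

(** The Gauss sum is real because [legendre] is even, so nothing is lost; a real value is needed for
    [sixth_kernel] to be real. *)
Definition leg_gauss_re : R := leg_gauss.1.

Lemma leg_gauss_reE : RtoC leg_gauss_re = leg_gauss.
Proof.
have := leg_gauss_conj; rewrite /leg_gauss_re; case: leg_gauss => a b [] /= E; congr (_, _).
have : b = - b := esym E.
move=> Eb; have : b + b = 0 by rewrite {1}Eb addNr.
by move/eqP; rewrite -mulr2n mulrn_eq0 /= => /eqP ->.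
Qed.

Lemma leg_gauss_re_sqr : leg_gauss_re ^+ 2 = p%:R.
Proof.
apply: RtoC_inj; change (RtoC (leg_gauss_re ^+ 2) = RtoC p%:R).
by rewrite rmorphXn /= leg_gauss_reE leg_gauss_sqr rmorph_nat.
Qed.

Definition quad_gauss (n : F) (j : nat) : C := \sum_x chi j x * psi (n * x ^+ 2).
Definition leg_char_sum (j : nat) : C := \sum_(z : F) chi j z * (leg_sub1 z)%:~R.

Lemma chiN j (x : F) : chi j (- x) = chi j (-1) * chi j x.
Proof. by rewrite -(chiM charF cardF gP) mulN1r. Qed.

(** In the double sum for [|G|^2] put [a = z b]. The sum over [b] of [psi (n (z^2 - 1) b^2)] is [p]
    for [z^2 = 1] and a quadratic Gauss sum otherwise. Leaving out [b = 0] subtracts the sum of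
    [chi j z], which vanishes for [j > 0]. *)
Lemma quad_gauss_sqr (n : F) j : n != 0 -> (0 < j < 2 * h)%N ->
  RtoC (Cmod (quad_gauss n j) ^+ 2) = p%:R * (1 + chi j (-1)) + legC n * leg_gauss * leg_char_sum j.
Proof.
move=> n0 jh; rewrite sqr_Cmod {2}/quad_gauss rmorph_sum /= big_distrr /=.
have D b : quad_gauss n j * Cconj (chi j b * psi (n * b ^+ 2)) =
    \sum_z (if b == 0 then 0 else chi j z * psi (n * (z ^+ 2 - 1) * b ^+ 2)).
  rewrite rmorphM /= (chi_conj charF cardF gP) psi_conj; case: eqVneq => [->|b0].
    by rewrite invr0 chi0 mul0r mulr0 big1.
  rewrite /quad_gauss (reindex_inj (mulIf b0)) big_distrl /=; apply: eq_bigr => z _.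
  rewrite mulrACA -(chiM charF cardF gP) mulfK // -psiD; congr (_ * psi _); ring.
under eq_bigr => b _ do rewrite D.
rewrite exchange_big /=.
have E z : \sum_b (if b == 0 then 0 else chi j z * psi (n * (z ^+ 2 - 1) * b ^+ 2)) =
   chi j z * ((z ^+ 2 == 1)%:R * p%:R) + chi j z * (legC n * leg_gauss * (leg_sub1 z)%:~R) - chi j z.
  transitivity (chi j z * (\sum_b psi (n * (z ^+ 2 - 1) * b ^+ 2) - 1)).
    rewrite (bigD1 0) //= eqxx add0r [in RHS](bigD1 0) //= expr0n mulr0 psi0 addrAC subrr add0r.
    by rewrite big_distrr /=; apply: eq_bigr => x /negPf->.
  have [z1|z1] := eqVneq (z ^+ 2) 1.
    rewrite /leg_sub1 z1 subrr mulr0 leg0 mulr0 mulr0 addr0 mul1r.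
    under eq_bigr => b _ do rewrite mul0r psi0.
    by rewrite sumr_const cardF mulrBr mulr1.
  rewrite gauss_quad; last by rewrite mulf_neq0 // subr_eq0.
  by rewrite legCM /leg_sub1 /=; ring.
under eq_bigr => z _ do rewrite E.
rewrite sumrB (chi_sum charF cardF gP jh) subr0 big_split /=; congr (_ + _).
  rewrite (bigD1 1) //= expr1n eqxx (bigD1 (-1)) ?(neg1_neq1 charF cardF) //= sqrrN expr1n eqxx.
  rewrite (chi1 charF cardF gP) big1 => [|z /andP[z1 zN]]; first by rewrite addr0 /= !mulr1n; ring.
  by rewrite sqrf_eq1 (negPf z1) (negPf zN) mul0r mulr0.
move: (legC n * leg_gauss) => c; rewrite /leg_char_sum big_distrr /=; apply: eq_bigr => z _; ring.
Qed.

Lemma char_sum_conv j (u w : F -> int) :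
  (\sum_z chi j z * (u z)%:~R) * (\sum_z chi j z * (w z)%:~R) =
  \sum_z chi j z * (\sum_(a | a != 0) u a * w (z / a))%:~R.
Proof.
rewrite big_distrl /= (bigD1 0) //= (chi0 h g) !mul0r add0r.
transitivity (\sum_(a | a != 0) \sum_z chi j z * (u a * w (z / a))%:~R).
  apply: eq_bigr => a a0; rewrite [RHS](reindex_inj (mulfI a0)) big_distrr /=.
  apply: eq_bigr => z _; have -> : a * z / a = z by rewrite mulrC mulKf.
  by rewrite (chiM charF cardF gP) intrM; ring.
rewrite exchange_big /=; apply: eq_bigr => z _.
by rewrite rmorph_sum big_distrr.
Qed.

Lemma leg_char_sum_even j : chi j (-1) * leg_char_sum j = leg_char_sum j.
Proof.
rewrite /leg_char_sum big_distrr /= [RHS](reindex_inj oppr_inj) /=; apply: eq_bigr => z _.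
by rewrite mulrA -chiN /leg_sub1 sqrrN.
Qed.

Lemma chiN1_sqr j : chi j (-1) ^+ 2 = 1.
Proof. by rewrite expr2 -(chiM charF cardF gP) mulrNN mulr1 (chi1 charF cardF gP). Qed.

(* Expansion of [(p D + c S) ^+ 3], where [D = 1 + chi (-1)] and [c ^+ 2 = p],
   by means of [D ^+ 2 = 2 D] and [D S = 2 S]. *)
Definition sixth_kernel (n z : F) : R :=
  4 * p%:R ^+ 3 * (z ^+ 2 == 1)%:R + 12 * p%:R ^+ 2 * ((legendre n)%:~R * leg_gauss_re) * (leg_sub1 z)%:~R
  + 6 * p%:R ^+ 2 * (leg_conv2 z)%:~R + ((legendre n)%:~R * leg_gauss_re) * p%:R * (leg_conv3 z)%:~R.

Lemma sum_char_sixth_kernel (n : F) j : n != 0 ->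
  \sum_z chi j z * RtoC (sixth_kernel n z) = (p%:R * (1 + chi j (-1)) + legC n * leg_gauss * leg_char_sum j) ^+ 3.
Proof.
move=> n0; set c := legC n * leg_gauss.
have c2 : c ^+ 2 = p%:R.
  by rewrite exprMn leg_gauss_sqr -rmorphXn /= (sqr_leg charF cardF) // mul1r.
have cE : RtoC ((legendre n)%:~R * leg_gauss_re) = c by rewrite rmorphM /= leg_gauss_reE rmorph_int.
have S2 : leg_char_sum j ^+ 2 = \sum_z chi j z * (leg_conv2 z)%:~R by rewrite expr2 char_sum_conv.
have S3 : leg_char_sum j ^+ 3 = \sum_z chi j z * (leg_conv3 z)%:~R by rewrite exprS S2 char_sum_conv.
have D1 : \sum_z chi j z * (z ^+ 2 == 1)%:R = 1 + chi j (-1).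
  rewrite (bigD1 1) //= expr1n eqxx (bigD1 (-1)) ?(neg1_neq1 charF cardF) //= sqrrN expr1n eqxx.
  rewrite (chi1 charF cardF gP) big1 => [|z /andP[z1 zN]]; first by rewrite addr0 /= !mulr1n; ring.
  by rewrite sqrf_eq1 (negPf z1) (negPf zN) mulr0.
have -> : \sum_z chi j z * RtoC (sixth_kernel n z) = 4 * p%:R ^+ 3 * (1 + chi j (-1)) +
    12 * p%:R ^+ 2 * c * leg_char_sum j + 6 * p%:R ^+ 2 * leg_char_sum j ^+ 2 + c * p%:R * leg_char_sum j ^+ 3.
  rewrite -D1 S2 S3 /leg_char_sum !big_distrr /= -!big_split /=; apply: eq_bigr => z _.
  rewrite /sixth_kernel; move: (_ * leg_gauss_re) cE => cR <-.
  by rewrite !rmorphD !rmorphM /= !rmorph_int !rmorph_nat; ring.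
have := leg_char_sum_even j; have := chiN1_sqr j; move: (leg_char_sum j) (chi j (-1)) => s e e2 es.
have e3 : e ^+ 3 = e by rewrite exprS e2 mulr1.
have c3 : c ^+ 3 = p%:R * c by rewrite exprS c2 mulrC.
transitivity (p%:R ^+ 3 * (1 + 3 * e + 3 * e ^+ 2 + e ^+ 3) + 3 * p%:R ^+ 2 * c * ((1 + 2 * e + e ^+ 2) * s)
    + 3 * p%:R * c ^+ 2 * ((1 + e) * s * s) + c ^+ 3 * s ^+ 3); last by ring.
have -> : (1 + 2 * e + e ^+ 2) * s = s + 2 * (e * s) + e * (e * s) by ring.
have -> : (1 + e) * s * s = s * s + e * s * s by ring.
rewrite e3 e2 c2 c3 !es; ring.
Qed.

Lemma Cmod_quad_gauss_six (n : F) j : n != 0 -> (0 < j < 2 * h)%N ->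
  RtoC (Cmod (quad_gauss n j) ^+ 6) = \sum_z chi j z * RtoC (sixth_kernel n z).
Proof.
move=> n0 jh; rewrite sum_char_sixth_kernel // -quad_gauss_sqr // -rmorphXn /= -exprM //.
Qed.

(* Replacing [n] by [g n] changes the sign of the second term of
   [quad_gauss_sqr], and both squares are nonnegative. *)
Lemma Cmod_quad_gauss_bound (n : F) j : n != 0 -> (0 < j < 2 * h)%N -> Cmod (quad_gauss n j) ^+ 2 <= 4 * p%:R.
Proof.
move=> n0 jh; have g0 := prim_root_neq0 charF cardF gP.
have gn0 : g * n != 0 by rewrite mulf_neq0.
have E : RtoC (Cmod (quad_gauss n j) ^+ 2 + Cmod (quad_gauss (g * n) j) ^+ 2) = 2 * p%:R * (1 + chi j (-1)).
  rewrite rmorphD /= !quad_gauss_sqr // legCM (leg_generator charF cardF gP); ring.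
have := congr1 Cmod E; rewrite Cmod_RtoC ger0_norm ?addr_ge0 ?sqr_ge0 // CmodM => {}E.
apply: le_trans (_ : Cmod (quad_gauss n j) ^+ 2 + Cmod (quad_gauss (g * n) j) ^+ 2 <= _).
  by rewrite lerDl sqr_ge0.
rewrite E.
have -> : Cmod (2 * p%:R) = 2 * p%:R.
  by rewrite -natrM -(rmorph_nat RtoC) Cmod_RtoC ger0_norm ?ler0n // natrM.
have : Cmod (1 + chi j (-1)) <= 2.
  apply: le_trans (CmodD _ _) _; rewrite Cmod1z.
  have := Cmod_chi_le1 charF cardF gP j (-1); lra.
have : 0 <= p%:R :> R by rewrite ler0n.
by move=> p0 H; nra.
Qed.

Lemma leg_gauss_re_ge1 : 1 <= `|leg_gauss_re|.
Proof.
rewrite -(@ler_pXn2r _ 2) ?nnegrE // expr1n real_normK ?num_real // leg_gauss_re_sqr.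
by rewrite ler1n.
Qed.

Lemma norm_intr_le (k : int) (m : nat) : `|k| <= m%:Z -> `|k%:~R : R| <= m%:R.
Proof. by move=> km; rewrite -intr_norm -[m%:R]/(m%:Z%:~R) ler_int. Qed.

(** Where [z^2 = 1] the second and third order terms give [4 p^3 + 6 p^2 (p - 3)], that is
    [10 p^3 - 18 p^2]. Elsewhere 850 is [12 + 6 * 37 + 616], with 37 chosen so that its square
    exceeds 1300. *)
Lemma sixth_kernel_bound (n z : F) : n != 0 -> z != 0 ->
  `|sixth_kernel n z - 10 * p%:R ^+ 3 * (z ^+ 2 == 1)%:R| <= 850 * p%:R ^+ 2 * `|leg_gauss_re|.
Proof.
move=> n0 z0; rewrite /sixth_kernel; set s := `|leg_gauss_re|; have s1 : 1 <= s := leg_gauss_re_ge1.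
have s2 : s ^+ 2 = p%:R by rewrite real_normK ?num_real // leg_gauss_re_sqr.
set c := (legendre n)%:~R * leg_gauss_re.
have cs : `|c| <= s.
  rewrite normrM -[X in _ <= X]mul1r ler_wpM2r //.
  exact: (@norm_intr_le _ 1%N (norm_leg_le1 n)).
move: c cs => c cs; have p1 : 1 <= p%:R :> R by rewrite ler1n.
have v3b : `|(leg_conv3 z)%:~R : R| <= 616 * p%:R.
  rewrite -natrM; apply: norm_intr_le; exact: (leg_conv3_bound charF cardF evenh z0).
have p2 : 0 <= p%:R ^+ 2 :> R by exact: sqr_ge0.
have B3 : `|c * p%:R * (leg_conv3 z)%:~R| <= 616 * p%:R ^+ 2 * s.
  rewrite !normrM (ger0_norm (ler0n _ _)).
  apply: le_trans (_ : s * p%:R * (616 * p%:R) <= _); last by rewrite le_eqVlt; apply/orP; left; apply/eqP; ring.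
  by apply: ler_pM; rewrite ?mulr_ge0 ?ler0n // ler_wpM2r ?ler0n.
have [z1|z1] := eqVneq (z ^+ 2) 1.
  rewrite (leg_conv2_sqr_eq1 charF cardF evenh z1) /leg_sub1 z1 subrr leg0 mulr0 addr0 !mulr1n !mulr1.
  rewrite intrB -[p%:Z%:~R]/(p%:R).
  have -> : 4 * p%:R ^+ 3 + 6 * p%:R ^+ 2 * (p%:R - 3%:~R) + c * p%:R * (leg_conv3 z)%:~R - 10 * p%:R ^+ 3 =
     c * p%:R * (leg_conv3 z)%:~R - 18 * p%:R ^+ 2 :> R by ring.
  apply: le_trans (ler_normB _ _) _; rewrite [X in _ + X]ger0_norm ?mulr_ge0 //.
  have : p%:R ^+ 2 * 1 <= p%:R ^+ 2 * s :> R by apply: ler_wpM2l.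
  move: B3 p2; move: (p%:R ^+ 2) `|_| => P x; nra.
rewrite !mulr0 subr0 add0r.
have v1b : `|(leg_sub1 z)%:~R : R| <= 1 by exact: (@norm_intr_le _ 1%N (norm_leg_le1 _)).
have v2b : `|(leg_conv2 z)%:~R : R| <= 37 * s.
  have := leg_conv2_bound charF cardF evenh z0 z1; rewrite -(ler_int R) rmorphXn /= intrM => H.
  rewrite -(@ler_pXn2r _ 2) ?nnegrE ?mulr_ge0 ?ler0n ?normr_ge0 // real_normK ?num_real // exprMn s2.
  apply: le_trans H _; rewrite -[p%:Z%:~R]/(p%:R : R) -natrX ler_wpM2r ?ler0n // -[1300%:~R]/(1300%:R) ler_nat //.
move: (p%:R ^+ 2 : R) p2 B3 => P P0 B3.
have B1 : `|12 * P * c * (leg_sub1 z)%:~R| <= 12 * P * s.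
  rewrite !normrM (ger0_norm P0) (ger0_norm (ler0n R 12)) -[X in _ <= X]mulr1.
  by apply: ler_pM; rewrite ?mulr_ge0 ?ler0n // ler_wpM2l // mulr_ge0 ?ler0n.
have B2 : `|6 * P * (leg_conv2 z)%:~R| <= 6 * P * (37 * s).
  by rewrite !normrM (ger0_norm P0) (ger0_norm (ler0n R 6)) ler_wpM2l // mulr_ge0 ?ler0n.
apply: le_trans (ler_normD _ _) _; apply: le_trans (lerD (ler_normD _ _) (lexx _)) _.
apply: le_trans (lerD (lerD B1 B2) B3) _; lra.
Qed.

End GaussSums.

(** * Dirichlet series at one *)

(** [Lim_seq] is total, so convergence has to be established; the explicit Cauchy rate supplies both
    the limit and the distance to it. *)
Lemma lim_seq_rate (a : nat -> R) (B : R) : 0 <= B ->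
  (forall M N : nat, (0 < M <= N)%N -> `|a N - a M| <= B / M%:R) ->
  forall M : nat, (0 < M)%N -> `|real (Lim_seq a) - a M| <= B / M%:R.
Proof.
move=> B0 H.
have [l al] : ex_finite_lim_seq a.
  apply/ex_lim_seq_cauchy_corr => eps.
  have /RltP e0 := cond_pos eps; set e := pos eps in e0 *.
  have [K /RltP HK] := INR_unbounded (B / e).
  rewrite INRE in HK.
  have K0 : 0 < K%:R :> R by apply: le_lt_trans HK; rewrite divr_ge0 // ltW.
  have BK : B / K%:R < e by rewrite ltr_pdivrMr // mulrC -ltr_pdivrMr.
  have main (m n : nat) : (K <= m)%N -> (m <= n)%N -> `|a n - a m| < e.
    move=> Km mn; have K0' : (0 < K)%N by rewrite -(ltr0n R).
    apply: le_lt_trans BK; apply: le_trans (H m n _) _; first by rewrite mn (leq_trans K0').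
    rewrite ler_wpM2l // lef_pV2 ?posrE ?ltr0n ?ler_nat // (leq_trans K0') //.
  exists K => n m /ssrnat.leP Kn /ssrnat.leP Km; apply/RltP.
  have [nm|mn] := leqP n m; last by apply: main => //; exact: ltnW.
  by have := main n m Kn nm; rewrite distrC.
move=> M M0; have -> : Lim_seq a = l by apply: is_lim_seq_unique.
have B1 : is_lim_seq (fun n => a n - a M) (l - a M).
  by apply: is_lim_seq_minus'; [exact: al | exact: is_lim_seq_const].
have B2 : is_lim_seq (fun n => `|a n - a M|) `|l - a M| by apply: (is_lim_seq_abs _ _ B1).
have : Rbar_le `|l - a M| (B / M%:R).
  apply: (is_lim_seq_le_loc _ (fun=> B / M%:R) _ _ _ B2 (is_lim_seq_const _)).
  exists M => n /ssrnat.leP Mn; apply/RleP; apply: H; rewrite M0 Mn //.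
by move=> /= /RleP.
Qed.

Lemma Cmod_le_parts (z : C) : Cmod z <= `|z.1| + `|z.2|.
Proof.
have zE : z = RtoC z.1 + Ci * RtoC z.2.
  case: z => x y; change ((x, y) = Cplus (RtoC x) (Cmult Ci (RtoC y))).
  by apply: injective_projections; rewrite /= !(Rmult_0_l, Rmult_0_r, Rmult_1_l, Rminus_0_r, Rplus_0_r, Rplus_0_l).
rewrite {1}zE; apply: le_trans (CmodD _ _) _; rewrite CmodM !Cmod_RtoC.
have -> : Cmod Ci = 1.
  by rewrite /Cmod /= !Rmult_0_l !Rmult_1_l Rplus_0_l sqrt_1.
by rewrite mul1r.
Qed.

Lemma sum_n_bigC (a : nat -> C) n : sum_n a n = \sum_(k < n.+1) a k.
Proof.
elim: n => [|n IH]; first by rewrite sum_O big_ord_recr big_ord0 /= add0r.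
by rewrite sum_Sn IH [RHS]big_ord_recr.
Qed.

Section DirichletSeries.
Variables (X : nat -> C) (p : nat).
Hypotheses (p0 : (0 < p)%N) (X1 : forall n, Cmod (X n) <= 1) (Xper : forall n, X (n + p)%N = X n)
  (Xsum : \sum_(n < p) X n = 0).

Definition Xpart (M : nat) : C := \sum_(n < M) X n.
(* The term [n = 0] vanishes, as [0^-1 = 0]. *)
Definition Lpart (M : nat) : C := \sum_(n < M) X n / RtoC n%:R.

Lemma Xpart_le (M : nat) : Cmod (Xpart M) <= p%:R.
Proof.
elim/ltn_ind: M => M IH; have [Mp|pM] := ltnP M p.
  apply: le_trans (Cmod_sum _ _ _) _; apply: le_trans (_ : \sum_(n < M) 1 <= _).
    by apply: ler_sum.
  by rewrite sumr_const card_ord ler_nat ltnW.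
have -> : Xpart M = Xpart (M - p).
  rewrite /Xpart -(big_mkord xpredT X) -(big_mkord xpredT X) (big_cat_nat (leq0n p) pM) /=.
  rewrite [X in X + _](_ : _ = 0) ?add0r; last by rewrite big_mkord.
  by rewrite -{1}[p]add0n big_addn; apply: eq_bigr => n _; exact: Xper.
by apply: IH; lia.
Qed.

(** The partial sum up to index [N] ends at the integer [N + 1], whereas [Lpart] excludes its
    bound. *)
Lemma L1_partialE N : L1_partial X N = Lpart N.+2.
Proof.
rewrite /L1_partial sum_n_bigC /Lpart [RHS]big_ord_recl /= invr0 mulr0 add0r.
by apply: eq_bigr => k _; rewrite /bump /= add1n -INRE.
Qed.

(** Abel summation: the increment of [u] at [N] is [Xpart N.+1] times [1 / N - 1 / (N + 1)], so the
    bound [p] on [Xpart] telescopes, and the two boundary terms complete it to [2 p / M]. *)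
Lemma Lpart_diff (M N : nat) : (0 < M <= N)%N -> Cmod (Lpart N - Lpart M) <= 2 * p%:R / M%:R.
Proof.
move=> /andP[M0 MN]; pose u K := Lpart K - Xpart K / RtoC K%:R.
have natC (K : nat) : RtoC K%:R = K%:R by rewrite rmorph_nat.
have nzC (K : nat) : (0 < K)%N -> K%:R != 0 :> C.
  move=> K0; rewrite -natC; apply/eqP => E.
  have /eqP : K%:R = 0 :> R by apply: RtoC_inj; exact: E.
  by rewrite pnatr_eq0; lia.
have du : Cmod (u N - u M) <= p%:R / M%:R - p%:R / N%:R.
  elim: N MN => [|N IH]; first by lia.
  rewrite leq_eqVlt => /orP[/eqP<-|MN]; first by rewrite !subrr Cmod0z.
  have N0 : (0 < N)%N by lia.
  have NR : 0 < N%:R :> R by rewrite ltr0n.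
  have N1R : 0 < N.+1%:R :> R by rewrite ltr0n.
  have E : u N.+1 - u N = Xpart N.+1 * RtoC (N%:R^-1 - N.+1%:R^-1).
    rewrite /u /Lpart /Xpart !big_ord_recr /= rmorphB /= !fmorphV /= !natC.
    have := nzC N N0; have := nzC N.+1 isT; move=> n1 n2.
    move: (\sum_(i < N) X i / _) (\sum_(i < N) X i) => A T; ring.
  have -> : u N.+1 - u M = (u N.+1 - u N) + (u N - u M) by rewrite addrA subrK.
  apply: le_trans (CmodD _ _) _; have := IH MN; rewrite E CmodM Cmod_RtoC.
  have inv_le : N.+1%:R^-1 <= N%:R^-1 :> R by rewrite lef_pV2 ?posrE // ler_nat.
  rewrite ger0_norm ?subr_ge0 //.
  have : Cmod (Xpart N.+1) * (N%:R^-1 - N.+1%:R^-1) <= p%:R * (N%:R^-1 - N.+1%:R^-1).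
    by rewrite ler_wpM2r ?subr_ge0 // Xpart_le.
  rewrite [p%:R * (_ - _)]mulrBr; move: (Cmod (Xpart _) * _) (Cmod (_ - _)) => x y xy1 xy2.
  by apply: le_trans (lerD xy1 xy2) _; rewrite addrC addrA subrK.
have N0 : (0 < N)%N by lia.
have tl K : Cmod (Xpart K / RtoC K%:R) <= p%:R / K%:R.
  rewrite CmodM -fmorphV Cmod_RtoC ger0_norm ?invr_ge0 ?ler0n // ler_wpM2r ?invr_ge0 ?ler0n //.
  exact: Xpart_le.
have -> : Lpart N - Lpart M = (u N - u M) + (Xpart N / RtoC N%:R - Xpart M / RtoC M%:R).
  by rewrite /u; ring.
apply: le_trans (CmodD _ _) _; apply: le_trans (lerD du (CmodD _ _)) _; rewrite CmodN.
have := tl N; have := tl M; rewrite -mulrA.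
move: (Cmod _) (Cmod _) (p%:R / M%:R) (p%:R / N%:R) => a b c d; lra.
Qed.

Lemma L1_tail (M : nat) : (0 < M)%N -> Cmod (L1 X - Lpart M.+2) <= 4 * p%:R / M%:R.
Proof.
move=> M0; have Bp : 0 <= 2 * p%:R :> R by rewrite mulr_ge0.
have D (K N : nat) : (0 < K <= N)%N -> Cmod (L1_partial X N - L1_partial X K) <= 2 * p%:R / K%:R.
  move=> /andP[K0 KN]; rewrite !L1_partialE; apply: le_trans (Lpart_diff _) _; first by lia.
  by rewrite ler_wpM2l // lef_pV2 ?posrE ?ltr0n // ler_nat; lia.
have H1 := @lim_seq_rate (fun N => (L1_partial X N).1) _ Bp.
have H2 := @lim_seq_rate (fun N => (L1_partial X N).2) _ Bp.
have {}H1 := H1 _ M M0; have {}H2 := H2 _ M M0.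
apply: le_trans (Cmod_le_parts _) _; rewrite -L1_partialE.
have -> : 4 * p%:R / M%:R = 2 * p%:R / M%:R + 2 * p%:R / M%:R :> R by ring.
apply: lerD; [apply: H1 | apply: H2] => K N KN; apply: le_trans (D K N KN).
  by apply/RleP; apply: Rle_trans (Rmax_Cmod _); exact: Rmax_l.
by apply/RleP; apply: Rle_trans (Rmax_Cmod _); exact: Rmax_r.
Qed.

End DirichletSeries.

(** * Mean values over the characters *)

Section MeanValues.
Variables (F : finFieldType) (h : nat) (charF : (2 * h).+1 \in [pchar F]) (cardF : #|F| = (2 * h).+1).
Variables (g : F) (gP : (2 * h).-primitive_root g).
Local Notation p := (2 * h).+1.
Local Notation chi := (dlog_char h g).

Lemma natr_eq_mod (m n : nat) : (m%:R == n%:R :> F) = (m == n %[mod p]).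
Proof.
wlog mn : m n / (m <= n)%N.
  by move=> H; case: (leqP m n) => [/H//|/ltnW /H]; rewrite eq_sym => ->; rewrite eq_sym.
by rewrite eq_sym -subr_eq0 -natrB // -(dvdn_pcharf charF) [in RHS]eq_sym eqn_mod_dvd.
Qed.

Lemma natr_ord_bij : bijective (fun k : 'I_p => (k : nat)%:R : F).
Proof.
apply: inj_card_bij; last by rewrite card_ord cardF.
by move=> k l /eqP; rewrite natr_eq_mod !modn_small // => /eqP /val_inj.
Qed.

Lemma natr_eq0 (n : nat) : (n%:R == 0 :> F) = (p %| n)%N.
Proof. by rewrite (dvdn_pcharf charF). Qed.

Lemma sum_chi_conj (x y : F) : \sum_(j < 2 * h) chi j x * Cconj (chi j y) =
  if (x != 0) && (x == y) then (2 * h)%:R else 0.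
Proof.
have [->|x0] /= := eqVneq x 0; first by rewrite big1 // => j _; rewrite chi0 mul0r.
have [->|y0] := eqVneq y 0.
  by rewrite (negPf x0) big1 // => j _; rewrite chi0 rmorph0 mulr0.
under eq_bigr => j _ do rewrite (chi_conj charF cardF gP) -(chiM charF cardF gP).
rewrite (chi_orth charF cardF gP) ?mulf_neq0 ?invr_eq0 //.
by rewrite -[X in X == 1](mulfK y0) mulfVK // -[X in _ == X](mulfV y0) (inj_eq (mulIf _)) ?invr_neq0.
Qed.

Lemma chi_parseval (q : F -> R) :
  \sum_(j < 2 * h) Cmod (\sum_x chi j x * RtoC (q x)) ^+ 2 = (2 * h)%:R * \sum_(x | x != 0) q x ^+ 2.
Proof.
apply: RtoC_inj.
transitivity (\sum_(j < 2 * h) \sum_x \sum_y RtoC (q x * q y) * (chi j x * Cconj (chi j y))).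
  rewrite (rmorph_sum RtoC) /=; apply: eq_bigr => j _; rewrite sqr_Cmod big_distrl /=.
  apply: eq_bigr => x _; rewrite rmorph_sum big_distrr /=; apply: eq_bigr => y _.
  rewrite rmorphM [RtoC (_ * _)]rmorphM /= (_ : Cconj (RtoC (q y)) = RtoC (q y)); first by ring.
  by apply: injective_projections => //=; rewrite Ropp_0.
rewrite exchange_big /=; transitivity (\sum_x \sum_y RtoC (q x * q y) *
    (if (x != 0) && (x == y) then (2 * h)%:R else 0)).
  apply: eq_bigr => x _; rewrite exchange_big /=; apply: eq_bigr => y _.
  by rewrite -big_distrr /= sum_chi_conj.
change (\sum_x \sum_y RtoC (q x * q y) * (if (x != 0) && (x == y) then (2 * h)%:R else 0) =
   RtoC ((2 * h)%:R * \sum_(x | x != 0) q x ^+ 2)).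
rewrite rmorphM rmorph_nat rmorph_sum big_distrr /= [RHS]big_mkcond /=; apply: eq_bigr => x _.
case: ifP => x0; last by rewrite big1 // => y _; rewrite mulr0.
rewrite (bigD1 x) //= eqxx big1 ?addr0 => [|y yx]; first by rewrite mulrC expr2.
by rewrite eq_sym (negPf yx) mulr0.
Qed.

Definition half_poly (j : nat) : C := \sum_(n < p) chi j n%:R * RtoC (half_coef n / n%:R).

(* [Lpart (p * p) - half_poly ^+ 2] has coefficients [defect], which vanish for
   [k < p] because the coefficients of zeta are all [1]. *)
Definition defect (k : nat) : R := (1 - trunc_conv p k) / k%:R.

Definition fiber_defect (x : F) : R := \sum_(k < p * p | k%:R == x) defect k.

(** The cut at [p * p] matches the range of products of two indices below [p]. Coefficients are then
    collected by residue class to prepare for Parseval. *)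
Lemma Lpart_sub_half_poly_sqr j :
  Lpart (fun n => chi j n%:R) (p * p) - half_poly j ^+ 2 = \sum_x chi j x * RtoC (fiber_defect x).
Proof.
pose f (n : nat) : C := chi j n%:R / RtoC n%:R.
have fM a b : f (a * b)%N = f a * f b.
  by rewrite /f natrM (chiM charF cardF gP) natrM rmorphM /= invfM mulrACA.
have -> : half_poly j = \sum_(n < p) RtoC (half_coef n) * f n.
  by apply: eq_bigr => n _; rewrite /f rmorphM fmorphV /=; ring.
rewrite (sqr_sum_mul (fun n => RtoC (half_coef n)) p fM) /Lpart -sumrB.
transitivity (\sum_(k < p * p) chi j k%:R * RtoC (defect k)).
  apply: eq_bigr => k _.
  have -> : \sum_(a < p) \sum_(b < p | (a * b == k)%N) RtoC (half_coef a) * RtoC (half_coef b) = RtoC (trunc_conv p k).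
    rewrite /trunc_conv rmorph_sum; apply: eq_bigr => a _; rewrite rmorph_sum; apply: eq_bigr => b _.
    by rewrite rmorphM.
  by rewrite /f /defect rmorphM rmorphB rmorph1 fmorphV /=; ring.
rewrite (partition_big (fun k : 'I_(p * p) => (k : nat)%:R : F) xpredT) //=.
apply: eq_bigr => x _; rewrite /fiber_defect rmorph_sum big_distrr /=.
by apply: eq_bigr => k /eqP ->.
Qed.

Lemma defect_ge0 k : 0 <= defect k.
Proof.
have [->|k0] := posnP k; first by rewrite /defect invr0 mulr0.
by rewrite divr_ge0 ?ler0n // subr_ge0 trunc_conv_le1.
Qed.

(** The bound depends only on the quotient [k %/ p]. Distinct members of one residue class have
    distinct quotients, so a class contributes at most a harmonic sum divided by [p]. For [k < p]
    both sides are 0, by the convention on the inverse of 0. *)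
Lemma defect_le k : defect k <= ((k %/ p)%N%:R * p%:R)^-1.
Proof.
have [->|k0] := posnP k; first by rewrite /defect invr0 mulr0 div0n mul0r invr0.
have [kp|pk] := ltnP k p.
  by rewrite /defect trunc_conv_eq1 ?k0 // subrr mul0r divn_small // mul0r invr0.
apply: le_trans (_ : k%:R^-1 <= _).
  by rewrite /defect ler_piMl ?invr_ge0 ?ler0n // gerBl trunc_conv_ge0.
rewrite -natrM lef_pV2 ?posrE ?ltr0n // ?ler_nat; first exact: leq_trunc_div.
by rewrite muln_gt0 divn_gt0 // pk.
Qed.

Lemma fiber_defect_bound (x : F) : 0 <= fiber_defect x <= (1 + ln p%:R) / p%:R.
Proof.
rewrite sumr_ge0 /=; last by move=> k _; exact: defect_ge0.
have dB (k : 'I_(p * p)) : (k %/ p < p)%N by rewrite ltn_divLR.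
apply: le_trans (_ : \sum_(k < p * p | k%:R == x) (fun i : 'I_p => ((i : nat)%:R * p%:R)^-1) (Ordinal (dB k)) <= _).
  by apply: ler_sum => k _; exact: defect_le.
apply: le_trans (_ : \sum_(i < p) ((i : nat)%:R * p%:R)^-1 <= _).
  apply: (@sum_inj_le _ _ _ xpredT) => // [k l /eqP kx /eqP lx /(congr1 (@nat_of_ord _)) /= E|i].
    apply: val_inj => /=; rewrite (divn_eq k p) (divn_eq l p) E; congr (_ + _)%N.
    by apply/eqP; rewrite -natr_eq_mod kx lx.
  by rewrite invr_ge0 mulr_ge0 ?ler0n.
under eq_bigr => i _ do rewrite invfM.
rewrite -big_distrl /= ler_wpM2r ?invr_ge0 ?ler0n //.
apply: le_trans (harmonic_le (ltn0Sn (2 * h))).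
by rewrite [X in _ <= X]big_ord_recr /= lerDl invr_ge0 ler0n.
Qed.

(** By Parseval and [fiber_defect_bound] the sum of squares is at most [H^2]; passing to the first
    power over fewer than [p] characters costs [s], the square root of [p]. *)
Lemma sum_Cmod_Lpart_sub_half_poly (s : R) : 0 < s -> s ^+ 2 = p%:R ->
  \sum_(j < 2 * h) Cmod (Lpart (fun n => chi j n%:R) (p * p) - half_poly j ^+ 2) <= s * (1 + ln p%:R).
Proof.
move=> s0 sp; set H := 1 + ln p%:R.
have H0 : 0 < H by rewrite /H; have := ln_ge0 (_ : 1 <= p%:R :> R); rewrite ler1n => /(_ isT); lra.
have pR : 0 < p%:R :> R by rewrite ltr0n.
pose A j := Cmod (Lpart (fun n => chi j n%:R) (p * p) - half_poly j ^+ 2).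
have SA : \sum_(j < 2 * h) A j ^+ 2 <= H ^+ 2.
  rewrite /A; under eq_bigr => j _ do rewrite Lpart_sub_half_poly_sqr.
  rewrite chi_parseval.
  apply: le_trans (_ : (2 * h)%:R * \sum_(x : F | x != 0) (H / p%:R) ^+ 2 <= _).
    rewrite ler_wpM2l ?ler0n //; apply: ler_sum => x _.
    by have /andP[q0 qH] := fiber_defect_bound x; rewrite lerXn2r // nnegrE ?(le_trans q0).
  have -> : \sum_(x : F | x != 0) (H / p%:R) ^+ 2 = (2 * h)%:R * (H / p%:R) ^+ 2.
    by rewrite sumr_const cardC1 cardF mulr_natl.
  have -> : (2 * h)%:R * ((2 * h)%:R * (H / p%:R) ^+ 2) = H ^+ 2 * ((2 * h)%:R / p%:R) ^+ 2 by ring.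
  rewrite -[X in _ <= X]mulr1 ler_wpM2l ?sqr_ge0 // exprn_ile1 ?divr_ge0 ?ler0n //.
  by rewrite ler_pdivrMr // mul1r ler_nat.
(* AM-GM instead of Cauchy-Schwarz *)
have AM j : A j <= (A j ^+ 2 * (s / H) + H / s) / 2.
  have : 0 <= (A j - H / s) ^+ 2 * (s / H) by rewrite mulr_ge0 ?sqr_ge0 ?divr_ge0 ?ltW.
  have -> : (A j - H / s) ^+ 2 * (s / H) = A j ^+ 2 * (s / H) - 2 * A j + H / s.
    by field; rewrite !gt_eqF.
  by move: (_ * (s / H)) (H / s) => u v; lra.
apply: le_trans (_ : \sum_(j < 2 * h) (A j ^+ 2 * (s / H) + H / s) / 2 <= _); first by apply: ler_sum => j _; exact: AM.
rewrite -big_distrl /= big_split /= -big_distrl /= sumr_const card_ord -[_ *+ (2 * h)]mulr_natl.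
have B1 : \sum_(j < 2 * h) A j ^+ 2 * (s / H) <= s * H.
  rewrite -[X in _ <= X](_ : H ^+ 2 * (s / H) = _); last by field; rewrite gt_eqF.
  by rewrite -big_distrl /= ler_wpM2r // divr_ge0 ?ltW.
have B2 : (2 * h)%:R * (H / s) <= s * H.
  rewrite -[X in _ <= X](_ : s ^+ 2 * (H / s) = _); last by field; rewrite gt_eqF.
  by rewrite sp ler_wpM2r ?divr_ge0 ?ltW // ltr_nat.
rewrite big_distrl /=; lra.
Qed.

End MeanValues.

(** * The sixth moment *)

Section MainSum.
Variables (F : finFieldType) (h : nat) (charF : (2 * h).+1 \in [pchar F]) (cardF : #|F| = (2 * h).+1).
Local Notation p := (2 * h).+1.

Definition half_div (m : nat) : R := half_coef m / m%:R.

Lemma half_div_ge0 m : 0 <= half_div m. Proof. by rewrite divr_ge0 ?half_coef_ge0 ?ler0n. Qed.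

Lemma half_div_le m : half_div m <= m%:R^-1.
Proof. by rewrite /half_div ler_piMl ?invr_ge0 ?ler0n ?half_coef_le1. Qed.

Lemma half_div0 : half_div 0 = 0. Proof. by rewrite /half_div invr0 mulr0. Qed.

Lemma natr_neq0 (m : 'I_p) : m != 0%N :> nat -> (m : nat)%:R != 0 :> F.
Proof.
move=> m0; rewrite (natr_eq0 charF) gtnNdvd ?lt0n //.
Qed.

Lemma sqr_ratio_eq1 (m k : 'I_p) : m != 0%N :> nat ->
  (((k : nat)%:R / (m : nat)%:R : F) ^+ 2 == 1) = (k == m :> nat) || (k == p - m :> nat)%N.
Proof.
move=> m0; have mF := natr_neq0 m0; rewrite sqrf_eq1; congr orb.
  rewrite -[X in _ == X](mulfV mF) (inj_eq (mulIf _)) ?invr_neq0 //.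
  by rewrite (natr_eq_mod charF) !modn_small.
rewrite -(inj_eq (mulIf mF)) divfK // mulN1r -subr_eq0 opprK -natrD (natr_eq0 charF).
apply/idP/eqP => [/dvdnP[q qE]|->]; last by rewrite subnK ?dvdnn // ltnW.
have := ltn_ord k; have := ltn_ord m; case: q qE => [|[|q]] E; nia.
Qed.

(** The pairs [k = m] give the sum of [half_sqr]. The pairs [k = p - m] contribute at most [1 / (m
    (p - m)) = (1 / m + 1 / (p - m)) / p] each, hence the logarithm divided by [p]. *)
Lemma sum_half_div_diag_bounds :
  \sum_(n < p) half_sqr n <=
  \sum_(m < p) \sum_(k < p) half_div m * half_div k * ((k%:R / m%:R : F) ^+ 2 == 1)%:R
  <= \sum_(n < p) half_sqr n + 2 * (1 + ln p%:R) / p%:R.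
Proof.
have E (m : 'I_p) : \sum_(k < p) half_div m * half_div k * ((k%:R / m%:R : F) ^+ 2 == 1)%:R =
    half_sqr m + half_div m * half_div (p - m)%N.
  have [m0|m0] := eqVneq (m : nat) 0%N.
    rewrite m0 [half_sqr 0](_ : _ = 0) ?half_div0 ?mul0r ?addr0; last by rewrite /half_sqr -/(half_div 0) half_div0 expr0n.
    by rewrite big1 // => k _; rewrite !mul0r.
  have mp : (p - m < p)%N by lia.
  have mm : Ordinal mp != m by apply/eqP => /(congr1 (@nat_of_ord _)) /=; have := ltn_ord m; lia.
  rewrite (bigD1 m) // (bigD1 (Ordinal mp)) // !sqr_ratio_eq1 //= !eqxx orbT /= !mulr1.
  rewrite /half_sqr -/(half_div m) expr2 big1 ?addr0 // => k /andP[km kmp].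
  have k1 : (k == m :> nat) = false by apply: negbTE; apply: contra km => /eqP kE; apply/eqP/val_inj.
  have k2 : (k == p - m :> nat)%N = false by apply: negbTE; apply: contra kmp => /eqP kE; apply/eqP/val_inj.
  by rewrite sqr_ratio_eq1 // k1 k2 mulr0.
rewrite (eq_bigr _ (fun m _ => E m)) big_split /= lerDl lerD2l.
rewrite sumr_ge0 /=; last by move=> m _; rewrite mulr_ge0 ?half_div_ge0.
rewrite big_ord_recl /= half_div0 mul0r add0r.
have B m : (0 < m < p)%N -> half_div m * half_div (p - m)%N <= (m%:R^-1 + (p - m)%N%:R^-1) / p%:R.
  move=> mp; apply: le_trans (_ : m%:R^-1 * (p - m)%N%:R^-1 <= _).
    by apply: ler_pM; rewrite ?half_div_ge0 ?half_div_le.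
  have mR : m%:R != 0 :> R by rewrite pnatr_eq0; lia.
  have pmR : (p - m)%:R != 0 :> R by rewrite pnatr_eq0; lia.
  have -> : p%:R = m%:R + (p - m)%:R :> R by rewrite -natrD subnKC //; lia.
  have mpR : m%:R + (p - m)%:R != 0 :> R by rewrite -natrD subnKC ?pnatr_eq0 //; lia.
  by rewrite le_eqVlt; apply/orP; left; apply/eqP; field; rewrite mpR pmR mR.
rewrite -(big_mkord xpredT (fun i => half_div (bump 0 i) * half_div (p - bump 0 i)%N)).
rewrite -(big_add1 _ _ 0 p xpredT (fun i => half_div i * half_div (p - i)%N)).
apply: le_trans (_ : \sum_(1 <= m < p) (m%:R^-1 + (p - m)%N%:R^-1) / p%:R <= _).
  by rewrite !big_nat; apply: ler_sum => m mp; exact: B.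
rewrite -big_distrl /= ler_wpM2r ?invr_ge0 ?ler0n // big_split /=.
have -> : \sum_(1 <= m < p) (p - m)%:R^-1 = \sum_(1 <= m < p) m%:R^-1 :> R.
  rewrite [RHS]big_nat_rev /=; apply: eq_big_nat => m mp; congr (_%:R^-1); lia.
have : \sum_(1 <= m < p) m%:R^-1 <= 1 + ln p%:R :> R.
  apply: le_trans (harmonic_le (ltn0Sn (2 * h))).
  rewrite -(big_mkord xpredT (fun k => k%:R^-1)) [X in _ <= X]big_nat_recr //=.
  by rewrite [X in _ <= X + _]big_ltn // invr0 add0r lerDl invr_ge0 ler0n.
move: (\sum_(1 <= m < p) _) (ln _) => x y; lra.
Qed.

Lemma sqr_sum_half_div_le : (\sum_(m < p) half_div m) ^+ 2 <= 1 + 2 * ln p%:R.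
Proof.
apply: le_trans (sqr_sum_half_coef_le p) _; have pp : (0 < p * p)%N by [].
apply: le_trans (_ : \sum_(k < (p * p).+1) (k : nat)%:R^-1 <= _).
  by rewrite [X in _ <= X]big_ord_recr /= lerDl invr_ge0 ler0n.
apply: le_trans (harmonic_le pp) _.
by rewrite natrM lnM ?ltr0n // lerD2l mulr_natl mulr2n.
Qed.

Variables (g : F) (gP : (2 * h).-primitive_root g).
Local Notation chi := (dlog_char h g).
Local Notation half_poly := (half_poly h g).

(** Orthogonality over [j] retains only [z m = k]. The index 0, where the quotient would be
    meaningless, has weight [half_div 0 = 0]. *)
Lemma sum_char_half_poly (u : F -> R) :
  \sum_(j < 2 * h) (\sum_z chi j z * RtoC (u z)) * (half_poly j * Cconj (half_poly j)) =
  RtoC ((2 * h)%:R * \sum_(m < p) \sum_(k < p) half_div m * half_div k * u (k%:R / m%:R)).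
Proof.
transitivity (\sum_(m < p) \sum_(k < p) \sum_z \sum_(j < 2 * h)
    RtoC (half_div m * half_div k * u z) * (chi j (z * m%:R) * Cconj (chi j k%:R))).
  rewrite [RHS]exchange_big; rewrite [RHS](eq_bigr (fun k : 'I_p => \sum_(j < 2 * h) \sum_z \sum_(m < p)
    RtoC (half_div m * half_div k * u z) * (chi j (z * m%:R) * Cconj (chi j k%:R)))) => [|k _]; last first.
    rewrite [RHS]exchange_big [LHS]exchange_big /=; apply: eq_bigr => z _; exact: exchange_big.
  rewrite [RHS]exchange_big /=; apply: eq_bigr => j _.
  rewrite [RHS]exchange_big /= big_distrl /=; apply: eq_bigr => z _.
  rewrite {1}/half_poly big_distrl big_distrr /= [RHS]exchange_big /=; apply: eq_bigr => m _.
  rewrite /half_poly rmorph_sum !big_distrr /=; apply: eq_bigr => k _.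
  have conjE : Cconj (chi j k%:R * RtoC (half_coef k / k%:R)) = Cconj (chi j k%:R) * RtoC (half_div k).
    by rewrite [LHS]rmorphM /=; congr (_ * _); apply: injective_projections => //=; rewrite Ropp_0.
  rewrite conjE -/(half_div m) (chiM charF cardF gP) !rmorphM /=; ring.
rewrite rmorphM rmorph_nat rmorph_sum big_distrr /=; apply: eq_bigr => m _.
rewrite rmorph_sum big_distrr /=; apply: eq_bigr => k _.
have [m0|m0] := eqVneq (m : nat) 0%N.
  rewrite m0 half_div0 !mul0r rmorph0 mulr0 big1 // => z _.
  by rewrite big1 // => j _; rewrite mul0r rmorph0 mul0r.
have [k0|k0] := eqVneq (k : nat) 0%N.
  rewrite k0 half_div0 mulr0 !mul0r rmorph0 mulr0 big1 // => z _.
  by rewrite big1 // => j _; rewrite mul0r rmorph0 mul0r.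
have mF := natr_neq0 m0; have kF := natr_neq0 k0.
under eq_bigr => z _ do rewrite -big_distrr /= (sum_chi_conj charF cardF gP).
rewrite (bigD1 (k%:R / m%:R)) //= divfK // kF eqxx /= big1 ?addr0 => [|z zP]; first by rewrite mulrC.
rewrite (_ : (z * m%:R == k%:R) = false) ?andbF ?mulr0 //; apply: contraNF zP => /eqP <-.
by rewrite mulfK.
Qed.

End MainSum.

(** Here [A] is the moment, [A'] the same with [half_poly] in place of [L1], [T] is [weight_sum],
    [D] its diagonal, [f] the sum of [half_sqr] below [p], [c] the constant [C_const], and [P], [x],
    [t], [l] stand for $p$, $p - 1$, $\sqrt p$, $\ln p$. The four errors have constants 640, 192,
    2550 and 80, within 4000. *)
Lemma sixth_moment_arith (A A' T D f l c t P x : R) :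
  P = x + 1 -> 5 <= P -> 1 <= l -> 1 <= t -> 0 <= f -> f <= 2 ->
  f <= c -> c <= f + 2 / P -> f <= D -> D <= f + 2 * (1 + l) / P ->
  `|A - A'| <= 64 * P ^+ 3 * (t * (1 + l) + 8) ->
  `|A' - x * T| <= 64 * P ^+ 3 * (1 + 2 * l) ->
  `|T - 10 * P ^+ 3 * D| <= 850 * P ^+ 2 * t * (1 + 2 * l) ->
  `|A - 10 * c * P ^+ 4| <= 4000 * (P ^+ 3 * t) * l.
Proof.
move=> PE P5 l1 t1 f0 f2 c1 c2 d1 d2 e1 e2 e3.
have P0 : 0 < P by lra.
have x0 : 0 <= x by lra.
have {}c2 : P * (c - f) <= 2 by rewrite mulrC -ler_pdivlMr //; lra.
have {}d2 : P * (D - f) <= 2 * (1 + l) by rewrite mulrC -ler_pdivlMr //; lra.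
have Pc : 0 <= P * (c - f) by apply: mulr_ge0; lra.
have Pd : 0 <= P * (D - f) by apply: mulr_ge0; lra.
have D4 : D - f <= 2 * (1 + l).
  apply: le_trans d2; rewrite ler_peMl //; lra.
have e4 : `|x * D - c * P| <= 8 * l.
  have -> : x * D - c * P = P * (D - f) - P * (c - f) - D by rewrite PE; ring.
  by rewrite ler_norml; apply/andP; split; lra.
have Y0 : 0 <= P ^+ 3 by rewrite exprn_ge0 // ltW.
have lt1 : l <= t * l by rewrite ler_peMl //; lra.
have tt1 : t <= t * l by rewrite ler_peMr //; lra.
have b1 : `|A - A'| <= P ^+ 3 * (640 * (t * l)).
  apply: le_trans e1 _; rewrite [64 * _]mulrC -mulrA ler_wpM2l //; lra.
have b2 : `|A' - x * T| <= P ^+ 3 * (192 * (t * l)).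
  apply: le_trans e2 _; rewrite [64 * _]mulrC -mulrA ler_wpM2l //; lra.
have b3 : `|x * (T - 10 * P ^+ 3 * D)| <= P ^+ 3 * (2550 * (t * l)).
  rewrite normrM (ger0_norm x0); apply: le_trans (_ : P * (850 * P ^+ 2 * t * (1 + 2 * l)) <= _).
    by apply: ler_pM => //; lra.
  have -> : P * (850 * P ^+ 2 * t * (1 + 2 * l)) = P ^+ 3 * (850 * t + 1700 * (t * l)) by ring.
  rewrite ler_wpM2l //; lra.
have b4 : `|10 * P ^+ 3 * (x * D - c * P)| <= P ^+ 3 * (80 * (t * l)).
  have triple_sum : 0 <= 10 * P ^+ 3 by rewrite mulr_ge0 ?ler0n.
  rewrite normrM (ger0_norm triple_sum) [10 * _]mulrC -mulrA ler_wpM2l //; lra.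
have -> : A - 10 * c * P ^+ 4 = (A - A') + (A' - x * T) + x * (T - 10 * P ^+ 3 * D)
   + 10 * P ^+ 3 * (x * D - c * P) by ring.
apply: le_trans (ler_normD _ _) _; apply: le_trans (lerD (ler_normD _ _) (lexx _)) _.
apply: le_trans (lerD (lerD (ler_normD _ _) (lexx _)) (lexx _)) _.
apply: le_trans (lerD (lerD (lerD b1 b2) b3) b4) _.
have -> : 4000 * (P ^+ 3 * t) * l = P ^+ 3 * (4000 * (t * l)) by ring.
rewrite -!mulrDr ler_wpM2l //; lra.
Qed.

Lemma inv_pred_le (x : R) : 1 <= x -> x^-1 <= 2 / (x + 1).
Proof.
move=> x1; have x0 : 0 < x by lra.
have x2 : 0 < x + 1 by lra.
rewrite ler_pdivlMr // mulrC ler_pdivrMr //; lra.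
Qed.

Section Asymptotics.
Variables (F : finFieldType) (h : nat) (charF : (2 * h).+1 \in [pchar F]) (cardF : #|F| = (2 * h).+1).
Hypothesis (evenh : ~~ odd h).
Variables (g : F) (gP : (2 * h).-primitive_root g).
Variables (psi : F -> C).
Hypotheses (psi0 : psi 0 = 1) (psi1 : psi 1 != 1) (psiD : forall x y, psi (x + y) = psi x * psi y)
  (psi_conj : forall x, Cconj (psi x) = psi (- x)).
Local Notation p := (2 * h).+1.
Local Notation chi := (dlog_char h g).
Local Notation U := (sixth_kernel h psi).
Local Notation half_poly := (half_poly h g).
Local Notation s := (`|leg_gauss_re psi|).
Local Notation G := (quad_gauss h g psi).

Lemma s_sqr : s ^+ 2 = p%:R.
Proof. by rewrite real_normK ?num_real // (leg_gauss_re_sqr charF cardF evenh psi0 psi1 psiD psi_conj). Qed.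

Lemma s_ge1 : 1 <= s.
Proof. exact: (leg_gauss_re_ge1 charF cardF evenh psi0 psi1 psiD psi_conj). Qed.

Lemma s_le_p : s <= p%:R.
Proof. by rewrite -s_sqr expr2 ler_peMl // s_ge1. Qed.

Lemma Cmod_nat (n : nat) : Cmod n%:R = n%:R.
Proof. by rewrite -(rmorph_nat RtoC) Cmod_RtoC ger0_norm ?ler0n. Qed.

Lemma chi_trivial (x : F) : x != 0 -> chi 0 x = 1.
Proof. by move=> x0; rewrite /dlog_char (negPf x0) mul0n expr0. Qed.

(** Orthogonality includes the principal character, where the kernel does not represent [|G|^6] but
    its transform is still the cube in [sum_char_sixth_kernel]. There [leg_char_sum] is -2, namely
    -1 from the complete sum less the term at 0, so the base of the cube is at most
    [2 p + 2 s <= 4 p]. *)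
Lemma trivial_term_bound (n : F) : n != 0 ->
  Cmod (\sum_z chi 0 z * RtoC (U n z)) <= 64 * p%:R ^+ 3.
Proof.
move=> n0; rewrite (sum_char_sixth_kernel charF cardF evenh gP psi0 psi1 psiD psi_conj) //.
have SE : leg_char_sum h g 0 = - 2.
  rewrite /leg_char_sum (bigD1 0) //= chi0 mul0r add0r.
  rewrite (eq_bigr (fun z : F => (leg_sub1 z)%:~R)) => [|z z0]; last by rewrite chi_trivial // mul1r.
  have := sum_leg_sqr_sub charF cardF (oner_neq0 F).
  rewrite (bigD1 0) //= expr0n /= sub0r (legN1 charF cardF evenh) => E.
  rewrite -rmorph_sum /= (_ : \sum_(z | z != 0) leg_sub1 z = -2) ?rmorphN ?rmorph_nat //.
  by move: E; rewrite /leg_sub1; move: (\sum_(_ | _) _) => x; lia.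
rewrite SE chi_trivial ?oppr_eq0 ?oner_neq0 // CmodX.
have -> : 64 * p%:R ^+ 3 = (4 * p%:R) ^+ 3 :> R by ring.
rewrite lerXn2r ?nnegrE ?Cmod_nonneg ?mulr_ge0 ?ler0n //.
apply: le_trans (CmodD _ _) _.
have gsE : Cmod (leg_gauss psi) = s by rewrite -(leg_gauss_reE charF cardF evenh psi_conj) Cmod_RtoC.
have lE : Cmod ((legendre n)%:~R) <= 1.
  rewrite -(rmorph_int RtoC) Cmod_RtoC; exact: (@norm_intr_le _ 1%N (norm_leg_le1 n)).
rewrite !CmodM gsE CmodN !Cmod_nat.
have := s_le_p; have := s_ge1; have := Cmod_nonneg ((legendre n)%:~R : C); nra.
Qed.

Definition weight_sum (n : F) : R := \sum_(m < p) \sum_(k < p) half_div m * half_div k * U n (k%:R / m%:R).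

Lemma Cmod_half_poly_sqr_le j : Cmod (half_poly j) ^+ 2 <= 1 + 2 * ln p%:R.
Proof.
apply: le_trans (sqr_sum_half_div_le h); rewrite lerXn2r ?nnegrE ?Cmod_nonneg //.
  by apply: sumr_ge0 => m _; exact: half_div_ge0.
apply: le_trans (Cmod_sum _ _ _) _; apply: ler_sum => m _.
rewrite CmodM Cmod_RtoC ger0_norm ?half_div_ge0 // -[X in _ <= X]mul1r ler_wpM2r ?half_div_ge0 //.
exact: (Cmod_chi_le1 charF cardF gP).
Qed.

Lemma sum_gauss_half_poly_bound (n : F) : n != 0 ->
  `|\sum_(j < 2 * h | (0 < j)%N) Cmod (G n j) ^+ 6 * Cmod (half_poly j) ^+ 2 - (2 * h)%:R * weight_sum n|
   <= 64 * p%:R ^+ 3 * (1 + 2 * ln p%:R).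
Proof.
move=> n0; set A := \sum_(j < _ | _) _.
have j0 := p1_gt0 charF cardF.
have E := sum_char_half_poly charF cardF gP (U n).
have AD : A = \sum_(j < 2 * h | j != Ordinal j0) Cmod (G n j) ^+ 6 * Cmod (half_poly j) ^+ 2.
  by apply: eq_bigl => j; rewrite -val_eqE /= lt0n.
have AE : RtoC (A - (2 * h)%:R * weight_sum n) =
   - ((\sum_z chi 0 z * RtoC (U n z)) * RtoC (Cmod (half_poly 0) ^+ 2)).
  rewrite rmorphB /= -/(weight_sum n) -E (bigD1 (Ordinal j0)) //= sqr_Cmod AD rmorph_sum.
  rewrite opprD addrCA -sumrB [X in _ + X]big1 ?addr0 // => j jP.
  rewrite rmorphM /= sqr_Cmod (Cmod_quad_gauss_six charF cardF evenh gP psi0 psi1 psiD psi_conj) ?subrr //.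
  by rewrite ltn_ord andbT lt0n; move: jP; rewrite -val_eqE.
rewrite -Cmod_RtoC AE CmodN CmodM Cmod_RtoC (ger0_norm (sqr_ge0 _)).
by apply: ler_pM; rewrite ?Cmod_nonneg ?sqr_ge0 ?trivial_term_bound ?Cmod_half_poly_sqr_le.
Qed.

Lemma weight_sum_bound (n : F) : n != 0 ->
  `|weight_sum n - 10 * p%:R ^+ 3 *
    \sum_(m < p) \sum_(k < p) half_div m * half_div k * ((k%:R / m%:R : F) ^+ 2 == 1)%:R| <=
  850 * p%:R ^+ 2 * s * (1 + 2 * ln p%:R).
Proof.
move=> n0; rewrite /weight_sum big_distrr -sumrB /=.
have p2 : 0 <= 850 * p%:R ^+ 2 * s by rewrite !mulr_ge0 ?ler0n.
apply: le_trans (ler_norm_sum _ _ _) _.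
apply: le_trans (_ : \sum_(m < p) \sum_(k < p) half_div m * half_div k * (850 * p%:R ^+ 2 * s) <= _).
  apply: ler_sum => m _; rewrite big_distrr -sumrB /=; apply: le_trans (ler_norm_sum _ _ _) _.
  apply: ler_sum => k _.
  have [m0|m0] := eqVneq (m : nat) 0%N; first by rewrite m0 half_div0 !mul0r mulr0 subrr normr0.
  have [k0|k0] := eqVneq (k : nat) 0%N; first by rewrite k0 half_div0 !mulr0 !mul0r mulr0 subrr normr0.
  have D (a b c d : R) : a * b - c * (a * d) = a * (b - c * d) by ring.
  have x0 : 0 <= half_div m * half_div k by rewrite mulr_ge0 ?half_div_ge0.
  rewrite D normrM (ger0_norm x0) ler_wpM2l //.
  apply: (sixth_kernel_bound charF cardF evenh psi0 psi1 psiD psi_conj) => //.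
  by rewrite mulf_neq0 ?invr_neq0 ?(natr_neq0 charF).
under eq_bigr => m _ do rewrite -big_distrl /= -big_distrr /=.
rewrite -big_distrl /= -big_distrl /= -expr2 mulrC ler_wpM2l //; exact: sqr_sum_half_div_le.
Qed.

Lemma sum_natr (f : F -> C) : \sum_(k < p) f k%:R = \sum_x f x.
Proof.
rewrite [RHS](reindex (fun k : 'I_p => (k : nat)%:R)) //.
by apply: onW_bij; exact: (natr_ord_bij charF cardF).
Qed.

Lemma p_ge5 : (5 <= p)%N.
Proof. have := h_gt0 charF cardF; move: evenh; case: (h) => [|[|k]] //; lia. Qed.

Lemma L1_chi_tail j : (0 < j < 2 * h)%N ->
  Cmod (L1 (fun k => chi j k%:R) - Lpart (fun k => chi j k%:R) (p * p)) <= 8 / p%:R.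
Proof.
move=> jh; have p5 := p_ge5.
(* [L1_tail] is applied at [p^2 - 2] because it speaks of [Lpart M.+2]; then
   [4 p / (p^2 - 2) <= 8 / p]. *)
have M0 : (0 < p * p - 2)%N by nia.
have ME : ((p * p - 2).+2 = p * p)%N by nia.
have := @L1_tail (fun k => chi j k%:R) p _ _ _ _ _ M0; rewrite ME => H.
apply: le_trans (H _ _ _ _) _ => //.
- by move=> k; exact: (Cmod_chi_le1 charF cardF gP).
- by move=> k; rewrite natrD (pcharf0 charF) addr0.
- by rewrite (sum_natr (chi j)) (chi_sum charF cardF gP).
rewrite ler_pdivrMr ?ltr0n // mulrAC ler_pdivlMr ?ltr0n //.
rewrite -!natrM ler_nat; nia.
Qed.

(** The Gauss sums are bounded pointwise by [(4 p)^3 = 64 p^3], leaving the mean distance of [L1]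
    from [half_poly ^+ 2]. The 8 collects the tails [8 / p] over fewer than [p] characters. *)
Lemma sum_gauss_L1_sub_half_poly (n : F) : n != 0 ->
  `|\sum_(j < 2 * h | (0 < j)%N) Cmod (G n j) ^+ 6 * Cmod (L1 (fun k => chi j k%:R)) -
    \sum_(j < 2 * h | (0 < j)%N) Cmod (G n j) ^+ 6 * Cmod (half_poly j) ^+ 2| <=
  64 * p%:R ^+ 3 * (s * (1 + ln p%:R) + 8).
Proof.
move=> n0; rewrite -sumrB; apply: le_trans (ler_norm_sum _ _ _) _.
pose B (j : nat) : R := Cmod (Lpart (fun k => chi j k%:R) (p * p) - half_poly j ^+ 2).
have P3 : 0 <= 64 * p%:R ^+ 3 :> R by rewrite mulr_ge0 ?exprn_ge0 ?ler0n.
apply: le_trans (_ : \sum_(j < 2 * h | (0 < j)%N) 64 * p%:R ^+ 3 * (B j + 8 / p%:R) <= _).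
  apply: ler_sum => j j0; have jh : (0 < j < 2 * h)%N by rewrite j0 ltn_ord.
  rewrite -mulrBr normrM; apply: ler_pM => //.
    rewrite ger0_norm ?exprn_ge0 ?Cmod_nonneg // -[6%N]/(2 * 3)%N exprM.
    have -> : 64 * p%:R ^+ 3 = (4 * p%:R) ^+ 3 :> R by ring.
    rewrite lerXn2r ?nnegrE ?sqr_ge0 ?mulr_ge0 ?ler0n //.
    exact: (Cmod_quad_gauss_bound charF cardF gP psi0 psi1 psiD psi_conj).
  rewrite -CmodX; apply: le_trans (Cmod_dist _ _) _.
  rewrite -[X in Cmod X](subrKA (Lpart (fun k => chi j k%:R) (p * p))) addrC.
  by apply: le_trans (CmodD _ _) _; apply: lerD => //; exact: L1_chi_tail.
rewrite -big_distrr /= ler_wpM2l //; apply: le_trans (_ : \sum_(j < 2 * h) (B j + 8 / p%:R) <= _).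
  rewrite big_mkcond; apply: ler_sum => j _; case: ifP => // _.
  by rewrite addr_ge0 ?Cmod_nonneg ?divr_ge0 ?ler0n.
rewrite big_split /=; apply: lerD.
  apply: (sum_Cmod_Lpart_sub_half_poly charF cardF gP); last exact: s_sqr.
  by apply: lt_le_trans s_ge1.
rewrite sumr_const card_ord -[_ *+ (2 * h)]mulr_natl mulrCA -[X in _ <= X]mulr1 ler_wpM2l ?ler0n //.
by rewrite ler_pdivrMr ?ltr0n // mul1r ler_nat.
Qed.

Lemma sixth_moment_bound (n : F) : n != 0 -> 1 <= ln p%:R ->
  `|\sum_(j < 2 * h | (0 < j)%N) Cmod (G n j) ^+ 6 * Cmod (L1 (fun k => chi j k%:R)) -
    10 * C_const * p%:R ^+ 4| <= 4000 * (p%:R ^+ 3 * s) * ln p%:R.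
Proof.
move=> n0 l1.
have e1 := sum_gauss_L1_sub_half_poly n0.
have e2 := sum_gauss_half_poly_bound n0.
have e3 := weight_sum_bound n0.
have /andP[d1 d2] := sum_half_div_diag_bounds charF cardF.
have [c1 c2] := C_const_bounds (p1_gt0 charF cardF).
have f2 := sum_half_sqr_le2 p.
have f0 : 0 <= \sum_(k < p) half_sqr k by apply: sumr_ge0 => k _; exact: half_sqr_ge0.
have pE : p%:R = (2 * h)%:R + 1 :> R by rewrite natr1.
have c3 : C_const <= \sum_(k < p) half_sqr k + 2 / p%:R.
  have h1 : 1 <= (2 * h)%:R :> R by rewrite ler1n (p1_gt0 charF cardF).
  have iv : ((2 * h)%:R)^-1 <= 2 / p%:R :> R by rewrite pE; exact: inv_pred_le.
  exact: le_trans c2 (lerD (lexx _) iv).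
apply: (sixth_moment_arith pE _ l1 s_ge1 f0 f2 c1 c3 d1 d2 e1 e2 e3).
by rewrite ler_nat; exact: p_ge5.
Qed.

End Asymptotics.

(** * Passage from the finite field to characters and exponentials on integers *)

Lemma e_Z (z : Z) : e_ (IZR z) = 1.
Proof.
have e_ofnat (m : nat) : e_ (IZR (Z.of_nat m)) = 1 by rewrite -INR_IZR_INZ INRE e_nat.
have [z0|z0] := Z_lt_le_dec z 0; last by rewrite -(Z2Nat.id z z0) e_ofnat.
have -> : IZR z = - IZR (Z.of_nat (Z.to_nat (- z))).
  by rewrite Z2Nat.id; [rewrite opp_IZR RoppE opprK | lia].
by rewrite -e_conj e_ofnat rmorph1.
Qed.

Lemma Nat_gcd_prime (q a : nat) : prime q -> Nat.gcd a q <> 1%N <-> (q %| a)%N.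
Proof.
move=> pq; have [u uE] := Nat.gcd_divide_r a q; have [w wE] := Nat.gcd_divide_l a q.
have dq : (Nat.gcd a q %| q)%N by apply/dvdnP; exists u.
move: pq => /primeP[q1 /(_ _ dq)] b; split=> [d1|/dvdnP[k ak] d1].
  case/orP: b => /eqP // dE; apply/dvdnP; exists w; rewrite {1}wE dE //.
have := Nat.gcd_greatest a q q; rewrite d1 => H.
have [v vE] := H (ex_intro _ k ak) (Nat.divide_refl q).
have : (q %| 1)%N by apply/dvdnP; exists v.
by rewrite dvdn1; lia.
Qed.

Lemma fold_right_big (f : (nat -> C) -> R) (X : nat -> nat -> C) (r : list nat) :
  fold_right (fun chi acc => f chi + acc) 0 (List.map X r) = \sum_(j <- r) f (X j).
Proof. by elim: r => [|j r IH]; rewrite ?big_nil // big_cons -IH. Qed.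

Lemma fold_right_perm (f : (nat -> C) -> R) (l l' : list (nat -> C)) : Permutation l l' ->
  fold_right (fun chi acc => f chi + acc) 0 l = fold_right (fun chi acc => f chi + acc) 0 l'.
Proof.
elim=> [//|x l1 l2 _ IH|x y l1|l1 l2 l3 _ IH1 _ IH2] /=; first by rewrite IH.
  by rewrite addrCA.
by rewrite IH1.
Qed.

Lemma In_iota m n k : List.In k (iota m n) <-> (m <= k < m + n)%N.
Proof.
rewrite -mem_iota; elim: (iota m n) => [|x r IH] /=; first by [].
rewrite inE; split=> [[->|/IH->]|/orP[/eqP->|/IH]]; rewrite ?eqxx ?orbT //; by [left|right].
Qed.

Lemma NoDup_map_iota (X : nat -> nat -> C) m n :
  (forall i j, (m <= i < m + n)%N -> (m <= j < m + n)%N -> X i = X j -> i = j) ->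
  NoDup (List.map X (iota m n)).
Proof.
elim: n m => [|n IH] m inj /=; first exact: NoDup_nil.
apply: NoDup_cons.
  move=> /List.in_map_iff [k [kE /In_iota kin]].
  have : k = m by apply: inj => //; lia.
  by lia.
by apply: IH => i j ih jh; apply: inj; lia.
Qed.

Section AdditiveCharacter.
Variables (F : finFieldType) (h : nat) (charF : (2 * h).+1 \in [pchar F]) (cardF : #|F| = (2 * h).+1).
Local Notation p := (2 * h).+1.

Definition nrep (x : F) : nat := if [pick k : 'I_p | (k : nat)%:R == x] is Some k then k else 0%N.

Lemma nrepK (x : F) : (nrep x)%:R = x.
Proof.
rewrite /nrep; case: pickP => [k /eqP//|none].
by have [fi _ Kf] := natr_ord_bij charF cardF; have := none (fi x); rewrite Kf eqxx.
Qed.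

Definition add_char (x : F) : C := e_ ((nrep x)%:R / p%:R).

Lemma add_char_nat (m : nat) : add_char m%:R = e_ (m%:R / p%:R).
Proof.
have /eqP : nrep m%:R == m %[mod p] by rewrite -(natr_eq_mod charF) nrepK.
have red (k : nat) : e_ (k%:R / p%:R) = e_ ((k %% p)%N%:R / p%:R).
  have p0 : p%:R != 0 :> R by rewrite pnatr_eq0.
  by rewrite {1}(divn_eq k p) natrD natrM mulrDl mulfK // e_D e_nat mul1r.
by rewrite /add_char (red m) (red (nrep _)) => ->.
Qed.

Lemma add_char0 : add_char 0 = 1.
Proof. by rewrite -[0 : F]/(0%:R) add_char_nat mul0r e_0. Qed.

Lemma add_charD x y : add_char (x + y) = add_char x * add_char y.
Proof. by rewrite -(nrepK x) -(nrepK y) -natrD !add_char_nat natrD mulrDl e_D. Qed.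

Lemma add_char_conj x : Cconj (add_char x) = add_char (- x).
Proof.
have H : Cconj (add_char x) * add_char x = 1 by rewrite /add_char e_conj -e_D addNr e_0.
have H' : add_char (- x) * add_char x = 1 by rewrite -add_charD addNr add_char0.
have c0 : add_char x != 0 by apply: contra_eq_neq H => ->; rewrite mulr0 eq_sym oner_neq0.
by apply: (mulIf c0); rewrite H H'.
Qed.

Lemma add_char1 : add_char 1 != 1.
Proof.
rewrite -[1 : F]/(1%:R) add_char_nat; apply: e_neq1; first by rewrite divr_gt0 ?ltr0n.
rewrite ltr_pdivrMr ?ltr0n // mul1r ltr1n; have := h_gt0 charF cardF; lia.
Qed.

Definition F_of_Z (n : Z) : F := (Z.to_nat (Z.modulo n (Z.of_nat p)))%:R.

Lemma e_F_of_Z (n : Z) (k : nat) : e_ (Rdiv (Rmult (IZR n) (INR k)) (INR p)) = add_char (F_of_Z n * k%:R).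
Proof.
rewrite /F_of_Z -natrM add_char_nat !INRE; set m := Z.to_nat _.
have mE : n = Z.add (Z.of_nat m) (Z.mul (Z.of_nat p) (Z.div n (Z.of_nat p))).
  rewrite /m Z2Nat.id; first by rewrite Z.add_comm -Z_div_mod_eq_full.
  by have [] := Z_mod_lt n (Z.of_nat p) ltac:(lia).
have p0 : p%:R != 0 :> R by rewrite pnatr_eq0.
have -> : Rdiv (Rmult (IZR n) k%:R) p%:R = (m * k)%N%:R / p%:R + IZR (Z.mul (Z.div n (Z.of_nat p)) (Z.of_nat k)).
  rewrite RdivE RmultE {1}mE plus_IZR !mult_IZR -!INR_IZR_INZ !INRE natrM.
  by rewrite RplusE !RmultE; move: (p%:R : R) p0 => P P0; field.
by rewrite e_D e_Z mulr1.
Qed.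

Lemma F_of_Z_neq0 (n : Z) : Z.gcd n (Z.of_nat p) = Zpos 1 -> F_of_Z n != 0.
Proof.
move=> gn; rewrite /F_of_Z (natr_eq0 charF); apply/negP => /dvdnP[k kE].
have pz : Z.of_nat p <> Z0 by lia.
have : Z.divide (Z.of_nat p) n.
  apply/Z.mod_divide => //.
  have [m0 m1] := Z_mod_lt n (Z.of_nat p) ltac:(lia).
  have : (Z.to_nat (Z.modulo n (Z.of_nat p)) < p)%N by lia.
  by rewrite kE; case: k kE => [|k] kE; [lia | rewrite mulSn; lia].
move=> pn; have := Z.gcd_greatest _ _ _ pn (Z.divide_refl _); rewrite gn => /Z.divide_1_r.
have := h_gt0 charF cardF; lia.
Qed.

Variables (g : F) (gP : (2 * h).-primitive_root g).
Local Notation chi := (dlog_char h g).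

Definition dchar (j : nat) : nat -> C := fun a => chi j a%:R.

Lemma chi_eq0 j (x : F) : chi j x = 0 <-> x = 0.
Proof.
split=> [c0|->]; last exact: chi0.
apply/eqP; apply: contraT => x0; have := chi1 charF cardF gP j.
by rewrite -(mulfV x0) (chiM charF cardF gP) c0 mul0r => /eqP; rewrite eq_sym oner_eq0.
Qed.

Lemma dchar_is_dchar j : is_dchar p (dchar j).
Proof.
have pp := pcharf_prime charF.
split; first by move=> a; rewrite /dchar natrD (pcharf0 charF) addr0.
split; first by move=> a b; rewrite /dchar natrM (chiM charF cardF gP).
split; first exact: (chi1 charF cardF gP).
move=> a; rewrite Nat_gcd_prime // -(natr_eq0 charF); split.
  by move/chi_eq0 => ->.
by move/eqP => a0; apply/chi_eq0.
Qed.

Lemma dchar0 : dchar 0 = principal_char p.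
Proof.
apply: functional_extensionality => a; rewrite /dchar /principal_char.
have pp := pcharf_prime charF; have := Nat_gcd_prime a pp; rewrite -(natr_eq0 charF).
case: (Nat.eqb_spec (Nat.gcd a p) 1) => [->|ne] [H1 H2].
  by apply: chi_trivial; apply/negP => /H2.
by move/H1: ne => /eqP ->; rewrite chi0.
Qed.

Lemma dchar_inj i j : (i < 2 * h)%N -> (j < 2 * h)%N -> dchar i = dchar j -> i = j.
Proof.
move=> ih jh E; apply: (chi_inj charF cardF gP ih jh).
by have := congr1 (fun X => X (nrep g)) E; rewrite /dchar nrepK.
Qed.

(** Periodicity lets [X] descend to [F] through the representatives [nrep], and the classification
    on the field applies. *)
Lemma is_dchar_dchar X : is_dchar p X -> exists2 j, (j < 2 * h)%N & X = dchar j.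
Proof.
move=> [Xper [XM [X1 X0]]].
have Xmul a q : X (a + q * p)%N = X a.
  elim: q => [|q IH]; first by rewrite mul0n addn0.
  by rewrite mulSn addnCA addnC; have := Xper (a + q * p)%N; rewrite IH.
have Xmod a : X a = X (a %% p)%N by rewrite {1}(divn_eq a p) addnC Xmul.
have Xn a b : a%:R = b%:R :> F -> X a = X b.
  by move/eqP; rewrite (natr_eq_mod charF) => /eqP E; rewrite Xmod E -Xmod.
pose Y (x : F) := X (nrep x).
have YN a : Y a%:R = X a by apply: Xn; rewrite nrepK.
have [||x y|j jh Yj] := @chi_classification F h charF cardF g gP Y.
- rewrite -[0 : F]/(0%:R) YN; apply/X0; rewrite Nat.gcd_0_l; have := h_gt0 charF cardF; lia.
- by rewrite -[1 : F]/(1%:R) YN X1.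
- by rewrite -(nrepK x) -(nrepK y) -natrM !YN; exact: XM.
by exists j => //; apply: functional_extensionality => a; rewrite -YN Yj.
Qed.

Lemma gauss_sumE (n : Z) j : gauss_sum n (dchar j) p = quad_gauss h g add_char (F_of_Z n) j.
Proof.
(* [sum_n] includes its upper index, so the sum runs over the residues [k + 1] with [k < p]; a shift
   by 1 in [F] matches it with [quad_gauss]. *)
rewrite /gauss_sum (_ : Nat.sub p 1 = (2 * h)%N); last by lia.
rewrite sum_n_bigC /quad_gauss [RHS](reindex_inj (addrI 1)).
rewrite -(sum_natr charF cardF (fun x => chi j (1 + x) * add_char (F_of_Z n * (1 + x) ^+ 2))).
apply: eq_bigr => k _; cbv beta; rewrite e_F_of_Z /dchar [1 + _]addrC natr1 expr2 -natrM //.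
Qed.

(** Membership and absence of repetition determine [l] up to order, so it is a permutation of the
    characters of index 1 to [2 h - 1], and the fold does not depend on the order. *)
Lemma char_sumE (n : Z) (l : list (nat -> C)) : NoDup l ->
  (forall X, List.In X l <-> (is_dchar p X /\ X <> principal_char p)) ->
  char_sum n p l =
  \sum_(j < 2 * h | (0 < j)%N) Cmod (quad_gauss h g add_char (F_of_Z n) j) ^+ 6 * Cmod (L1 (dchar j)).
Proof.
move=> nd lP.
have h0 := p1_gt0 charF cardF.
have P : Permutation l (List.map dchar (iota 1 (2 * h).-1)).
  apply: NoDup_Permutation => //.
    by apply: NoDup_map_iota => i j ih jh; apply: dchar_inj; lia.
  move=> X; rewrite lP List.in_map_iff; split.
    move=> [/is_dchar_dchar [j jh ->] Xp]; exists j; split=> //; apply/In_iota.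
    have : j <> 0%N by move=> j0; apply: Xp; rewrite j0 dchar0.
    lia.
  move=> [j [<- /In_iota jh]]; split; first exact: dchar_is_dchar.
  rewrite -dchar0 => /dchar_inj H; have : j = 0%N by apply: H; lia.
  lia.
pose f X := Rmult (pow (Cmod (gauss_sum n X p)) 6) (Cmod (L1 X)).
transitivity (fold_right (fun chi acc => f chi + acc) 0 l); first by [].
rewrite (fold_right_perm f P) fold_right_big.
rewrite -(big_mkord (fun j => (0 < j)%N) (fun j => Cmod (quad_gauss h g add_char (F_of_Z n) j) ^+ 6 * Cmod (L1 (dchar j)))).
rewrite big_ltn_cond //= /index_iota subn1 big_seq [RHS]big_seq_cond; apply: eq_big => j.
  by rewrite !mem_iota; apply/idP/idP; lia.
by rewrite /f gauss_sumE RpowE.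
Qed.

End AdditiveCharacter.

Lemma seven_halves : Rdiv (IZR 7) (IZR 2) = Rplus (INR 3) (Rinv (IZR 2)).
Proof.
rewrite INR_IZR_INZ; change (Z.of_nat 3) with (Zpos 3).
Stdlib.micromega.Lra.lra.
Qed.

Lemma Rpower_seven_halves (P t : R) : 0 < P -> 0 <= t -> t ^+ 2 = P -> Rpower P (Rdiv (IZR 7) (IZR 2)) = P ^+ 3 * t.
Proof.
move=> /RltP P0 t0 tP.
rewrite seven_halves.
rewrite Rpower_plus Rpower_pow // Rpower_sqrt // RpowE RmultE; congr (_ * _).
rewrite -tP -RpowE sqrt_pow2 //; exact/RleP.
Qed.

Lemma one_le_ln (P : R) : 3%:R <= P -> 1 <= ln P.
Proof.
move=> P3; apply/RleP; rewrite -[X in Rle X _]ln_exp.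
apply: ln_le; first exact: exp_pos.
apply: Rle_trans exp_le_3 _; apply/RleP; rewrite -[IZR 3](INR_IZR_INZ 3) INRE //.
Qed.

Theorem sixth_moment_asymptotic :
  exists K : R, forall (p : nat),
    Znumtheory.prime (Z.of_nat p) -> Nat.modulo p 4 = 1%N ->
    forall (n : Z), Z.gcd n (Z.of_nat p) = Zpos 1 ->
    forall (l : list (nat -> C)),
      NoDup l ->
      (forall chi : nat -> C,
          List.In chi l <-> (is_dchar p chi /\ chi <> principal_char p)) ->
      Rle (Rabs (Rminus (char_sum n p l) (Rmult (Rmult (IZR 10) C_const) (pow (INR p) 4))))
        (Rmult (Rmult K (Rpower (INR p) (Rdiv (IZR 7) (IZR 2)))) (ln (INR p))).
Proof.
exists (IZR 4000) => p /prime_natP pp p4 n gn l nd lP.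
have [h evenh pE] : exists2 h, ~~ odd h & p = (2 * h).+1.
  exists (p.-1./2); have := Nat.div_mod_eq p 4; rewrite p4; lia.
subst p; have charF := pchar_Fp pp; have cardF := card_Fp pp.
have [g gP] := ex_generator charF cardF.
have n0 := F_of_Z_neq0 charF cardF gn.
have p3 : 3%:R <= (2 * h).+1%:R :> R by rewrite ler_nat; have := prime_gt1 pp; lia.
have l1 := one_le_ln p3.
have := sixth_moment_bound charF cardF evenh gP (add_char0 charF cardF) (add_char1 charF cardF)
  (add_charD charF cardF) (add_char_conj charF cardF) n0 l1.
rewrite -(char_sumE charF cardF gP n nd lP).
have P0 : 0 < (2 * h).+1%:R :> R by rewrite ltr0n.
have s2 := s_sqr charF cardF evenh (add_char0 charF cardF) (add_char1 charF cardF) (add_charD charF cardF) (add_char_conj charF cardF).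
rewrite -(Rpower_seven_halves P0 (normr_ge0 _) s2) => H.
apply/RleP; rewrite !INRE RpowE.
have -> : IZR 4000 = 4000%:R by rewrite -INRE INR_IZR_INZ.
have -> : IZR 10 = 10%:R by rewrite -INRE INR_IZR_INZ.
exact: H.
Qed.

End SixthMoment.

Theorem theorem4 :
  exists K : R, forall (p : nat),
    prime (Z.of_nat p) -> (p mod 4 = 1)%nat ->
    forall (n : Z), Z.gcd n (Z.of_nat p) = 1%Z ->
    forall (l : list (nat -> C)),
      NoDup l ->
      (forall chi : nat -> C,
          In chi l <-> (is_dchar p chi /\ chi <> principal_char p)) ->
      Rabs (char_sum n p l - 10 * C_const * (INR p) ^ 4)
        <= K * Rpower (INR p) (7 / 2) * ln (INR p).
Proof.
  exact SixthMoment.sixth_moment_asymptotic.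
Qed.
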